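(* Let $\delta,\varepsilon\in(0,1]$ and suppose that $$G_{\delta,\varepsilon}>0\qquad\text{and}\qquad K_{\delta,\varepsilon}:=\frac{6L_*}{G_{\delta,\varepsilon}}<1 .$$ Then the renormalized fast-slow system $$\partial_tu+\delta^{-1}A_fu=f(u,v),\qquad \partial_tv+A_{s,\varepsilon}v=g(u,v)$$ possesses a finite-dimensional invariant Lipschitz graph (the slow manifold) $$\mathcal M_{\delta,\varepsilon}=\{J_{\delta,\varepsilon}(p):p\in P_\varepsilon\mathcal H\},\qquad J_{\delta,\varepsilon}(p)=\bigl(h^u_{\delta,\varepsilon}(p),\,p+h^q_{\delta,\varepsilon}(p)\bigr),$$ with $h^u_{\delta,\varepsilon}:P_\varepsilon\mathcal H\to\mathcal X$ and $h^q_{\delta,\varepsilon}:P_\varepsilon\mathcal H\to Q_\varepsilon\mathcal H$. The graph components satisfy $$\|h^u_{\delta,\varepsilon}\|_{L^\infty}\le\frac{M_f\,\delta}{\omega_f},\qquad \|h^q_{\delta,\varepsilon}\|_{L^\infty}\le\frac{M_g}{\alpha_\varepsilon}\le\frac{M_g\,\varepsilon^2}{\mu+\varepsilon},$$ and $$\operatorname{Lip}(h^u_{\delta,\varepsilon})+\operatorname{Lip}(h^q_{\delta,\varepsilon})\le\frac{4L_*}{(1-K_{\delta,\varepsilon})\,G_{\delta,\varepsilon}} .$$ Moreover, the dynamics on $\mathcal M_{\delta,\varepsilon}$ are conjugate through $J_{\delta,\varepsilon}$ to the finite-dimensional equation $$\dot p+A_sp=P_\varepsilon g\bigl(h^u_{\delta,\varepsilon}(p),\,p+h^q_{\delta,\varepsilon}(p)\bigr),\qquad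 p\in P_\varepsilon\mathcal H .$$
   Context: $\mathcal X$ and $\mathcal H$ are real Hilbert spaces, $\mathcal H$ infinite-dimensional; $\mathcal X\times\mathcal H$ carries the norm $\|(u,v)\|=\|u\|_{\mathcal X}+\|v\|_{\mathcal H}$. The fast operator $A_f:\mathrm D(A_f)\subset\mathcal X\to\mathcal X$ is self-adjoint with $A_f\ge\omega_fI$ for some $\omega_f>0$. The slow operator $A_s:\mathrm D(A_s)\subset\mathcal H\to\mathcal H$ is nonnegative self-adjoint with compact resolvent. The maps $f:\mathcal X\times\mathcal H\to\mathcal X$, $g:\mathcal X\times\mathcal H\to\mathcal H$ are globally bounded and globally Lipschitz; $M_f=\sup\|f\|_{\mathcal X}$, $M_g=\sup\|g\|_{\mathcal H}$, $L_*=\max\{\operatorname{Lip}(f),\operatorname{Lip}(g)\}$. Fix $\mu>0$. For $0<\varepsilon\le1$ let $\Lambda_\varepsilon=\mu\varepsilon^{-2}$, $P_\varepsilon=\mathbf 1_{[0,\Lambda_\varepsilon]}(A_s)$, $Q_\varepsilon=I-P_\varepsilon$, $A_{s,\varepsilon}=A_s+\varepsilon^{-1}Q_\varepsilon$ with $\mathrm D(A_{s,\varepsilon})=\mathrm D(A_s)$. Put $\beta_\varepsilon=\sup\sigma(A_s|_{P_\varepsilon\mathcal H})$ ($=0$ if $P_\varepsilon\mathcal H=\{0\}$), $\lambda_\varepsilon^+=\inf\sigma(A_s|_{Q_\varepsilon\mathcal H})$, $\alpha_\varepsilon=\lambda_\varepsilon^++\varepsilon^{-1}$. Define $a_{\delta,\varepsilon}=\min\{\omega_f\delta^{-1},\alpha_\varepsilon\}$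 and $G_{\delta,\varepsilon}=a_{\delta,\varepsilon}-\beta_\varepsilon$. Solutions are understood as mild solutions. (The paper also defines here the associated graph retraction $\mathcal R_{\delta,\varepsilon}(u,v)=J_{\delta,\varepsilon}(P_\varepsilon v)$.) *)

(* Defs.v *)
From Stdlib Require Export Reals ClassicalEpsilon.
From Coquelicot Require Export Coquelicot.
Set Implicit Arguments.
Unset Strict Implicit.
Open Scope R_scope.

Record Hilbert := {
  hilbert_space :> CompleteNormedModule R_AbsRing;
  inner : hilbert_space -> hilbert_space -> R;
  inner_sym : forall x y, inner x y = inner y x;
  inner_plus : forall x y z, inner (plus x y) z = inner x z + inner y z;
  inner_scal : forall (a : R) x y, inner (scal a x) y = a * inner x y;
  inner_norm : forall x, inner x x = norm x ^ 2
}.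
Arguments inner {h} _ _.

(* V is contained in the span of finitely many vectors; for a linear subspace V
   this is finite-dimensionality. *)
Definition finite_dimensional (H : Hilbert) (V : H -> Prop) : Prop :=
  exists (n : nat) (b : nat -> H), forall x, V x ->
    exists c : nat -> R, x = sum_n (fun k => scal (c k) (b k)) n.

Definition infinite_dimensional (H : Hilbert) : Prop :=
  ~ finite_dimensional (H := H) (fun _ => True).

(* The image of a map; for an orthogonal projection P, this is PH. *)
Definition range (H : Hilbert) (P : H -> H) : H -> Prop :=
  fun x => exists y, x = P y.

(* [sup_norm] and [lip] are extended reals: [lip] is [p_infty] for a map that is not Lipschitz
   on [D], and [sup_norm] is [p_infty] for a map that is unbounded on [D]. *)

Definition sup_norm {T : Type} {V : NormedModule R_AbsRing}
    (D : T -> Prop) (F : T -> V) : Rbar :=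
  Lub_Rbar (fun r => exists x, D x /\ r = norm (F x)).

Definition lip {T : Type} {V : NormedModule R_AbsRing}
    (d : T -> T -> R) (D : T -> Prop) (F : T -> V) : Rbar :=
  Glb_Rbar (fun L => 0 <= L /\
    forall x y, D x -> D y -> norm (minus (F x) (F y)) <= L * d x y).

Definition dist {V : NormedModule R_AbsRing} (x y : V) : R := norm (minus x y).

(* The distance of the norm |u| + |v| on X * H; the product norm of Coquelicot
   is the Euclidean combination of the two norms instead. *)
Definition dist_sum (X H : Hilbert) (w z : X * H) : R :=
  dist (fst w) (fst z) + dist (snd w) (snd z).

Definition everywhere {T : Type} : T -> Prop := fun _ => True.

(* A partially defined operator; the values of [op] outside [dom] are irrelevant. *)
Record operator (H : Hilbert) := { dom : H -> Prop; op :> H -> H }.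
Arguments dom {H} _ _.

Definition op_scal (H : Hilbert) (c : R) (A : operator H) : operator H :=
  {| dom := dom A; op := fun x => scal c (A x) |}.

Definition linear_operator (H : Hilbert) (A : operator H) : Prop :=
  dom A zero /\
  (forall x y, dom A x -> dom A y ->
     dom A (plus x y) /\ A (plus x y) = plus (A x) (A y)) /\
  (forall (a : R) x, dom A x -> dom A (scal a x) /\ A (scal a x) = scal a (A x)).

Definition densely_defined (H : Hilbert) (A : operator H) : Prop :=
  forall (x : H) (r : R), 0 < r -> exists y, dom A y /\ dist x y < r.

(* The last clause says that A and its adjoint have the same graph. *)
Definition self_adjoint (H : Hilbert) (A : operator H) : Prop :=
  linear_operator A /\ densely_defined A /\
  forall y z, (dom A y /\ A y = z) <->
              (forall x, dom A x -> inner (A x) y = inner x z).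

(* A >= c I in the sense of quadratic forms *)
Definition bounded_below_by (H : Hilbert) (c : R) (A : operator H) : Prop :=
  forall x, dom A x -> c * norm x ^ 2 <= inner (A x) x.

(* T is a bounded two-sided inverse of A - l, both regarded as operators in the
   subspace V; for V = H this is the resolvent of A at l. *)
Definition is_resolvent_on (H : Hilbert) (V : H -> Prop) (A : operator H)
    (l : R) (T : H -> H) : Prop :=
  (forall y, V y -> V (T y) /\ dom A (T y) /\ minus (A (T y)) (scal l (T y)) = y) /\
  (forall x, V x -> dom A x ->
     V (minus (A x) (scal l x)) /\ T (minus (A x) (scal l x)) = x) /\
  (exists C, forall y, V y -> norm (T y) <= C * norm y).

(* The spectrum of the part of A in V.  It is used for self-adjoint operators
   only, whose spectrum (that of the complexification) is real. *)
Definition spectrum_on (H : Hilbert) (V : H -> Prop) (A : operator H) (l : R) : Prop :=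
  ~ exists T, is_resolvent_on V A l T.

Definition compact_map (H : Hilbert) (T : H -> H) : Prop :=
  forall x : nat -> H, (exists C, forall n, norm (x n) <= C) ->
    exists (k : nat -> nat) (y : H),
      (forall n, (k n < k (S n))%nat) /\
      filterlim (fun n => T (x (k n))) eventually (locally y).

Definition compact_resolvent (H : Hilbert) (A : operator H) : Prop :=
  exists l T, is_resolvent_on everywhere A l T /\ compact_map T.

Definition eigenbasis (H : Hilbert) (A : operator H) (e : nat -> H) (l : nat -> R) : Prop :=
  (forall k, dom A (e k) /\ A (e k) = scal (l k) (e k)) /\
  (forall j k, inner (e j) (e k) = if Nat.eq_dec j k then 1 else 0) /\
  (forall x, is_series (fun k => scal (inner x (e k)) (e k)) x).

(* T = phi(A) for a bounded function phi and a self-adjoint operator A with compact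
   resolvent on an infinite-dimensional space: phi(A) x = sum_k phi(l_k) <x, e_k> e_k.
   The operator phi(A) does not depend on the choice of the eigenbasis. *)
Definition is_funcalc (H : Hilbert) (A : operator H) (phi : R -> R) (T : H -> H) : Prop :=
  exists e l, eigenbasis A e l /\
    forall x, is_series (fun k => scal (phi (l k) * inner x (e k)) (e k)) (T x).

Definition funcalc (H : Hilbert) (A : operator H) (phi : R -> R) : H -> H :=
  epsilon (inhabits (fun x => x)) (is_funcalc A phi).

Definition indicator (a b : R) : R -> R :=
  fun x => if Rle_dec a x then if Rle_dec x b then 1 else 0 else 0.

Definition C0_semigroup (H : Hilbert) (S : R -> H -> H) : Prop :=
  (forall t, 0 <= t ->
     (forall x y, S t (plus x y) = plus (S t x) (S t y)) /\
     (forall (a : R) x, S t (scal a x) = scal a (S t x)) /\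
     (exists C, forall x, norm (S t x) <= C * norm x)) /\
  (forall x, S 0 x = x) /\
  (forall s t x, 0 <= s -> 0 <= t -> S (s + t) x = S s (S t x)) /\
  (forall x, filterlim (fun t => S t x) (at_right 0) (locally x)).

(* S is the strongly continuous semigroup with generator -A. *)
Definition generated_by_opp (H : Hilbert) (A : operator H) (S : R -> H -> H) : Prop :=
  C0_semigroup S /\
  forall x y, (dom A x /\ A x = y) <->
    filterlim (fun t : R => scal (/ t) (minus x (S t x))) (at_right 0) (locally y).

(* exp (- t A), for t >= 0 *)
Definition semigroup (H : Hilbert) (A : operator H) : R -> H -> H :=
  epsilon (inhabits (fun _ x => x)) (generated_by_opp A).

(* x is a mild solution of x' + A x = F on the interval I. *)
Definition mild_solution (H : Hilbert) (A : operator H) (F : R -> H)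
    (I : R -> Prop) (x : R -> H) : Prop :=
  continuous_on I x /\
  forall t0 t, I t0 -> I t -> t0 <= t ->
    is_RInt (fun s => semigroup A (t - s) (F s)) t0 t
            (minus (x t) (semigroup A (t - t0) (x t0))).

Definition half_line : R -> Prop := fun t => 0 <= t.

Definition Lambda (mu eps : R) : R := mu * / eps ^ 2.

Definition Pproj (H : Hilbert) (As : operator H) (mu eps : R) : H -> H :=
  funcalc As (indicator 0 (Lambda mu eps)).

Definition Qproj (H : Hilbert) (As : operator H) (mu eps : R) : H -> H :=
  fun x => minus x (Pproj As mu eps x).

Definition As_eps (H : Hilbert) (As : operator H) (mu eps : R) : operator H :=
  {| dom := dom As; op := fun x => plus (As x) (scal (/ eps) (Qproj As mu eps x)) |}.

(* If PH = {0}, the spectrum is empty, [Lub_Rbar] is [m_infty] and [real m_infty = 0]. *)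
Definition beta (H : Hilbert) (As : operator H) (mu eps : R) : R :=
  real (Lub_Rbar (spectrum_on (range (Pproj As mu eps)) As)).

Definition lambda_plus (H : Hilbert) (As : operator H) (mu eps : R) : R :=
  real (Glb_Rbar (spectrum_on (range (Qproj As mu eps)) As)).

Definition alpha (H : Hilbert) (As : operator H) (mu eps : R) : R :=
  lambda_plus As mu eps + / eps.

Definition gap (H : Hilbert) (As : operator H) (omegaf mu delta eps : R) : R :=
  Rmin (omegaf * / delta) (alpha As mu eps) - beta As mu eps.

Definition system_solution (X H : Hilbert) (Af : operator X) (As : operator H)
    (f : X * H -> X) (g : X * H -> H) (mu delta eps : R)
    (I : R -> Prop) (w : R -> X * H) : Prop :=
  mild_solution (op_scal (/ delta) Af) (fun s => f (w s)) I (fun t => fst (w t)) /\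
  mild_solution (As_eps As mu eps) (fun s => g (w s)) I (fun t => snd (w t)).

Definition graph_map (X H : Hilbert) (hu : H -> X) (hq : H -> H) (p : H) : X * H :=
  (hu p, plus p (hq p)).

Definition slow_manifold (X H : Hilbert) (As : operator H) (mu eps : R)
    (hu : H -> X) (hq : H -> H) (w : X * H) : Prop :=
  exists p, range (Pproj As mu eps) p /\ w = graph_map hu hq p.

(* Solutions starting in M remain in M, and through every point of M there passes
   a solution defined for all t in R and contained in M; [sol I w] means that w is a
   solution on I. *)
Definition invariant {T : Type} (sol : (R -> Prop) -> (R -> T) -> Prop)
    (M : T -> Prop) : Prop :=
  (forall w, sol half_line w -> M (w 0) -> forall t, 0 <= t -> M (w t)) /\
  (forall m, M m -> exists w, sol everywhere w /\ w 0 = m /\ forall t, M (w t)).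

(* Solutions of p' + As p = P g (J p) in PH, for all t in R; since PH is
   finite-dimensional, mild and classical solutions coincide. *)
Definition reduced_solution (X H : Hilbert) (As : operator H) (g : X * H -> H)
    (mu eps : R) (J : H -> X * H) (p : R -> H) : Prop :=
  (forall t, range (Pproj As mu eps) (p t)) /\
  (forall t, is_derive p t (minus (Pproj As mu eps (g (J (p t)))) (As (p t)))).

(* The equation with solutions [red] defines a flow phi on V, and J maps it to the
   dynamics on J(V): J (phi t p) is the solution starting at J p, and a curve p in V
   solves the reduced equation if and only if J p solves the full one. *)
Definition conjugate_through {V T : Type} (D : V -> Prop)
    (red : (R -> V) -> Prop) (sol : (R -> Prop) -> (R -> T) -> Prop)
    (J : V -> T) : Prop :=
  exists phi : R -> V -> V,
    (forall p, D p -> red (fun t => phi t p) /\ phi 0 p = p /\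
       forall r, red r -> r 0 = p -> forall t, r t = phi t p) /\
    (forall p, D p -> sol half_line (fun t => J (phi t p)) /\
       forall w, sol half_line w -> w 0 = J p -> forall t, 0 <= t -> w t = J (phi t p)) /\
    (forall r : R -> V, (forall t, D (r t)) ->
       (red r <-> sol everywhere (fun t => J (r t)))).

(* Main.v *)
Require Import Defs.
From Stdlib Require Import Lra Lia Psatz.
From mathcomp Require Import ssreflect.
Set Implicit Arguments.
Unset Strict Implicit.
Open Scope general_if_scope.
Open Scope R_scope.

(** A self-adjoint operator bounded below generates a contraction semigroup (the limit of the flows of its
    Yosida approximations), and every semigroup with that generator decays at the rate of the lower bound.
    The slow operator has an eigenbasis, so that [H] splits into a finite-dimensional part, on which
    [exp (- t A_s)] extends to a group growing at most like [exp (- beta t)] for [t <= 0], and a part on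
    which the renormalized semigroup decays at rate [alpha].  With [eta] the midpoint of the gap, the
    Lyapunov-Perron map ([u] and [q] integrated from time [- oo], [p] from time 0) is a contraction with
    constant [K] for the norm [sup_(t <= 0) exp (eta t) (|u| + |p| + |q|)], each of the three integrals
    contributing [2 L / G].  The graph consists of the values at time 0 of the fixed points.  A time shift of
    a fixed point is a fixed point, so that fixed points stay on the graph; their [p] components are the
    solutions of the reduced equation, hence [J] lifts these to solutions of the full system on all of [R].
    Forward uniqueness for the full system gives invariance and the conjugacy. *)

(** * Geometry and convergence in a Hilbert space *)

(** The definitions fix [semigroup] and [Pproj] by [epsilon], so nothing of a construction survives
    except the specification: decay and the action on eigenvectors are proved for an arbitrary
    semigroup with the given generator, and the eigenvectors used are those that the choice behind
    [Pproj] supplies. The gap condition has this form because [u] and [q] are damped forward in time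
    at rate at least [a], while [p] can be run backward at the cost [exp (- b t)]: a weight rate
    [eta] strictly between [b] and [a] makes all three integrals converge, and the midpoint leaves
    [G / 2] on either side. Since [eta > 0], bounded forcings have finite weighted norm, which
    starts the iterations. Only the integrals for [u] and [q] enter the Lipschitz bound, hence [4 L]
    there against [6 L] in [K]. Curves are not gathered into a Banach space; their differences are
    estimated pointwise in time. The semigroups of [u] and [q] cannot be run backward, so a solution
    on all of [R] is assembled from trajectories ending at arbitrarily late times. *)

Section HilbertGeometry.
Context {H : Hilbert}.
Implicit Types x y z : H.

Lemma inner_plus_r x y z : inner z (plus x y) = inner z x + inner z y.
Proof. by rewrite inner_sym inner_plus !(inner_sym _ z). Qed.

Lemma inner_scal_r (a : R) x z : inner z (scal a x) = a * inner z x.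
Proof. by rewrite inner_sym inner_scal (inner_sym x). Qed.

Lemma inner_opp x z : inner (opp x) z = - inner x z.
Proof. rewrite -(scal_opp_one x) inner_scal /opp /one /=; lra. Qed.

Lemma inner_opp_r x z : inner z (opp x) = - inner z x.
Proof. by rewrite inner_sym inner_opp inner_sym. Qed.

Lemma inner_minus x y z : inner (minus x y) z = inner x z - inner y z.
Proof. rewrite /minus inner_plus inner_opp; lra. Qed.

Lemma inner_minus_r x y z : inner z (minus x y) = inner z x - inner z y.
Proof. by rewrite !(inner_sym z) inner_minus. Qed.

Lemma inner_zero x : inner zero x = 0.
Proof. rewrite -(plus_opp_r x) inner_plus inner_opp; lra. Qed.

Lemma inner_zero_r x : inner x zero = 0.
Proof. by rewrite inner_sym inner_zero. Qed.

Definition innerE := (@inner_plus, @inner_plus_r, @inner_scal, @inner_scal_r,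
  @inner_opp, @inner_opp_r, @inner_minus, @inner_minus_r, @inner_zero, @inner_zero_r).

Lemma minus_eq0 x y : norm (minus x y) = 0 -> x = y.
Proof.
  move=> h; apply: (plus_reg_r (opp y)).
  rewrite plus_opp_r; exact: (norm_eq_zero _ h).
Qed.

Lemma inner_ext x y : (forall z, inner x z = inner y z) -> x = y.
Proof.
  move=> h; apply: minus_eq0.
  have : norm (minus x y) ^ 2 = 0 by rewrite -inner_norm inner_minus h; lra.
  nra.
Qed.

Lemma norm_nonneg x : 0 <= norm x.
Proof. exact: norm_ge_0. Qed.

Lemma norm_le_sq x (c : R) : 0 <= c -> inner x x <= c ^ 2 -> norm x <= c.
Proof. rewrite inner_norm => hc h; have := norm_nonneg x; nra. Qed.

(** The vector [|y|^2 x - <x,y> y] has squared length [|y|^2 (|x|^2 |y|^2 - <x,y>^2)]. Scaling by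
    [|y|^2] avoids a division, and only [y = 0] has to be treated apart. *)
Lemma cauchy_schwarz x y : Rabs (inner x y) <= norm x * norm y.
Proof.
  have hx := norm_nonneg x; have hy := norm_nonneg y.
  have key : inner x y ^ 2 <= (norm x * norm y) ^ 2.
  { have h : 0 <= inner (minus (scal (norm y ^ 2) x) (scal (inner x y) y))
                        (minus (scal (norm y ^ 2) x) (scal (inner x y) y))
      by rewrite inner_norm; nra.
    rewrite !innerE (inner_sym y x) !inner_norm in h.
    case: (Req_dec (norm y) 0) => [y0 | y0].
    - have -> : y = zero by apply: norm_eq_zero.
      rewrite inner_zero_r; nra.
    - have hp : 0 < norm y by lra.
      have h2 : 0 < norm y ^ 2 by nra.
      have h3 : 0 <= norm y ^ 2 * ((norm x * norm y) ^ 2 - inner x y ^ 2) by nra.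
      nra. }
  apply: Rsqr_incr_0_var; last by nra.
  rewrite -Rsqr_abs /Rsqr; nra.
Qed.

Lemma inner_le x y : inner x y <= norm x * norm y.
Proof. exact: Rle_trans (Rle_abs _) (cauchy_schwarz x y). Qed.

Lemma norm_triangleR x y : norm (plus x y) <= norm x + norm y.
Proof. exact: norm_triangle. Qed.

Lemma norm_triangle_minus x y : norm (minus x y) <= norm x + norm y.
Proof. rewrite -(norm_opp y); exact: norm_triangle. Qed.

Lemma norm_scalR (a : R) x : norm (scal a x) = Rabs a * norm x.
Proof.
  have h : norm (scal a x) ^ 2 = (Rabs a * norm x) ^ 2
    by rewrite -inner_norm !innerE inner_norm Rpow_mult_distr pow2_abs; ring.
  apply: Rsqr_inj; [exact: norm_nonneg | | by rewrite /Rsqr; lra].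
  apply: Rmult_le_pos; [exact: Rabs_pos | exact: norm_nonneg].
Qed.

Lemma norm_zeroR : norm (zero : H) = 0.
Proof. exact: norm_zero. Qed.

Lemma norm_minus_sym x y : norm (minus x y) = norm (minus y x).
Proof. by rewrite -(norm_opp (minus x y)) opp_minus. Qed.

End HilbertGeometry.

(** An identity of vectors is tested against an arbitrary vector, which turns it into an identity of
    reals. When the coefficients contain inverses the real goal is left open for [field]. *)
Ltac vec := apply inner_ext; intro; rewrite !innerE; try ring.

Section Convergence.
Context {H : Hilbert}.
Implicit Types x y z : H.

Lemma norm_split x y z : z = plus x y -> norm z <= norm x + norm y.
Proof. move=> ->; exact: norm_triangle. Qed.

Lemma norm_minus_trans y x z : norm (minus x z) <= norm (minus x y) + norm (minus y z).
Proof.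
  have -> : minus x z = plus (minus x y) (minus y z) by vec.
  exact: norm_triangle.
Qed.

Lemma norm_le_minus x y : norm x <= norm y + norm (minus x y).
Proof. have {1}-> : x = plus y (minus x y) by vec. exact: norm_triangle. Qed.

Lemma filterlim_normP {T : Type} {F : (T -> Prop) -> Prop} {FF : Filter F} (f : T -> H) y :
  filterlim f F (locally y) <-> forall e, 0 < e -> F (fun t => norm (minus (f t) y) < e).
Proof.
  split => [/filterlim_locally_ball_norm h e he | h].
  - exact: (h (mkposreal e he)).
  - apply/filterlim_locally_ball_norm => e; exact: (h e (cond_pos e)).
Qed.

Definition tends (u : nat -> H) y :=
  forall e, 0 < e -> exists N, forall n, (N <= n)%nat -> norm (minus (u n) y) < e.

Lemma tends_filterlim u y : tends u y <-> filterlim u eventually (locally y).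
Proof. by rewrite filterlim_normP. Qed.

Lemma tends_unique u x y : tends u x -> tends u y -> x = y.
Proof.
  move=> /tends_filterlim h1 /tends_filterlim h2.
  exact: (filterlim_locally_unique (F := eventually) u x y h1 h2).
Qed.

Lemma tends_ext u v x : (forall n, u n = v n) -> tends u x -> tends v x.
Proof. by move=> h hu e he; case: (hu e he) => N hN; exists N => n hn; rewrite -h; apply: hN. Qed.

Lemma tends_cauchy (u : nat -> H) :
  (forall e, 0 < e -> exists N, forall n m, (N <= n)%nat -> (N <= m)%nat ->
     norm (minus (u n) (u m)) < e) -> exists y, tends u y.
Proof.
  move=> h.
  have [|y hy] := proj1 (filterlim_locally_cauchy (F := eventually) u).
  - move=> e; have [N hN] := h e (cond_pos e).
    exists (fun n => (N <= n)%nat); split; first by exists N.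
    move=> n m hn hm; apply: norm_compat1; rewrite norm_minus_sym; exact: hN.
  - by exists y; apply/tends_filterlim.
Qed.

Lemma tends_bound (u : nat -> H) y x c :
  tends u y -> (exists N, forall n, (N <= n)%nat -> norm (minus (u n) x) <= c) ->
  norm (minus y x) <= c.
Proof.
  move=> hu [N hN]; apply: Rnot_lt_le => hc.
  have [N2 h2] := hu (norm (minus y x) - c) ltac:(lra).
  have h3 := h2 _ (Nat.le_max_r N N2); have h4 := hN _ (Nat.le_max_l N N2).
  have := norm_minus_trans (u (Nat.max N N2)) y x; rewrite (norm_minus_sym y (u _)); lra.
Qed.

Lemma tends_norm_le (u : nat -> H) y c :
  tends u y -> (exists N, forall n, (N <= n)%nat -> norm (u n) <= c) -> norm y <= c.
Proof.
  move=> hu [N hN]; have -> : y = minus y zero by vec.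
  apply: (tends_bound hu); exists N => n hn.
  have -> : minus (u n) zero = u n by vec.
  exact: hN.
Qed.

Lemma tends_squeeze (u : nat -> H) y (r : nat -> R) :
  is_lim_seq r 0 -> (forall n, norm (minus (u n) y) <= r n) -> tends u y.
Proof.
  move=> /is_lim_seq_spec hr h e he; have [N hN] := hr (mkposreal e he).
  exists N => n hn; have := hN n hn; rewrite Rminus_0_r /= => /Rabs_def2 [h1 _].
  exact: Rle_lt_trans (h n) h1.
Qed.

Lemma tends_lim (u : nat -> H) y : tends u y -> is_lim_seq (fun n => norm (minus (u n) y)) 0.
Proof.
  move=> hu; apply/is_lim_seq_spec => e; have [N hN] := hu e (cond_pos e).
  exists N => n hn; rewrite Rminus_0_r Rabs_pos_eq; [exact: hN | exact: norm_nonneg].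
Qed.

Lemma tends_inner (u : nat -> H) x y : tends u x -> is_lim_seq (fun n => inner (u n) y) (inner x y).
Proof.
  move=> /tends_lim hu.
  apply/is_lim_seq_spec/is_lim_seq_spec.
  apply: (is_lim_seq_ext (fun n => inner x y + inner (minus (u n) x) y)).
  { by move=> n; rewrite inner_minus; lra. }
  have -> : Finite (inner x y) = Rbar_plus (inner x y) 0 by rewrite /= Rplus_0_r.
  apply: is_lim_seq_plus'; first exact: is_lim_seq_const.
  apply/is_lim_seq_abs_0.
  apply: (is_lim_seq_le_le (fun _ => 0) _ (fun n => norm y * norm (minus (u n) x))).
  - move=> n; split; first exact: Rabs_pos.
    rewrite Rmult_comm; exact: cauchy_schwarz.
  - exact: is_lim_seq_const.
  - have -> : Finite 0 = Rbar_mult (norm y) 0 by rewrite /= Rmult_0_r.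
    by apply: is_lim_seq_scal_l.
Qed.

Lemma tends_const x : tends (fun _ => x) x.
Proof. move=> e he; exists 0%nat => n _; by rewrite minus_eq_zero norm_zeroR. Qed.

Lemma tends_plus u v x y : tends u x -> tends v y -> tends (fun n => plus (u n) (v n)) (plus x y).
Proof.
  move=> hu hv e he; have [N1 h1] := hu (e / 2) ltac:(lra); have [N2 h2] := hv (e / 2) ltac:(lra).
  exists (Nat.max N1 N2) => n hn.
  have := h1 n ltac:(lia); have := h2 n ltac:(lia).
  have := @norm_split (minus (u n) x) (minus (v n) y) (minus (plus (u n) (v n)) (plus x y))
    ltac:(vec); lra.
Qed.

Lemma tends_scal (c : R) u x : tends u x -> tends (fun n => scal c (u n)) (scal c x).
Proof.
  move=> /tends_lim hu; apply: (@tends_squeeze _ _ (fun n => Rabs c * norm (minus (u n) x))).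
  - have -> : Finite 0 = Rbar_mult (Rabs c) 0 by rewrite /= Rmult_0_r.
    by apply: is_lim_seq_scal_l.
  - move=> n; have -> : minus (scal c (u n)) (scal c x) = scal c (minus (u n) x) by vec.
    rewrite norm_scalR; lra.
Qed.

Lemma tends_linear (L : H -> H) u x : is_linear L -> tends u x -> tends (fun n => L (u n)) (L x).
Proof.
  move=> hL hu; have [M [hM hb]] := linear_norm _ hL => e he.
  have [N hN] := hu (e / M) ltac:(exact: Rdiv_lt_0_compat).
  exists N => n hn; rewrite -(linear_minus _ _ _ hL).
  apply: Rle_lt_trans (hb _) _.
  have := hN n hn => h; apply: (Rmult_lt_reg_r (/ M)); first exact: Rinv_0_lt_compat.
  by rewrite Rmult_comm -Rmult_assoc Rinv_l ?Rmult_1_l; [ exact: h | lra].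
Qed.

Lemma lin_minus (L : H -> H) x y : is_linear L -> L (minus x y) = minus (L x) (L y).
Proof. move=> hL; exact: linear_minus. Qed.

Lemma lin_plus (L : H -> H) x y : is_linear L -> L (plus x y) = plus (L x) (L y).
Proof. move=> hL; exact: linear_plus. Qed.

Lemma lin_scal (L : H -> H) (c : R) x : is_linear L -> L (scal c x) = scal c (L x).
Proof. move=> hL; exact: linear_scal. Qed.

Lemma continuous_normP {U : Hilbert} (f : R -> U) t :
  continuous f t <-> forall e, 0 < e ->
    exists d, 0 < d /\ forall s, Rabs (s - t) < d -> norm (minus (f s) (f t)) < e.
Proof.
  split => [/filterlim_locally_ball_norm h e he | h].
  - have [d hd] := h (mkposreal e he); exists d; split; first exact: cond_pos.
    move=> s hs; exact: hd.
  - apply/filterlim_locally_ball_norm => e; have [d [hd h2]] := h e (cond_pos e).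
    by exists (mkposreal d hd) => s hs; apply: h2.
Qed.

End Convergence.

Section OperatorNorm.
Context {H : Hilbert}.
Implicit Types x : H.

Lemma unit_scal x : x <> zero -> 0 < norm x /\ norm (scal (/ norm x) x) = 1.
Proof.
  move=> hx; have h : 0 < norm x.
  { have := norm_nonneg x; case: (Req_dec (norm x) 0) => [h | ]; last lra.
    case: hx; exact: norm_eq_zero. }
  split=> //; rewrite norm_scalR Rabs_pos_eq; last by left; apply: Rinv_0_lt_compat.
  field; lra.
Qed.

(** [m] is the operator norm of [L] on [V], a supremum over the unit ball. The near-maximizers of
    the last clause feed both the gliding hump and the search for extremal eigenvectors. *)
Lemma restricted_norm (L : H -> H) (V : H -> Prop) : is_linear L -> V zero ->
  (forall (a : R) x, V x -> V (scal a x)) ->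
  exists m, 0 <= m /\ (forall x, V x -> norm (L x) <= m * norm x) /\
    forall r, r < m -> exists x, V x /\ norm x <= 1 /\ r < norm (L x).
Proof.
  move=> hL V0 Vs; have [M [hM hb]] := linear_norm _ hL.
  pose E r := exists x, V x /\ norm x <= 1 /\ r = norm (L x).
  have E0 : E (norm (L zero)) by exists zero; split=> //; split=> //; rewrite norm_zeroR; lra.
  have [m [hm1 hm2]] : exists m, is_lub E m.
  { have [||m hm] := completeness E; last by exists m.
    - exists M => r [x [_ [hx ->]]]; apply: Rle_trans (hb x) _.
      rewrite -{2}(Rmult_1_r M); apply: Rmult_le_compat_l => //; lra.
    - by exists (norm (L zero)). }
  exists m; split; first exact: Rle_trans (norm_nonneg _) (hm1 _ E0).
  split.
  - move=> x hx; case: (classic (x = zero)) => [-> | nz].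
    + have -> : L zero = zero := linear_zero _ hL; rewrite norm_zeroR; lra.
    + have [hp hu] := unit_scal nz.
      have : norm (L (scal (/ norm x) x)) <= m.
      { apply: hm1; exists (scal (/ norm x) x); split; first exact: Vs. split=> //; lra. }
      rewrite lin_scal // norm_scalR Rabs_pos_eq; last by left; apply: Rinv_0_lt_compat.
      move=> h; apply: (Rmult_le_reg_l (/ norm x)); first exact: Rinv_0_lt_compat.
      have -> : / norm x * (m * norm x) = m by field; lra.
      exact: h.
  - move=> r hr; apply: NNPP => hn; have : m <= r; last lra.
    apply: hm2 => s [x [hx [h1 ->]]]; apply: Rnot_lt_le => hl; apply: hn; by exists x.
Qed.

End OperatorNorm.

(** * Calculus of Hilbert-valued functions *)

Lemma choose {A B : Type} (P : A -> B -> Prop) :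
  (forall a, exists b, P a b) -> exists f : A -> B, forall a, P a (f a).
Proof.
  move=> h; exists (fun a => proj1_sig (constructive_indefinite_description _ (h a))) => a.
  exact: proj2_sig (constructive_indefinite_description _ (h a)).
Qed.

Section Calculus.
Context {H : Hilbert}.
Implicit Types x y z : H.

Lemma derive_normP (f : R -> H) t l :
  is_derive f t l <-> forall e, 0 < e -> exists d, 0 < d /\ forall s, Rabs (s - t) < d ->
    norm (minus (minus (f s) (f t)) (scal (s - t) l)) <= e * Rabs (s - t).
Proof.
  split.
  - move=> [_ h] e he; have [d hd] := h t (fun P hP => hP) (mkposreal e he).
    exists d; split; first exact: cond_pos.
    move=> s hs; exact: (hd s hs).
  - move=> h; split; first exact: is_linear_scal_l.
    move=> u hu; rewrite -(is_filter_lim_locally_unique _ _ hu) => e.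
    have [d [hd h2]] := h e (cond_pos e).
    exists (mkposreal d hd) => s hs; exact: h2.
Qed.

Lemma derive_continuous (f : R -> H) t l : is_derive f t l -> continuous f t.
Proof. move=> h; apply: ex_derive_continuous; by exists l. Qed.

Lemma derive_linear (L : H -> H) (f : R -> H) t l :
  is_linear L -> is_derive f t l -> is_derive (fun s => L (f s)) t (L l).
Proof.
  move=> hL /derive_normP h; have [M [hM hb]] := linear_norm _ hL.
  apply/derive_normP => e he; have [d [hd h2]] := h (e / M) ltac:(exact: Rdiv_lt_0_compat).
  exists d; split=> // s hs.
  rewrite -(linear_scal _ hL) -!(linear_minus _ _ _ hL).
  apply: Rle_trans (hb _) _.
  apply: Rle_trans (Rmult_le_compat_l _ _ _ (Rlt_le _ _ hM) (h2 s hs)) _.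
  right; field; lra.
Qed.

Lemma continuous_linear (L : H -> H) (f : R -> H) t :
  is_linear L -> continuous f t -> continuous (fun s => L (f s)) t.
Proof. move=> hL hf; apply: continuous_comp hf _; exact: linear_cont. Qed.

Lemma derive_inner (f g : R -> H) t f' g' :
  is_derive f t f' -> is_derive g t g' ->
  is_derive (fun s => inner (f s) (g s)) t (inner f' (g t) + inner (f t) g').
Proof.
  move=> hf hg.
  have /continuous_normP cg := derive_continuous hg.
  move/derive_normP: hf => hf; move/derive_normP: hg => hg.
  split; first exact: is_linear_scal_l.
  move=> u hu; rewrite -(is_filter_lim_locally_unique _ _ hu) => e.
  have n1 := norm_nonneg f'; have n2 := norm_nonneg (f t); have n3 := norm_nonneg (g t).
  have he := cond_pos e.
  (* The error splits into three terms, with factors [g s], [f'] and [f t]; each tolerance is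
     [e / 3] over a bound for its factor. The added 1 covers a vanishing factor and, for [g s], its
     deviation from [g t]. *)
  set e1 := e / 3 / (norm (g t) + 1); set e2 := e / 3 / (norm (f t) + 1).
  set e3 := e / 3 / (norm f' + 1).
  have p1 : 0 < e1 by apply: Rdiv_lt_0_compat; lra.
  have p2 : 0 < e2 by apply: Rdiv_lt_0_compat; lra.
  have p3 : 0 < e3 by apply: Rdiv_lt_0_compat; lra.
  have [d1 [hd1 h1]] := hf e1 p1; have [d2 [hd2 h2]] := hg e2 p2.
  have [d3 [hd3 h3]] := cg (Rmin 1 e3) ltac:(apply: Rmin_glb_lt; lra).
  have hd : 0 < Rmin d1 (Rmin d2 d3) by repeat apply: Rmin_glb_lt.
  exists (mkposreal _ hd) => s hs.
  have q1 : Rabs (s - t) < d1 by apply: Rlt_le_trans hs (Rmin_l _ _).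
  have q2 : Rabs (s - t) < d2 by apply: Rlt_le_trans hs (Rle_trans _ _ _ (Rmin_r _ _) (Rmin_l _ _)).
  have q3 : Rabs (s - t) < d3 by apply: Rlt_le_trans hs (Rle_trans _ _ _ (Rmin_r _ _) (Rmin_r _ _)).
  have k1 := h1 s q1; have k2 := h2 s q2; have k3 := h3 s q3.
  have k4 : norm (minus (g s) (g t)) < e3 := Rlt_le_trans _ _ _ k3 (Rmin_r _ _).
  have k5 : norm (g s) <= norm (g t) + 1.
  { have := norm_le_minus (g s) (g t); have := Rlt_le_trans _ _ _ k3 (Rmin_l 1 e3); lra. }
  set r := Rabs (s - t) in k1 k2 |- *; have hr : 0 <= r by exact: Rabs_pos.
  have -> : norm (minus s t) = r by [].
  set X := minus (minus (f s) (f t)) (scal (s - t) f') in k1.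
  set Y := minus (minus (g s) (g t)) (scal (s - t) g') in k2.
  have E : minus (minus (inner (f s) (g s)) (inner (f t) (g t)))
              (scal (minus s t) (inner f' (g t) + inner (f t) g'))
       = inner X (g s) + (s - t) * inner f' (minus (g s) (g t)) + inner (f t) Y.
  { rewrite /X /Y !innerE /minus /plus /opp /scal /= /mult /=; ring. }
  rewrite E.
  have a1 : Rabs (inner X (g s)) <= e / 3 * r.
  { apply: Rle_trans (cauchy_schwarz _ _) _.
    apply: Rle_trans (Rmult_le_compat _ _ _ _ (norm_nonneg _) (norm_nonneg _) k1 k5) _.
    right; rewrite /e1; field; lra. }
  have a2 : Rabs ((s - t) * inner f' (minus (g s) (g t))) <= e / 3 * r.
  { rewrite Rabs_mult -/r.
    have b := cauchy_schwarz f' (minus (g s) (g t)).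
    have b2 : norm f' * norm (minus (g s) (g t)) <= e / 3.
    { have -> : e / 3 = (norm f' + 1) * e3 by rewrite /e3; field; lra.
      apply: Rmult_le_compat; try exact: norm_nonneg; lra. }
    rewrite Rmult_comm; apply: Rmult_le_compat_r => //; lra. }
  have a3 : Rabs (inner (f t) Y) <= e / 3 * r.
  { apply: Rle_trans (cauchy_schwarz _ _) _.
    apply: (Rle_trans _ ((norm (f t) + 1) * (e2 * r))).
    - apply: Rmult_le_compat; try exact: norm_nonneg; [lra | exact: k2].
    - right; rewrite /e2; field; lra. }
  have t1 := Rabs_triang (inner X (g s) + (s - t) * inner f' (minus (g s) (g t))) (inner (f t) Y).
  have t2 := Rabs_triang (inner X (g s)) ((s - t) * inner f' (minus (g s) (g t))).
  rewrite /norm /= /abs /=; lra.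
Qed.

Lemma continuous_norm_fun (f : R -> H) t : continuous f t -> continuous (fun s => norm (f s)) t.
Proof. move=> hf; apply: continuous_comp hf _; exact: filterlim_norm. Qed.

Lemma continuous_dist (f : R -> H) x t : continuous f t -> continuous (fun s => norm (minus (f s) x)) t.
Proof.
  move=> hf; apply: (continuous_norm_fun (f := fun s => minus (f s) x)).
  apply: continuous_minus => //; exact: continuous_const.
Qed.

Lemma continuous_dominated (f : R -> H) (k : R -> R) t : continuous k t -> k t = 0 ->
  (forall s, norm (minus (f s) (f t)) <= k s) -> continuous f t.
Proof.
  move=> ck k0 hk; apply/continuous_normP => e he.
  have [d hd] := proj1 (filterlim_locally_ball_norm _ _) ck (mkposreal e he).
  exists d; split; first exact: cond_pos.
  move=> s hs; apply: Rle_lt_trans (hk s) _; have : Rabs (k s - k t) < e := hd s hs.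
  rewrite k0 Rminus_0_r => /Rabs_def2; by case.
Qed.

Lemma is_RInt_linear (L : H -> H) (f : R -> H) a b v :
  is_linear L -> is_RInt f a b v -> is_RInt (fun s => L (f s)) a b (L v).
Proof.
  move=> hL hf; rewrite /is_RInt.
  apply: (filterlim_ext (fun p => L (scal (sign (b - a)) (Riemann_sum f p)))).
  - move=> p; rewrite (linear_scal _ hL); congr (scal _ _).
    elim/(@SF_cons_ind R): p => [u | u p IH]; first exact: (linear_zero _ hL).
    by rewrite !Riemann_sum_cons (linear_plus _ hL) (linear_scal _ hL) IH.
  - apply: filterlim_comp hf _; exact: (linear_cont L v hL).
Qed.

Lemma RInt_is (f : R -> H) a b : (forall s, continuous f s) -> is_RInt f a b (RInt f a b).
Proof. move=> hf; apply: RInt_correct; apply: ex_RInt_continuous => s _; exact: hf. Qed.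

Lemma RInt_derive (f : R -> H) a t :
  (forall s, continuous f s) -> is_derive (RInt f a) t (f t).
Proof.
  move=> hf; apply: is_derive_RInt; last exact: hf.
  by exists (mkposreal 1 Rlt_0_1) => s _; apply: RInt_is.
Qed.

Lemma RInt_norm_le (f : R -> H) (g : R -> R) a b v w :
  a <= b -> (forall s, a <= s <= b -> norm (f s) <= g s) ->
  is_RInt f a b v -> is_RInt g a b w -> norm v <= w.
Proof. exact: norm_RInt_le. Qed.

End Calculus.

Lemma mvt_le (f df : R -> R) a b c : a <= b ->
  (forall s, a <= s <= b -> continuous f s) ->
  (forall s, a < s < b -> is_derive f s (df s)) ->
  (forall s, a < s < b -> df s <= c) -> f b - f a <= c * (b - a).
Proof.
  move=> hab hc hd hle.
  (* The mean value point may be an endpoint, where nothing is known of the derivative; there [df']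
     takes the value [c], for which the bound is trivial. *)
  pose df' s := if Rlt_dec a s then if Rlt_dec s b then df s else c else c.
  have [|s hs|s [hs E]] := MVT_gen f a b df'; rewrite ?Rmin_left ?Rmax_right //.
  - move=> s [h1 h2]; rewrite /df'.
    case: Rlt_dec => // _; case: Rlt_dec => // _; exact: hd.
  - rewrite Rmin_left ?Rmax_right // in hs; apply/continuity_pt_filterlim; exact: hc.
  - rewrite E; apply: Rmult_le_compat_r; first lra.
    rewrite /df'; case: Rlt_dec => h1; last lra.
    case: Rlt_dec => h2; last lra. exact: hle.
Qed.

Lemma is_RInt_exp (c k a b : R) : k <> 0 ->
  is_RInt (fun s => c * exp (k * s)) a b (c / k * (exp (k * b) - exp (k * a))).
Proof.
  move=> hk.
  have -> : c / k * (exp (k * b) - exp (k * a))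
     = minus (c / k * exp (k * b)) (c / k * exp (k * a)) by rewrite /minus /plus /opp /=; ring.
  apply: (is_RInt_derive (V := R_CompleteNormedModule) (fun s => c / k * exp (k * s))).
  - move=> s _; auto_derive => //; field; exact: hk.
  - move=> s _; apply: ex_derive_continuous; by auto_derive.
Qed.

(** * Energy estimates, Gronwall's lemma and global Picard iteration *)

Section Energy.
Context {H : Hilbert}.

(** Where [z] vanishes its norm may fail to be differentiable, so [sqrt (|z|^2 + e^2)] is followed
    instead: its derivative is at most [rho], and [e] tends to 0. Differentiability is asked only
    inside the interval, as a semigroup orbit extended to negative times by a constant may have a
    corner at 0. *)
Lemma energy_le (z dz : R -> H) rho T : 0 <= T -> 0 <= rho ->
  (forall s, 0 <= s <= T -> continuous z s) ->
  (forall s, 0 < s < T -> is_derive z s (dz s)) ->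
  (forall s, 0 < s < T -> inner (dz s) (z s) <= rho * norm (z s)) ->
  norm (z T) <= norm (z 0) + rho * T.
Proof.
  move=> hT hrho hc hd hle; apply: le_epsilon => e he.
  pose psi s := norm (z s) ^ 2 + e ^ 2.
  have psi0 s : 0 < psi s by rewrite /psi; have := norm_nonneg (z s); nra.
  have psi1 s : norm (z s) <= sqrt (psi s).
  { rewrite -(sqrt_pow2 (norm (z s))); last exact: norm_nonneg.
    apply: sqrt_le_1_alt; rewrite /psi; nra. }
  have psi2 s : continuous z s -> continuous (fun s => sqrt (psi s)) s.
  { move=> h; apply: (continuous_comp psi sqrt).
    - apply: (continuous_comp (fun s => norm (z s)) (fun r => r ^ 2 + e ^ 2)).
      + exact: continuous_norm_fun.
      + apply: ex_derive_continuous; by auto_derive.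
    - apply: continuous_sqrt. }
  have h : sqrt (psi T) - sqrt (psi 0) <= rho * (T - 0).
  { apply: (@mvt_le (fun s => sqrt (psi s)) (fun s => inner (dz s) (z s) / sqrt (psi s))) => //.
  - move=> s hs; exact: psi2 (hc s hs).
  - move=> s hs.
    apply: (is_derive_ext (fun s => sqrt (inner (z s) (z s) + e ^ 2))).
    { by move=> u; rewrite /psi inner_norm. }
    have := derive_inner (hd s hs) (hd s hs) => h.
    have E : inner (dz s) (z s) / sqrt (psi s)
       = scal (inner (dz s) (z s) + inner (z s) (dz s)) (/ (2 * sqrt (psi s))).
    { rewrite (inner_sym (z s)) /scal /= /mult /=; field.
      have := sqrt_lt_R0 _ (psi0 s); lra. }
    rewrite E.
    apply: (is_derive_comp sqrt (fun u => inner (z u) (z u) + e ^ 2)).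
    + rewrite /psi -inner_norm; apply/is_derive_Reals; apply: derivable_pt_lim_sqrt.
      rewrite inner_norm; exact: psi0.
    + have -> : inner (dz s) (z s) + inner (z s) (dz s)
         = plus (inner (dz s) (z s) + inner (z s) (dz s)) zero by rewrite plus_zero_r.
      apply: is_derive_plus => //; exact: is_derive_const.
  - move=> s hs; have h1 := sqrt_lt_R0 _ (psi0 s).
    apply: (Rmult_le_reg_r (sqrt (psi s))) => //.
    rewrite /Rdiv Rmult_assoc Rinv_l ?Rmult_1_r; last lra.
    apply: Rle_trans (hle s hs) _; apply: Rmult_le_compat_l => //.
  }
  have h1 := psi1 T.
  have h2 : sqrt (psi 0) <= norm (z 0) + e.
  { have n0 := norm_nonneg (z 0).
    rewrite -(sqrt_pow2 (norm (z 0) + e)); last lra.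
    apply: sqrt_le_1_alt; rewrite /psi; nra. }
  lra.
Qed.

(** [exp (- c s)] times the integral of [phi] is nonincreasing; it starts from 0, so the integral
    stays nonpositive, and with it [phi]. *)
Lemma gronwall (phi : R -> R) c T : 0 <= c ->
  (forall s, continuous phi s) ->
  (forall t, 0 <= t <= T -> phi t <= c * RInt phi 0 t) ->
  forall t, 0 <= t <= T -> phi t <= 0.
Proof.
  move=> hc hphi hle t ht.
  have dI s : is_derive (RInt phi 0) s (phi s).
  { apply: is_derive_RInt; last exact: hphi.
    exists (mkposreal 1 Rlt_0_1) => u _.
    apply: (RInt_correct (V := R_CompleteNormedModule)).
    apply: (ex_RInt_continuous (V := R_CompleteNormedModule)) => r _; exact: hphi. }
  pose F s := exp (- c * s) * RInt phi 0 s.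
  have dF s : is_derive F s (exp (- c * s) * (phi s - c * RInt phi 0 s)).
  { have E : exp (- c * s) * (phi s - c * RInt phi 0 s)
      = plus (mult (- c * exp (- c * s)) (RInt phi 0 s)) (mult (exp (- c * s)) (phi s))
      by rewrite /plus /mult /=; ring.
    rewrite E; apply: (is_derive_mult (fun s => exp (- c * s)) (RInt phi 0)).
    - auto_derive => //; ring.
    - exact: dI.
    - exact: Rmult_comm. }
  have h : F t - F 0 <= 0 * (t - 0).
  { apply: (@mvt_le F (fun s => exp (- c * s) * (phi s - c * RInt phi 0 s))); first lra.
    - move=> s _; apply: ex_derive_continuous; eexists; exact: dF.
    - move=> s _; exact: dF.
    - move=> s hs; have := hle s ltac:(lra); have := exp_pos (- c * s); nra. }
  have F0 : F 0 = 0.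
  { rewrite /F RInt_point /zero /=; ring. }
  have hI : RInt phi 0 t <= 0.
  { apply: Rnot_lt_le => hI; have : 0 < F t by apply: Rmult_lt_0_compat => //; exact: exp_pos.
    lra. }
  have := hle t ht; nra.
Qed.

Lemma pow_lim0 (K C : R) : 0 <= K < 1 -> is_lim_seq (fun n => C * K ^ n) 0.
Proof.
  move=> hK; have -> : Finite 0 = Rbar_mult C 0 by rewrite /= Rmult_0_r.
  apply: is_lim_seq_scal_l; apply: is_lim_seq_geom; rewrite Rabs_pos_eq; lra.
Qed.

Lemma geometric_cauchy (u : nat -> H) C K : 0 <= K < 1 ->
  (forall n, norm (minus (u (S n)) (u n)) <= C * K ^ n) ->
  exists y, forall n, norm (minus y (u n)) <= C / (1 - K) * K ^ n.
Proof.
  move=> hK h.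
  have C0 : 0 <= C by have := h 0%nat; have := norm_nonneg (minus (u 1%nat) (u 0%nat)); rewrite /=; lra.
  have hp n : 0 <= K ^ n by apply: pow_le; lra.
  have step n k : norm (minus (u (n + k)%nat) (u n)) <= C / (1 - K) * (K ^ n - K ^ (n + k)).
  { elim: k => [|k IH].
    - rewrite Nat.add_0_r minus_eq_zero norm_zeroR; lra.
    - have := norm_minus_trans (u (n + k)%nat) (u (n + S k)%nat) (u n).
      have := h (n + k)%nat; rewrite Nat.add_succ_r /=.
      have -> : C * K ^ (n + k) = C / (1 - K) * (K ^ (n + k) - K * K ^ (n + k)) by field; lra.
      lra. }
  have D0 : 0 <= C / (1 - K) by apply: Rdiv_le_0_compat; lra.
  have step2 n m : (n <= m)%nat -> norm (minus (u m) (u n)) <= C / (1 - K) * K ^ n.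
  { move=> hnm; have -> : m = (n + (m - n))%nat by lia.
    apply: Rle_trans (step _ _) _; apply: Rmult_le_compat_l => //; have := hp (n + (m - n))%nat; lra. }
  have [y hy] : exists y, tends u y.
  { apply: tends_cauchy => e he.
    have /is_lim_seq_spec hl := pow_lim0 (C / (1 - K)) hK.
    have he2 : 0 < e / 2 by lra.
    have [N hN] := hl (mkposreal _ he2); exists N => n m hn hm.
    have := hN N (Nat.le_refl N); rewrite Rminus_0_r /= => /Rabs_def2 [h1 _].
    have := norm_minus_trans (u N) (u n) (u m); rewrite (norm_minus_sym (u N) (u m)).
    have := step2 N n hn; have := step2 N m hm; lra. }
  exists y => n; apply: (tends_bound hy); exists n => m; exact: step2.
Qed.

(** Completeness for a weighted sup norm: the weight is locally bounded, so convergence is locally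
    uniform and the limit is continuous, with the geometric remainder kept for later use. *)
Lemma weighted_limit (y : nat -> R -> H) (W : R -> R) C K : 0 <= K < 1 ->
  (forall n s, continuous (y n) s) -> (forall s, continuous W s) ->
  (forall n s, norm (minus (y (S n) s) (y n s)) <= C * K ^ n * W s) ->
  exists z : R -> H, (forall s, continuous z s) /\
    forall n s, norm (minus (z s) (y n s)) <= C / (1 - K) * K ^ n * W s.
Proof.
  move=> hK cy cW h.
  have [z hz] : exists z : R -> H, forall s n, norm (minus (z s) (y n s)) <= C * W s / (1 - K) * K ^ n.
  { apply: (@choose _ _ (fun s zs => forall n, norm (minus zs (y n s)) <= C * W s / (1 - K) * K ^ n)) => s.
    apply: (@geometric_cauchy (fun n => y n s)) => // n.
    have -> : C * W s * K ^ n = C * K ^ n * W s by ring.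
    exact: h. }
  have hz' n s : norm (minus (z s) (y n s)) <= C / (1 - K) * K ^ n * W s.
  { have -> : C / (1 - K) * K ^ n * W s = C * W s / (1 - K) * K ^ n by field; lra.
    exact: hz. }
  exists z; split=> // t; apply/continuous_normP => e he.
  have /is_lim_seq_spec hl := pow_lim0 ((Rabs C / (1 - K)) * (Rabs (W t) + 1)) hK.
  have he3 : 0 < e / 3 by lra.
  have [n hn] := hl (mkposreal _ he3).
  have := hn n (Nat.le_refl n); rewrite Rminus_0_r /= => /Rabs_def2 [h1 _].
  have near s : Rabs (W s) <= Rabs (W t) + 1 -> norm (minus (z s) (y n s)) < e / 3.
  { move=> hs; apply: Rle_lt_trans (hz' n s) _; apply: Rle_lt_trans h1.
    have -> : C / (1 - K) * K ^ n * W s = (C * W s) * (/ (1 - K) * K ^ n) by field; lra.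
    have -> : Rabs C / (1 - K) * (Rabs (W t) + 1) * K ^ n
       = (Rabs C * (Rabs (W t) + 1)) * (/ (1 - K) * K ^ n) by field; lra.
    apply: Rmult_le_compat_r.
    - apply: Rmult_le_pos; [left; apply: Rinv_0_lt_compat; lra | apply: pow_le; lra].
    - apply: Rle_trans (Rle_abs _) _; rewrite Rabs_mult.
      apply: Rmult_le_compat_l => //; exact: Rabs_pos. }
  have /continuous_normP cyt := cy n t.
  have [d1 [hd1 k1]] := cyt _ he3.
  have [d2 hd2] := proj1 (filterlim_locally_ball_norm _ _) (cW t) (mkposreal 1 Rlt_0_1).
  exists (Rmin d1 d2); split; first by apply: Rmin_glb_lt => //; exact: cond_pos.
  move=> s hs.
  have a1 := near t ltac:(lra).
  have a2 : norm (minus (z s) (y n s)) < e / 3.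
  { apply: near.
    have b : Rabs (W s - W t) < 1 := hd2 s (Rlt_le_trans _ _ _ hs (Rmin_r _ _)).
    have := Rabs_triang_inv (W s) (W t); lra. }
  have a3 := k1 s (Rlt_le_trans _ _ _ hs (Rmin_l _ _)).
  have b1 := norm_minus_trans (y n s) (z s) (z t).
  have b2 := norm_minus_trans (y n t) (y n s) (z t).
  rewrite (norm_minus_sym (y n t)) in b2; lra.
Qed.

(** Integration from 0 gains the factor [1 / lam] against the weight [exp (lam |t|)], on both sides
    of 0. Thanks to this gain Picard iteration converges without restriction on time. *)
Lemma RInt_exp_abs_le (f : R -> H) C lam t : 0 < lam -> 0 <= C -> (forall s, continuous f s) ->
  (forall s, norm (f s) <= C * exp (lam * Rabs s)) ->
  norm (RInt f 0 t) <= C / lam * exp (lam * Rabs t).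
Proof.
  move=> hl hC hc hle.
  have hCl : 0 <= C / lam by apply: Rdiv_le_0_compat.
  case: (Rle_dec 0 t) => ht.
  - apply: (Rle_trans _ (C / lam * (exp (lam * t) - exp (lam * 0)))).
    + apply: (@RInt_norm_le _ f (fun s => C * exp (lam * s)) 0 t) => //.
      * move=> s hs; rewrite -{2}(Rabs_pos_eq s); [exact: hle | lra].
      * exact: RInt_is.
      * apply: is_RInt_exp; lra.
    + rewrite Rabs_pos_eq //; apply: Rmult_le_compat_l => //; have := exp_pos (lam * 0); lra.
  - have ht' : t <= 0 by lra.
    rewrite -opp_RInt_swap; last by eexists; apply: RInt_is.
    rewrite norm_opp.
    apply: (Rle_trans _ (C / (- lam) * (exp (- lam * 0) - exp (- lam * t)))).
    + apply: (@RInt_norm_le _ f (fun s => C * exp (- lam * s)) t 0) => //.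
      * move=> s hs; have -> : - lam * s = lam * Rabs s by rewrite Rabs_left1; lra.
        exact: hle.
      * exact: RInt_is.
      * apply: is_RInt_exp; lra.
    + rewrite (Rabs_left1 t) //.
      have -> : C / - lam * (exp (- lam * 0) - exp (- lam * t))
        = C / lam * (exp (lam * - t) - exp (- lam * 0)).
      { have -> : - lam * t = lam * - t by ring. field; lra. }
      apply: Rmult_le_compat_l => //; have := exp_pos (- lam * 0); lra.
Qed.

Lemma continuous_exp_abs lam s : continuous (fun s => exp (lam * Rabs s)) s.
Proof.
  apply: (continuous_comp (fun s => lam * Rabs s) exp).
  - apply: (continuous_scal_r (V := R_NormedModule)); exact: continuous_Rabs.
  - apply: ex_derive_continuous; by auto_derive.
Qed.

Lemma continuous_lipschitz_field (B : R -> H -> H) (y : R -> H) L t :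
  (forall s x z, norm (minus (B s x) (B s z)) <= L * norm (minus x z)) ->
  (forall x, continuous (fun s => B s x) t) -> continuous y t ->
  continuous (fun s => B s (y s)) t.
Proof.
  move=> hL hB hy.
  apply: (continuous_dominated (k := fun s => L * norm (minus (y s) (y t)) + norm (minus (B s (y t)) (B t (y t))))).
  - apply: (continuous_plus (V := R_NormedModule)); last by apply: continuous_dist; apply: hB.
    apply: (continuous_scal_r (V := R_NormedModule)); exact: continuous_dist.
  - rewrite !minus_eq_zero norm_zeroR; lra.
  - move=> s; apply: Rle_trans (norm_minus_trans (B s (y t)) _ _) _.
    exact: Rplus_le_compat_r.
Qed.

Theorem picard (B : R -> H -> H) (y0 : H) L M :
  (forall s x z, norm (minus (B s x) (B s z)) <= L * norm (minus x z)) ->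
  (forall x s, continuous (fun r => B r x) s) ->
  (forall s, norm (B s y0) <= M) ->
  exists y : R -> H, y 0 = y0 /\ forall t, is_derive y t (B t (y t)).
Proof.
  move=> hL hB hM.
  (* [l] is positive whatever the sign of [L], and the weight rate [2 l] gives the contraction
     factor [l / (2 l) = 1 / 2]. *)
  pose l := Rabs L + 1; have hl : 0 < l by rewrite /l; have := Rabs_pos L; lra.
  have hl' s x z : norm (minus (B s x) (B s z)) <= l * norm (minus x z).
  { apply: Rle_trans (hL s x z) _; apply: Rmult_le_compat_r; first exact: norm_nonneg.
    rewrite /l; have := Rle_abs L; lra. }
  have cB (y : R -> H) : (forall s, continuous y s) -> forall s, continuous (fun s => B s (y s)) s.
  { by move=> hy s; apply: (continuous_lipschitz_field hL). }
  have M0 : 0 <= M by apply: Rle_trans (hM 0); exact: norm_nonneg.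
  pose y := fix y n := match n with
    | O => fun _ : R => y0
    | S n => fun t => plus y0 (RInt (fun s => B s (y n s)) 0 t) end.
  have cy n s : continuous (y n) s.
  { elim: n s => [|n IH] s; first exact: continuous_const.
    apply: continuous_plus; first exact: continuous_const.
    apply: derive_continuous; apply: RInt_derive; exact: cB. }
  have lam : 0 < 2 * l by lra.
  have RI (f g : R -> H) t : (forall s, continuous f s) -> (forall s, continuous g s) ->
    minus (RInt f 0 t) (RInt g 0 t) = RInt (fun s => minus (f s) (g s)) 0 t.
  { move=> hf hg; symmetry; apply: is_RInt_unique; apply: is_RInt_minus; exact: RInt_is. }
  have cdiff (f g : R -> H) : (forall s, continuous f s) -> (forall s, continuous g s) ->
    forall s, continuous (fun s => minus (f s) (g s)) s.
  { by move=> hf hg s; apply: continuous_minus. }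
  have hW s : 1 <= exp (2 * l * Rabs s).
  { rewrite -exp_0; case: (Rle_lt_or_eq_dec _ _ (Rmult_le_pos _ _ (Rlt_le _ _ lam) (Rabs_pos s))).
    - move=> h; left; exact: exp_increasing.
    - move=> <-; lra. }
  have hy n s : norm (minus (y (S n) s) (y n s)) <= M / (2 * l) * (1 / 2) ^ n * exp (2 * l * Rabs s).
  { elim: n s => [|n IH] s.
    - have -> : minus (y 1%nat s) (y 0%nat s) = RInt (fun s => B s y0) 0 s by rewrite /=; vec.
      rewrite /= Rmult_1_r; apply: RInt_exp_abs_le => //.
      + move=> r; have := hM r; have := hW r; nra.
    - have -> : minus (y (S (S n)) s) (y (S n) s)
         = RInt (fun s => minus (B s (y (S n) s)) (B s (y n s))) 0 s.
      { rewrite -RI; [ | exact: cB | exact: cB]. rewrite /=; vec. }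
      have -> : M / (2 * l) * (1 / 2) ^ S n = (l * (M / (2 * l) * (1 / 2) ^ n)) / (2 * l)
        by rewrite /=; field; lra.
      apply: RInt_exp_abs_le => //.
      + apply: Rmult_le_pos; first lra. apply: Rmult_le_pos; last by apply: pow_le; lra.
        apply: Rdiv_le_0_compat; lra.
      + apply: cdiff; exact: cB.
      + move=> r; apply: Rle_trans (hl' _ _ _) _; rewrite Rmult_assoc.
        apply: Rmult_le_compat_l; first lra. exact: IH. }
  have hK : 0 <= 1 / 2 < 1 by lra.
  have [z [cz hz]] := weighted_limit hK cy (@continuous_exp_abs (2 * l)) hy.
  have eqz t : z t = plus y0 (RInt (fun s => B s (z s)) 0 t).
  { apply: (@tends_unique _ (fun n => y (S n) t)).
    - apply: (@tends_squeeze _ _ _ (fun n => M / (2 * l) / (1 - 1 / 2) * exp (2 * l * Rabs t) * (1 / 2) * (1 / 2) ^ n)).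
      + exact: pow_lim0.
      + move=> n; rewrite norm_minus_sym; apply: Rle_trans (hz (S n) t) _.
        right; rewrite /=; field; lra.
    - apply: (@tends_squeeze _ _ _ (fun n => (l * (M / (2 * l) / (1 - 1 / 2)) / (2 * l) * exp (2 * l * Rabs t)) * (1 / 2) ^ n)).
      + exact: pow_lim0.
      + move=> n.
        have -> : minus (y (S n) t) (plus y0 (RInt (fun s => B s (z s)) 0 t))
          = RInt (fun s => minus (B s (y n s)) (B s (z s))) 0 t.
        { rewrite -RI; [ | exact: cB | exact: cB]. rewrite /=; vec. }
        have -> : (l * (M / (2 * l) / (1 - 1 / 2)) / (2 * l) * exp (2 * l * Rabs t)) * (1 / 2) ^ n
          = (l * (M / (2 * l) / (1 - 1 / 2) * (1 / 2) ^ n)) / (2 * l) * exp (2 * l * Rabs t) by field; lra.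
        apply: RInt_exp_abs_le => //.
        * apply: Rmult_le_pos; first lra. apply: Rmult_le_pos; last by apply: pow_le; lra.
          apply: Rdiv_le_0_compat; last lra. apply: Rdiv_le_0_compat; lra.
        * apply: cdiff; exact: cB.
        * move=> r; apply: Rle_trans (hl' _ _ _) _; rewrite Rmult_assoc.
          apply: Rmult_le_compat_l; first lra. rewrite norm_minus_sym; exact: hz. }
  exists z; split.
  - rewrite eqz RInt_point; vec.
  - move=> t; apply: (is_derive_ext (fun t => plus y0 (RInt (fun s => B s (z s)) 0 t))).
    { by move=> s; rewrite -eqz. }
    have -> : B t (z t) = plus zero (B t (z t)) by rewrite plus_zero_l.
    apply: is_derive_plus; first exact: is_derive_const.
    apply: (RInt_derive (f := fun s => B s (z s))); exact: cB.
Qed.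

End Energy.

(** * Self-adjoint operators and bounded flows *)

Lemma scaled_square_zero c p : 0 < c -> c * p ^ 2 <= 0 -> p = 0.
Proof.
  move=> hc h; case: (Req_dec p 0) => // np.
  have := Rmult_lt_0_compat _ _ hc (pow2_gt_0 _ np); lra.
Qed.

Section SelfAdjoint.
Context {H : Hilbert} (A : operator H).
Hypothesis sa : self_adjoint A.
Implicit Types x y z : H.

Lemma dom_zero : dom A zero.
Proof. by case: sa => [[? _] _]. Qed.

Lemma dom_plus x y : dom A x -> dom A y -> dom A (plus x y).
Proof. by case: sa => [[_ [h _]] _] hx hy; case: (h x y hx hy). Qed.

Lemma op_plus x y : dom A x -> dom A y -> A (plus x y) = plus (A x) (A y).
Proof. by case: sa => [[_ [h _]] _] hx hy; case: (h x y hx hy). Qed.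

Lemma dom_scal (a : R) x : dom A x -> dom A (scal a x).
Proof. by case: sa => [[_ [_ h]] _] hx; case: (h a x hx). Qed.

Lemma op_scalE (a : R) x : dom A x -> A (scal a x) = scal a (A x).
Proof. by case: sa => [[_ [_ h]] _] hx; case: (h a x hx). Qed.

Lemma minusE x y : minus x y = plus x (scal (-1) y).
Proof. vec. Qed.

Lemma dom_minus x y : dom A x -> dom A y -> dom A (minus x y).
Proof. move=> hx hy; rewrite minusE; apply: dom_plus => //; exact: dom_scal. Qed.

Lemma op_minus x y : dom A x -> dom A y -> A (minus x y) = minus (A x) (A y).
Proof.
  move=> hx hy; rewrite minusE op_plus ?op_scalE //; last exact: dom_scal.
  by rewrite -minusE.
Qed.

Lemma sa_dense x (r : R) : 0 < r -> exists y, dom A y /\ norm (minus x y) < r.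
Proof. case: sa => _ [h _]; exact: h. Qed.

Lemma sa_adjoint y z : (forall x, dom A x -> inner (A x) y = inner x z) -> dom A y /\ A y = z.
Proof. by case: sa => _ [_ h] hx; apply/h. Qed.

Lemma sa_symmetric x y : dom A x -> dom A y -> inner (A x) y = inner x (A y).
Proof. by case: sa => _ [_ h] hx hy; apply: (proj1 (h y (A y))). Qed.

Lemma sa_closed (u : nat -> H) x y : (forall n, dom A (u n)) ->
  tends u x -> tends (fun n => A (u n)) y -> dom A x /\ A x = y.
Proof.
  move=> hd hu hA; apply: sa_adjoint => v hv.
  have h1 := tends_inner (y := v) hA; have h2 := tends_inner (y := A v) hu.
  have : is_lim_seq (fun n => inner (A (u n)) v) (inner x (A v)).
  { apply: (is_lim_seq_ext _ _ _ _ h2) => n; by rewrite sa_symmetric. }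
  move=> h3; have := is_lim_seq_unique _ _ h1; rewrite (is_lim_seq_unique _ _ h3).
  by case=> E; rewrite (inner_sym _ x) E inner_sym.
Qed.

Lemma norm_op_ge c x : 0 < c -> bounded_below_by c A -> dom A x -> c * norm x <= norm (A x).
Proof.
  move=> hc hb hx; have h1 := hb x hx; have h2 := inner_le (A x) x.
  case: (Req_dec (norm x) 0) => [-> | n0]; first by rewrite Rmult_0_r; apply: norm_nonneg.
  have n1 : 0 < norm x by have := norm_nonneg x; lra.
  apply: (Rmult_le_reg_r (norm x)) => //; lra.
Qed.

Lemma inv_succ_small e : 0 < e -> exists N, forall n, (N <= n)%nat -> / (INR n + 1) < e.
Proof.
  move=> he; have [N hN] := archimed_cor1 e he; exists N => n hn.
  apply: Rle_lt_trans (proj1 hN); apply: Rinv_le_contravar.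
  - apply: lt_0_INR; lia.
  - have := le_INR _ _ hn; lra.
Qed.

Lemma inv_succ_pos n : 0 < / (INR n + 1).
Proof. apply: Rinv_0_lt_compat; have := pos_INR n; lra. Qed.

(* The range is closed because [c |x| <= |A x|]; the residual of the best approximation
   of [y] in the range is orthogonal to the range, hence in the kernel of [A]. *)
Lemma sa_surjective c y : 0 < c -> bounded_below_by c A -> exists x, dom A x /\ A x = y.
Proof.
  move=> hc hb.
  pose E r := exists x, dom A x /\ r = - norm (minus y (A x)) ^ 2.
  have [m [hm1 hm2]] : exists m, is_lub E m.
  { have [|| m hm] := completeness E; last by exists m.
    - exists 0 => r [x [_ ->]]; have := norm_nonneg (minus y (A x)); nra.
    - exists (- norm (minus y (A zero)) ^ 2); exists zero; split=> //; exact: dom_zero. }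
  have low x : dom A x -> - m <= norm (minus y (A x)) ^ 2.
  { move=> hx; have := hm1 (- norm (minus y (A x)) ^ 2) ltac:(by exists x); lra. }
  have [u hu] : exists u : nat -> H, forall n, dom A (u n) /\
      norm (minus y (A (u n))) ^ 2 < - m + / (INR n + 1).
  { apply: (@choose _ _ (fun n x => dom A x /\ norm (minus y (A x)) ^ 2 < - m + / (INR n + 1))) => n.
    apply: NNPP => hn; have := hm2 (m - / (INR n + 1)) => h; have hp := inv_succ_pos n.
    have : m <= m - / (INR n + 1); last lra.
    apply: h => r [x [hx ->]]; apply: Rnot_lt_le => hl; apply: hn; exists x; split=> //; lra. }
  (* Parallelogram identity: the midpoint of [u n] and [u k] is again a competitor, so the squared
     distance of the two images is at most [2 (e^2 / 4 + e^2 / 4)], from the two excesses over the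
     infimum. *)
  have cau e : 0 < e -> exists N, forall n k, (N <= n)%nat -> (N <= k)%nat ->
      norm (minus (A (u n)) (A (u k))) < e.
  { move=> he; have [N hN] := @inv_succ_small (e ^ 2 / 4) ltac:(nra).
    exists N => n k hn hk; have [d1 k1] := hu n; have [d2 k2] := hu k.
    have i1 := hN n hn; have i2 := hN k hk.
    have dm : dom A (scal (/ 2) (plus (u n) (u k))) by apply: dom_scal; apply: dom_plus.
    have lw := low _ dm; rewrite op_scalE ?op_plus // in lw; last by apply: dom_plus.
    rewrite -!inner_norm !innerE in k1 k2 lw.
    have : norm (minus (A (u n)) (A (u k))) ^ 2 < e ^ 2.
    { rewrite -inner_norm !innerE.
      rewrite (inner_sym (A (u n)) y) in k1 lw; rewrite (inner_sym (A (u k)) y) in k2 lw.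
      rewrite (inner_sym (A (u k)) (A (u n))) in lw *. lra. }
    have := norm_nonneg (minus (A (u n)) (A (u k))); nra. }
  have [z hz] := tends_cauchy cau.
  have [x hx] : exists x, tends u x.
  { apply: tends_cauchy => e he; have [N hN] := cau (c * e) ltac:(nra).
    exists N => n k hn hk; have := hN n k hn hk.
    rewrite -op_minus; [ | exact: (proj1 (hu n)) | exact: (proj1 (hu k))].
    have := @norm_op_ge c (minus (u n) (u k)) hc hb
      ltac:(apply: dom_minus; [exact: (proj1 (hu n)) | exact: (proj1 (hu k))]).
    move=> h1 h2; apply: (Rmult_lt_reg_l c) => //; lra. }
  have [dx Ax] := sa_closed (fun n => proj1 (hu n)) hx hz.
  have rm : norm (minus y (A x)) ^ 2 <= - m.
  { apply: le_epsilon => e he.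
    set r := sqrt (- m + e).
    have hme : 0 <= - m + e.
    { have : m <= 0; last lra. apply: hm2 => q [v [_ ->]].
      have := norm_nonneg (minus y (A v)); nra. }
    have -> : - m + e = r ^ 2 by rewrite /r pow2_sqrt.
    have r0 : 0 <= r by apply: sqrt_pos.
    have : norm (minus y (A x)) <= r; last by have := norm_nonneg (minus y (A x)); nra.
    rewrite Ax norm_minus_sym; apply: (tends_bound hz).
    have [N hN] := inv_succ_small he; exists N => n hn.
    rewrite norm_minus_sym -(sqrt_pow2 (norm _)); last exact: norm_nonneg.
    apply: sqrt_le_1_alt; have := hN n hn; have := proj2 (hu n); lra. }
  have orth v : dom A v -> inner (A v) (minus y (A x)) = inner v zero.
  { move=> hv; rewrite inner_zero_r.
    have ineq t : 0 <= t ^ 2 * norm (A v) ^ 2 - 2 * t * inner (A v) (minus y (A x)).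
    { have := low (plus x (scal t v)) ltac:(apply: dom_plus => //; exact: dom_scal).
      rewrite op_plus ?op_scalE //; last exact: dom_scal.
      have -> : norm (minus y (plus (A x) (scal t (A v)))) ^ 2
        = norm (minus y (A x)) ^ 2 + t ^ 2 * norm (A v) ^ 2 - 2 * t * inner (A v) (minus y (A x)).
      { rewrite -!inner_norm !innerE (inner_sym (A v) y) (inner_sym (A v) (A x)) (inner_sym (A x) y).
        ring. }
      lra. }
    set p := inner (A v) (minus y (A x)) in ineq *; set q := norm (A v) ^ 2 in ineq.
    have q0 : 0 <= q by rewrite /q; have := norm_nonneg (A v); nra.
    (* The minimizing parameter would be [p / q]; the added 1 keeps the quotient meaningful when
       [A v = 0] and still yields a negative multiple of [p^2]. *)
    have := ineq (p / (q + 1)).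
    have -> : (p / (q + 1)) ^ 2 * q - 2 * (p / (q + 1)) * p = - (p ^ 2 * ((q + 2) / (q + 1) ^ 2)) by field; lra.
    move=> h; have hq : 0 < (q + 2) / (q + 1) ^ 2 by apply: Rdiv_lt_0_compat; nra.
    apply: (@scaled_square_zero _ p hq); lra. }
  have [dr Ar] := sa_adjoint orth.
  have := hb _ dr; rewrite Ar inner_zero => h.
  exists x; split=> //; symmetry; apply: minus_eq0.
  apply: (@scaled_square_zero c _ hc); lra.
Qed.

(** Being symmetric and defined everywhere, [K] moves to the other side of the adjoint identity, and
    what remains is the adjoint identity of [A] up to the factor [c]. This serves for rescaling the
    fast operator, for [1 + lam A], for the shift that inverts the upper part and for the
    renormalized operator. *)
Lemma sa_perturb (B : operator H) (c : R) (K : H -> H) : c <> 0 -> is_linear K ->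
  (forall x y, inner (K x) y = inner x (K y)) ->
  (forall x, dom B x <-> dom A x) -> (forall x, B x = plus (scal c (A x)) (K x)) ->
  self_adjoint B.
Proof.
  move=> hc hK sK hd hB; split; [ | split].
  - split; first by apply/hd; exact: dom_zero.
    split.
    + move=> x y /hd hx /hd hy; split; first by apply/hd; exact: dom_plus.
      rewrite !hB op_plus // (linear_plus _ hK); vec.
    + move=> a x /hd hx; split; first by apply/hd; exact: dom_scal.
      rewrite !hB op_scalE // (linear_scal _ hK); vec.
  - move=> x r hr; have [y [hy h]] := sa_dense x hr; exists y; split=> //; exact/hd.
  - move=> y z; split.
    + move=> [/hd hy <-] x /hd hx; rewrite !hB !innerE sa_symmetric // sK; ring.
    + move=> h.
      have [dy Ay] : dom A y /\ A y = scal (/ c) (minus z (K y)).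
      { apply: sa_adjoint => x hx; have := h x ltac:(exact/hd).
        rewrite !hB !innerE sK => E; have -> : inner x z = c * inner (A x) y + inner x (K y) by lra.
        field; exact: hc. }
      split; first exact/hd.
      rewrite hB Ay; vec; field; exact: hc.
Qed.

End SelfAdjoint.

(** * Flows of bounded positive operators *)

Section BoundedGenerator.
Context {H : Hilbert}.
Implicit Types (x : H) (y z : R -> H).

Definition symmetric (B : H -> H) := forall x x', inner (B x) x' = inner x (B x').
Definition positive (B : H -> H) := forall x, 0 <= inner (B x) x.
Definition flows (B : H -> H) (y : R -> H) := forall t, is_derive y t (opp (B (y t))).

Lemma flow_exists (B : H -> H) x : is_linear B -> exists y, y 0 = x /\ flows B y.
Proof.
  move=> hB; have [M [hM hb]] := linear_norm _ hB.
  apply: (@picard _ (fun _ x => opp (B x)) x M (norm (opp (B x)))).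
  - move=> _ u v.
    have -> : minus (opp (B u)) (opp (B v)) = opp (B (minus u v)) by rewrite (linear_minus _ _ _ hB); vec.
    rewrite norm_opp; exact: hb.
  - move=> u s; exact: continuous_const.
  - move=> _; exact: Rle_refl.
Qed.

Lemma derive_minus (f g : R -> H) t f' g' : is_derive f t f' -> is_derive g t g' ->
  is_derive (fun s => minus (f s) (g s)) t (minus f' g').
Proof. exact: is_derive_minus. Qed.

Lemma energy_global (z dz : R -> H) rho T : 0 <= T -> 0 <= rho ->
  (forall s, is_derive z s (dz s)) ->
  (forall s, 0 < s < T -> inner (dz s) (z s) <= rho * norm (z s)) ->
  norm (z T) <= norm (z 0) + rho * T.
Proof.
  move=> hT hr hd hle; apply: (energy_le hT hr) hle => s _ //.
  apply: derive_continuous; exact: hd.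
Qed.

Lemma flow_unique (B : H -> H) y z t : is_linear B -> positive B -> flows B y -> flows B z ->
  y 0 = z 0 -> 0 <= t -> y t = z t.
Proof.
  move=> hB pB hy hz h0 ht; apply: minus_eq0.
  have := @energy_global (fun s => minus (y s) (z s))
    (fun s => minus (opp (B (y s))) (opp (B (z s)))) 0 t ht (Rle_refl 0)
    (fun s => derive_minus (hy s) (hz s)).
  rewrite h0 minus_eq_zero norm_zeroR => h.
  have := norm_nonneg (minus (y t) (z t)); have : norm (minus (y t) (z t)) <= 0 + 0 * t; last lra.
  apply: h => s hs.
  have -> : minus (opp (B (y s))) (opp (B (z s))) = opp (B (minus (y s) (z s)))
    by rewrite (linear_minus _ _ _ hB); vec.
  rewrite inner_opp; have := pB (minus (y s) (z s)); lra.
Qed.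

Lemma flow_contraction (B : H -> H) y t : positive B -> flows B y -> 0 <= t -> norm (y t) <= norm (y 0).
Proof.
  move=> pB hy ht; have -> : norm (y 0) = norm (y 0) + 0 * t by ring.
  apply: (@energy_global y (fun s => opp (B (y s))) 0 t) => // [|s hs]; first lra.
  rewrite inner_opp; have := pB (y s); lra.
Qed.

Lemma flow_comm (B C : H -> H) y : is_linear C -> (forall x, C (B x) = B (C x)) -> flows B y ->
  flows B (fun t => C (y t)).
Proof.
  move=> hC hBC hy t; rewrite -hBC.
  have -> : opp (C (B (y t))) = C (opp (B (y t))) by rewrite (linear_opp _ _ hC).
  exact: derive_linear.
Qed.

(** The velocity is, up to sign, [B y], itself a flow of [B], so its norm never exceeds the initial
    one. *)
Lemma flow_displacement (B : H -> H) y t : is_linear B -> positive B -> flows B y -> 0 <= t ->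
  norm (minus (y t) (y 0)) <= t * norm (B (y 0)).
Proof.
  move=> hB pB hy ht.
  have := @energy_global (fun s => minus (y s) (y 0)) (fun s => opp (B (y s))) (norm (B (y 0))) t ht (norm_nonneg _).
  rewrite minus_eq_zero norm_zeroR Rplus_0_l Rmult_comm; apply.
  - move=> s; have -> : opp (B (y s)) = minus (opp (B (y s))) zero by vec.
    apply: derive_minus; [exact: hy | exact: is_derive_const].
  - move=> s [hs _]; apply: Rle_trans (inner_le _ _) _.
    apply: Rmult_le_compat_r; first exact: norm_nonneg.
    rewrite norm_opp.
    exact: (flow_contraction pB (flow_comm hB (fun _ => eq_refl) hy) (Rlt_le _ _ hs)).
Qed.

Lemma flow_plus (B : H -> H) y z : is_linear B -> flows B y -> flows B z ->
  flows B (fun t => plus (y t) (z t)).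
Proof.
  move=> hB hy hz t; rewrite (linear_plus _ hB).
  have -> : opp (plus (B (y t)) (B (z t))) = plus (opp (B (y t))) (opp (B (z t))) by vec.
  by apply: is_derive_plus.
Qed.

Lemma flow_shift (B : H -> H) y s : flows B y -> flows B (fun t => y (t + s)).
Proof.
  move=> hy t.
  have -> : opp (B (y (t + s))) = scal 1 (opp (B (y (t + s)))) by rewrite scal_one.
  apply: (is_derive_comp y (fun t => t + s)); first exact: hy.
  auto_derive => //.
Qed.

(** [<y s, z (t - s)>] is constant in [s], its derivative being [- <B y, z> + <y, B z>]. *)
Lemma flow_symmetric (B : H -> H) y z t : is_linear B -> symmetric B -> flows B y -> flows B z ->
  0 <= t -> inner (y t) (z 0) = inner (y 0) (z t).
Proof.
  move=> hB sB hy hz ht.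
  have dz s : is_derive (fun s => z (t - s)) s (B (z (t - s))).
  { have -> : B (z (t - s)) = scal (-1) (opp (B (z (t - s)))) by vec.
    apply: (is_derive_comp z (fun s => t - s)); first exact: hz.
    auto_derive => //; ring. }
  have d s : is_derive (fun s => inner (y s) (z (t - s))) s 0.
  { have -> : 0 = inner (opp (B (y s))) (z (t - s)) + inner (y s) (B (z (t - s)))
      by rewrite inner_opp sB; ring.
    by apply: derive_inner. }
  have := @eq_is_derive _ (fun s => inner (y s) (z (t - s))) 0 t (fun s _ => d s).
  case: (Rle_lt_or_eq_dec _ _ ht) => [h /(_ h) | <- _]; last by [].
  by rewrite Rminus_0_r Rminus_diag => ->.
Qed.

(** The difference [w] satisfies [w' = - B w + D z] with [D = C - B]. As [D] commutes with [C],
    [D z] is a flow of [C] and stays below its initial norm; positivity of [B] discards the other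
    term. *)
Lemma flow_compare (B C : H -> H) y z t : is_linear B -> is_linear C -> positive B -> positive C ->
  (forall x, B (C x) = C (B x)) -> flows B y -> flows C z -> y 0 = z 0 -> 0 <= t ->
  norm (minus (y t) (z t)) <= t * norm (minus (B (y 0)) (C (y 0))).
Proof.
  move=> hB hC pB pC hBC hy hz h0 ht.
  pose D x := minus (C x) (B x).
  have hD : is_linear D.
  { rewrite /D /minus; apply: (is_linear_comp (fun x => (C x, opp (B x))) (fun p => plus (fst p) (snd p))).
    - apply: is_linear_prod => //; apply: (is_linear_comp B opp) => //; exact: is_linear_opp.
    - exact: is_linear_plus. }
  have hDC x : D (C x) = C (D x) by rewrite /D hBC (linear_minus _ _ _ hC).
  have hDz : flows C (fun t => D (z t)) by apply: flow_comm.
  have := @energy_global (fun s => minus (y s) (z s))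
    (fun s => minus (opp (B (y s))) (opp (C (z s)))) (norm (D (z 0))) t ht (norm_nonneg _)
    (fun s => derive_minus (hy s) (hz s)).
  rewrite h0 minus_eq_zero norm_zeroR => h.
  have -> : norm (minus (B (z 0)) (C (z 0))) = norm (D (z 0)) by rewrite norm_minus_sym.
  have : norm (minus (y t) (z t)) <= 0 + norm (D (z 0)) * t; last lra.
  apply: h => s hs.
  have -> : minus (opp (B (y s))) (opp (C (z s)))
    = plus (opp (B (minus (y s) (z s)))) (D (z s)) by rewrite /D (linear_minus _ _ _ hB); vec.
  rewrite inner_plus inner_opp.
  have h1 := pB (minus (y s) (z s)); have h2 := inner_le (D (z s)) (minus (y s) (z s)).
  have h3 := flow_contraction pC hDz (Rlt_le _ _ (proj1 hs)).
  have := Rmult_le_compat_r _ _ _ (norm_nonneg (minus (y s) (z s))) h3; lra.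
Qed.

End BoundedGenerator.

(** * Generation of the semigroup by Yosida approximation *)

Section Yosida.
Context {H : Hilbert} (A : operator H).
Hypothesis sa : self_adjoint A.
Hypothesis pos : bounded_below_by 0 A.
Implicit Types x y z : H.

(** [J] is [(1 + lam A)^-1]; with this normalization it is a contraction for every [lam > 0], and it
    tends strongly to the identity as [lam] tends to 0. *)
Definition resolvent (lam : R) (J : H -> H) :=
  forall y, dom A (J y) /\ plus (J y) (scal lam (A (J y))) = y.

Lemma op_nonneg x : dom A x -> 0 <= inner (A x) x.
Proof. move=> hx; have := pos hx; lra. Qed.

Lemma resolvent_exists lam : 0 < lam -> exists J, resolvent lam J.
Proof.
  move=> hl; apply: (@choose _ _ (fun y x => dom A x /\ plus x (scal lam (A x)) = y)) => y.
  pose B := {| dom := dom A; op := fun x => plus (scal lam (A x)) x |}.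
  have sB : self_adjoint B.
  { apply: (@sa_perturb _ A sa B lam (fun x => x)) => //; first lra. exact: is_linear_id. }
  have bB : bounded_below_by 1 B.
  { move=> x hx; rewrite /= !innerE inner_norm.
    have := Rmult_le_pos _ _ (Rlt_le _ _ hl) (op_nonneg hx); lra. }
  have [x [hx hB]] := sa_surjective sB y Rlt_0_1 bB.
  exists x; split=> //; by rewrite -hB plus_comm.
Qed.

Section Resolvent.
Context (lam : R) (J : H -> H).
Hypothesis hl : 0 < lam.
Hypothesis hJ : resolvent lam J.

Lemma res_dom y : dom A (J y).
Proof. by case: (hJ y). Qed.

Lemma resE y : plus (J y) (scal lam (A (J y))) = y.
Proof. by case: (hJ y). Qed.

Lemma res_injective x y : dom A x -> dom A y ->
  plus x (scal lam (A x)) = plus y (scal lam (A y)) -> x = y.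
Proof.
  move=> hx hy E; apply: minus_eq0; set d := minus x y.
  have hd : dom A d by apply: dom_minus.
  have E2 : plus d (scal lam (A d)) = zero.
  { rewrite /d op_minus //.
    have -> : plus (minus x y) (scal lam (minus (A x) (A y)))
       = minus (plus x (scal lam (A x))) (plus y (scal lam (A y))) by vec.
    rewrite E; vec. }
  have : inner (plus d (scal lam (A d))) d = 0 by rewrite E2 inner_zero.
  rewrite inner_plus inner_scal inner_norm => E3.
  have := Rmult_le_pos _ _ (Rlt_le _ _ hl) (op_nonneg hd).
  move=> h; apply: (@scaled_square_zero 1); lra.
Qed.

Lemma res_unique x y : dom A x -> plus x (scal lam (A x)) = y -> J y = x.
Proof. move=> hx E; apply: res_injective => //; [exact: res_dom | by rewrite resE E]. Qed.

Lemma res_norm y : norm (J y) <= norm y.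
Proof.
  have h : inner (J y) (plus (J y) (scal lam (A (J y)))) = inner (J y) (J y) + lam * inner (A (J y)) (J y).
  { rewrite !innerE (inner_sym (A _)); ring. }
  rewrite resE in h.
  have := Rmult_le_pos _ _ (Rlt_le _ _ hl) (op_nonneg (res_dom y)).
  have := inner_le (J y) y; rewrite h inner_norm => h1 h2.
  case: (Req_dec (norm (J y)) 0) => [-> | n0]; first exact: norm_nonneg.
  have n1 : 0 < norm (J y) by have := norm_nonneg (J y); lra.
  apply: (Rmult_le_reg_l (norm (J y))) => //; lra.
Qed.

Lemma res_linear : is_linear J.
Proof.
  split.
  - move=> x y; apply: res_unique; first by apply: dom_plus => //; exact: res_dom.
    rewrite op_plus //; try exact: res_dom.
    apply: (eq_trans _ (f_equal2 plus (resE x) (resE y))); vec.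
  - move=> k x; apply: res_unique; first by apply: dom_scal => //; exact: res_dom.
    rewrite op_scalE //; last exact: res_dom.
    apply: (eq_trans _ (f_equal (scal k) (resE x))); vec.
  - exists 1; split; first lra. move=> x; rewrite Rmult_1_l; exact: res_norm.
Qed.

Lemma res_symmetric : symmetric J.
Proof.
  move=> x y; have h := sa_symmetric sa (res_dom x) (res_dom y).
  have : inner (J x) (plus (J y) (scal lam (A (J y)))) = inner (plus (J x) (scal lam (A (J x)))) (J y)
    by rewrite !innerE h.
  by rewrite !resE.
Qed.

(** The Yosida approximation, written without [A] so that its boundedness is evident; it equals
    [A J] everywhere and [J A] on the domain. *)
Definition yosida x := scal (/ lam) (minus x (J x)).

Lemma yosidaE x : yosida x = A (J x).
Proof.
  apply: (eq_trans (f_equal (fun v => scal (/ lam) (minus v (J x))) (eq_sym (resE x)))).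
  vec; field; lra.
Qed.

Lemma yosida_dom x : dom A x -> yosida x = J (A x).
Proof.
  move=> hx; symmetry; apply: res_unique.
  - apply: dom_scal => //; apply: dom_minus => //; exact: res_dom.
  - rewrite {1}yosidaE /yosida op_scalE ?op_minus //; try exact: res_dom;
      last by apply: dom_minus => //; exact: res_dom.
    vec; field; lra.
Qed.

Lemma yosida_linear : is_linear yosida.
Proof.
  apply: (is_linear_comp (fun x => minus x (J x)) (fun x => scal (/ lam) x)).
  - apply: (is_linear_comp (fun x => (x, opp (J x))) (fun p => plus (fst p) (snd p))).
    + apply: is_linear_prod; first exact: is_linear_id.
      apply: (is_linear_comp J opp); [exact: res_linear | exact: is_linear_opp].
    + exact: is_linear_plus.
  - apply: is_linear_scal_r; exact: Rmult_comm.
Qed.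

Lemma yosida_symmetric : symmetric yosida.
Proof. move=> x y; rewrite /yosida !innerE res_symmetric; ring. Qed.

(** Writing [Y] for the approximation, [x = J x + lam Y x] gives
    [<Y x, x> = <A J x, J x> + lam |Y x|^2]. *)
Lemma yosida_positive : positive yosida.
Proof.
  move=> x; have := op_nonneg (res_dom x); rewrite -yosidaE => h.
  have -> : inner (yosida x) x = inner (yosida x) (plus (J x) (scal lam (yosida x)))
    by rewrite {3}yosidaE resE.
  rewrite inner_plus_r inner_scal_r inner_norm.
  have := Rmult_le_pos _ _ (Rlt_le _ _ hl) (pow2_ge_0 (norm (yosida x))); lra.
Qed.

Lemma res_approx x : dom A x -> norm (minus x (J x)) <= lam * norm (A x).
Proof.
  move=> hx; have -> : minus x (J x) = scal lam (yosida x) by rewrite /yosida; vec; field; lra.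
  rewrite norm_scalR Rabs_pos_eq; last lra.
  apply: Rmult_le_compat_l; first lra. rewrite yosida_dom //; exact: res_norm.
Qed.

End Resolvent.

(** For [b = K (J x)], the vector [A b] is a combination of [J x] and [b], so [b] lies in the domain
    of [A^2]. Hence [1 + mu A] may be applied to [(1 + lam A) b] and gives [x]; so [(1 + lam A) b]
    is [K x], and applying [J] returns [b]. *)
Lemma res_commute lam mu J K x : 0 < lam -> 0 < mu -> resolvent lam J -> resolvent mu K ->
  J (K x) = K (J x).
Proof.
  move=> hl hm hJ hK; set b := K (J x).
  have db : dom A b := res_dom hK _.
  have Eb : plus b (scal mu (A b)) = J x := resE hK _.
  have dAb : dom A (A b).
  { have -> : A b = scal (/ mu) (minus (J x) b) by rewrite -Eb; vec; field; lra.
    apply: dom_scal => //; apply: dom_minus => //; exact: res_dom hJ _. }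
  have dw : dom A (plus b (scal lam (A b))) by apply: dom_plus => //; apply: dom_scal.
  have Ew : K x = plus b (scal lam (A b)).
  { apply: (res_unique hm hK) => //.
    have := resE hJ x; rewrite -Eb => <-.
    rewrite !op_plus ?op_scalE //; try by apply: dom_scal.
    vec. }
  by apply: (res_unique hl hJ).
Qed.

Lemma yosida_commute lam mu J K x : 0 < lam -> 0 < mu -> resolvent lam J -> resolvent mu K ->
  yosida lam J (yosida mu K x) = yosida mu K (yosida lam J x).
Proof.
  move=> hl hm hJ hK; have lJ := res_linear hl hJ; have lK := res_linear hm hK.
  rewrite /yosida !(linear_scal _ lJ, linear_scal _ lK, linear_minus _ _ _ lJ, linear_minus _ _ _ lK).
  rewrite (res_commute x hl hm hJ hK); vec.
Qed.

Definition yosida_step n := / (INR n + 1).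

Lemma sa_semigroup_data : exists (Y : nat -> H -> H) (Phi : nat -> R -> H -> H),
  (forall n, is_linear (Y n) /\ symmetric (Y n) /\ positive (Y n)) /\
  (forall n m x, Y n (Y m x) = Y m (Y n x)) /\
  (forall x, dom A x -> tends (fun n => Y n x) (A x)) /\
  (forall n x, dom A x -> norm (Y n x) <= norm (A x)) /\
  (forall n x, Phi n 0 x = x /\ flows (Y n) (fun t => Phi n t x)).
Proof.
  have [J hJ] : exists J : nat -> H -> H, forall n, resolvent (yosida_step n) (J n).
  { apply: (@choose _ _ (fun n J => resolvent (yosida_step n) J)) => n; apply: resolvent_exists; exact: inv_succ_pos. }
  have hl n : 0 < yosida_step n by exact: inv_succ_pos.
  pose Y n := yosida (yosida_step n) (J n).
  have linY n : is_linear (Y n) := yosida_linear (hl n) (hJ n).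
  have [Psi hPsi] : exists Psi : nat * H -> R -> H, forall p, Psi p 0 = snd p /\ flows (Y (fst p)) (Psi p).
  { apply: (@choose _ _ (fun (p : nat * H) (y : R -> H) => y 0 = snd p /\ flows (Y (fst p)) y)) => [[n x]].
    exact: flow_exists. }
  exists Y, (fun n t x => Psi (n, x) t); split; [ | split; [ | split; [ | split]]].
  - move=> n; split; first exact: linY. split.
    + exact: yosida_symmetric.
    + exact: yosida_positive.
  - by move=> n m x; apply: yosida_commute.
  (* On the domain [Y n x = J n (A x)], so the claim is that [J n] tends strongly to 1: this holds
     at rate [yosida_step n] on the domain, and elsewhere by density and contraction. *)
  - move=> x hx e he.
    have [y [hy hxy]] := sa_dense sa (A x) (r := e / 3) ltac:(lra).
    have [N hN] := @inv_succ_small (e / 3 / (norm (A y) + 1))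
      ltac:(apply: Rdiv_lt_0_compat; [lra | have := norm_nonneg (A y); lra]).
    exists N => n hn; rewrite /Y (yosida_dom (hl n) (hJ n)) //.
    have h1 := norm_minus_trans (J n y) (J n (A x)) (A x).
    have h2 := norm_minus_trans y (J n y) (A x).
    have h3 : norm (minus (J n (A x)) (J n y)) <= norm (minus (A x) y).
    { rewrite -(linear_minus _ _ _ (res_linear (hl n) (hJ n))); exact: res_norm. }
    have h4 := res_approx (hl n) (hJ n) hy.
    have h5 : yosida_step n * norm (A y) < e / 3.
    { have nA := norm_nonneg (A y).
      apply: (Rle_lt_trans _ (yosida_step n * (norm (A y) + 1))); first by have := hl n; nra.
      apply: (Rmult_lt_reg_r (/ (norm (A y) + 1))); first by apply: Rinv_0_lt_compat; lra.
      rewrite Rmult_assoc Rinv_r ?Rmult_1_r; last lra. exact: hN. }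
    rewrite (norm_minus_sym y (J n y)) in h4 h2 |- *.
    rewrite (norm_minus_sym y (A x)) in h2; lra.
  - move=> n x hx; rewrite /Y (yosida_dom (hl n) (hJ n)) //; exact: res_norm.
  - move=> n x; exact: (hPsi (n, x)).
Qed.

(* The flows of the commuting Yosida approximations [Y n] form a Cauchy sequence by [flow_compare]. *)
Theorem sa_generates : exists S, generated_by_opp A S.
Proof.
  have [Y [Phi [hY [cY [tY [bY hP]]]]]] := sa_semigroup_data.
  have linY n := proj1 (hY n). have symY n := proj1 (proj2 (hY n)). have posY n := proj2 (proj2 (hY n)).
  have P0 n x : Phi n 0 x = x := proj1 (hP n x).
  have Pf n x : flows (Y n) (fun t => Phi n t x) := proj2 (hP n x).
  have uniq n (y : R -> H) x t : flows (Y n) y -> y 0 = x -> 0 <= t -> y t = Phi n t x.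
  { move=> hy hx ht; apply: (@flow_unique _ (Y n) y (fun t => Phi n t x)) => //; by rewrite P0. }
  have contr n t x : 0 <= t -> norm (Phi n t x) <= norm x.
  { move=> ht; have := flow_contraction (posY n) (Pf n x) ht; by rewrite P0. }
  have plusP n t x y : 0 <= t -> Phi n t (plus x y) = plus (Phi n t x) (Phi n t y).
  { move=> ht; symmetry; apply: (uniq n (fun t => plus (Phi n t x) (Phi n t y))) => //.
    - by apply: flow_plus.
    - by rewrite !P0. }
  have scalP n t (a : R) x : 0 <= t -> Phi n t (scal a x) = scal a (Phi n t x).
  { move=> ht; symmetry; apply: (uniq n (fun t => scal a (Phi n t x))) => //.
    - apply: (flow_comm (C := fun x => scal a x)) => //.
      + apply: is_linear_scal_r; exact: Rmult_comm.
      + by move=> v; rewrite (linear_scal _ (linY n)).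
    - by rewrite P0. }
  have minusP n t x y : 0 <= t -> Phi n t (minus x y) = minus (Phi n t x) (Phi n t y).
  { move=> ht; rewrite minusE plusP // scalP //; by rewrite -minusE. }
  have lawP n s t x : 0 <= s -> 0 <= t -> Phi n (s + t) x = Phi n s (Phi n t x).
  { move=> hs ht; apply: (uniq n (fun s => Phi n (s + t) x)) => //.
    - exact: (flow_shift t (Pf n x)).
    - by rewrite Rplus_0_l. }
  have cmp n m t x : 0 <= t -> norm (minus (Phi n t x) (Phi m t x)) <= t * norm (minus (Y n x) (Y m x)).
  { move=> ht; have := flow_compare (linY n) (linY m) (posY n) (posY m) (cY n m) (Pf n x) (Pf m x).
    by rewrite !P0; apply. }
  have conv t x : 0 <= t -> exists y, tends (fun n => Phi n t x) y.
  { move=> ht; apply: tends_cauchy => e he.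
    have [y [hy hxy]] := sa_dense sa x (r := e / 3) ltac:(lra).
    have [N hN] := tY y hy (e / 6 / (t + 1)) ltac:(apply: Rdiv_lt_0_compat; lra).
    exists N => n m hn hm.
    have h1 := norm_minus_trans (Phi n t y) (Phi n t x) (Phi m t x).
    have h2 := norm_minus_trans (Phi m t y) (Phi n t y) (Phi m t x).
    have h3 : norm (minus (Phi n t x) (Phi n t y)) < e / 3.
    { rewrite -minusP //; apply: Rle_lt_trans hxy; exact: contr. }
    have h4 : norm (minus (Phi m t y) (Phi m t x)) < e / 3.
    { rewrite norm_minus_sym -minusP //; apply: Rle_lt_trans hxy; exact: contr. }
    have h5 := cmp n m t y ht.
    have h6 := norm_minus_trans (A y) (Y n y) (Y m y).
    have h7 := hN n hn; have := hN m hm; rewrite norm_minus_sym => h8.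
    have h9 : t * norm (minus (Y n y) (Y m y)) <= e / 3.
    { have -> : e / 3 = (t + 1) * (2 * (e / 6 / (t + 1))) by field; lra.
      apply: Rmult_le_compat => //; try lra. exact: norm_nonneg. }
    lra. }
  have [SS hSS] : exists SS : R * H -> H, forall p, 0 <= fst p -> tends (fun n => Phi n (fst p) (snd p)) (SS p).
  { apply: (@choose _ _ (fun (p : R * H) (y : H) => 0 <= fst p -> tends (fun n => Phi n (fst p) (snd p)) y)) => [[t x]] /=.
    case: (Rle_dec 0 t) => ht; last by exists zero.
    by have [y hy] := conv t x ht; exists y. }
  pose S t x := SS (t, x).
  have hS t x : 0 <= t -> tends (fun n => Phi n t x) (S t x) := hSS (t, x).
  have contrS t x : 0 <= t -> norm (S t x) <= norm x.
  { move=> ht; apply: (tends_norm_le (hS t x ht)); exists 0%nat => n _; exact: contr. }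
  have plusS t x y : 0 <= t -> S t (plus x y) = plus (S t x) (S t y).
  { move=> ht; apply: (tends_unique (hS t _ ht)).
    apply: (@tends_ext _ (fun n => plus (Phi n t x) (Phi n t y))); first by move=> n; rewrite plusP.
    by apply: tends_plus; apply: hS. }
  have scalS t (a : R) x : 0 <= t -> S t (scal a x) = scal a (S t x).
  { move=> ht; apply: (tends_unique (hS t _ ht)).
    apply: (@tends_ext _ (fun n => scal a (Phi n t x))); first by move=> n; rewrite scalP.
    by apply: tends_scal; apply: hS. }
  have minusS t x y : 0 <= t -> S t (minus x y) = minus (S t x) (S t y).
  { move=> ht; rewrite minusE plusS // scalS //; by rewrite -minusE. }
  have smallP n t x : 0 <= t -> dom A x -> norm (minus (Phi n t x) x) <= t * norm (A x).
  { move=> ht hx; have := flow_displacement (linY n) (posY n) (Pf n x) ht; rewrite P0 => h.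
    apply: Rle_trans h _; apply: Rmult_le_compat_l => //; exact: bY. }
  have smallS t x : 0 <= t -> dom A x -> norm (minus (S t x) x) <= t * norm (A x).
  { move=> ht hx; apply: (tends_bound (hS t x ht)); exists 0%nat => n _.
    exact: smallP. }
  have contS x e : 0 < e -> exists d, 0 < d /\ forall t, 0 <= t < d -> norm (minus (S t x) x) < e.
  { move=> he; have [y [hy hxy]] := sa_dense sa x (r := e / 3) ltac:(lra).
    have nA := norm_nonneg (A y).
    exists (e / 3 / (norm (A y) + 1)); split; first by apply: Rdiv_lt_0_compat; lra.
    move=> t ht.
    have h1 := norm_minus_trans (S t y) (S t x) x.
    have h2 := norm_minus_trans y (S t y) x; rewrite (norm_minus_sym y x) in h2.
    have h3 : norm (minus (S t x) (S t y)) < e / 3.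
    { rewrite -minusS; last lra. apply: Rle_lt_trans hxy; apply: contrS; lra. }
    have h4 := smallS t y (proj1 ht) hy.
    have h5 : t * norm (A y) <= e / 3.
    { have -> : e / 3 = (e / 3 / (norm (A y) + 1)) * (norm (A y) + 1) by field; lra.
      apply: Rmult_le_compat; lra. }
    lra. }
  have genS x : dom A x ->
    filterlim (fun t : R => scal (/ t) (minus x (S t x))) (at_right 0) (locally (A x)).
  {move=> hx; apply/filterlim_normP => e he.
    have [y' [hy' hxy]] := sa_dense sa (A x) (r := e / 8) ltac:(lra).
    have nA := norm_nonneg (A y').
    have hd : 0 < e / 8 / (norm (A y') + 1) by apply: Rdiv_lt_0_compat; lra.
    exists (mkposreal _ hd) => t /= ht ht0.
    have ht1 : t < e / 8 / (norm (A y') + 1).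
    { have : Rabs (t - 0) < e / 8 / (norm (A y') + 1) := ht; rewrite Rminus_0_r Rabs_pos_eq; lra. }
    set z := minus (S t x) (minus x (scal t (A x))).
    have -> : minus (scal (/ t) (minus x (S t x))) (A x) = scal (- / t) z by rewrite /z; vec; field; lra.
    rewrite norm_scalR Rabs_Ropp Rabs_pos_eq; last by left; apply: Rinv_0_lt_compat.
    have key : norm z <= (e / 2) * t.
    { apply: (tends_bound (hS t x (Rlt_le _ _ ht0))).
      have [N hN] := tY x hx (e / 24) ltac:(lra).
      exists N => n hn; have h0 := hN n hn; rewrite norm_minus_sym in h0.
      (* In units of [e / 24], [|A x - Y n x|] costs 1, [|A x - y'|] costs 3, the displacement of
         [y'] costs 3 and the image of [y' - Y n x] costs 4, in all 11; replacing [Y n x] by [A x]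
         at the end adds 1, for a total of [e / 2]. *)
      have h := @energy_global _ (fun s => minus (Phi n s x) (minus x (scal s (Y n x))))
        (fun s => minus (opp (Y n (Phi n s x))) (opp (Y n x))) (11 * (e / 24)) t (Rlt_le _ _ ht0) ltac:(lra).
      have : norm (minus (Phi n t x) (minus x (scal t (Y n x))))
           <= norm (minus (Phi n 0 x) (minus x (scal 0 (Y n x)))) + 11 * (e / 24) * t.
      { apply: h.
        - move=> s; apply: derive_minus; first exact: Pf.
          have -> : opp (Y n x) = minus zero (scal 1 (Y n x)) by vec.
          apply: derive_minus; first exact: is_derive_const.
          apply: is_derive_scal_l; exact: is_derive_id.
        - move=> s hs; apply: Rle_trans (inner_le _ _) _.
          apply: Rmult_le_compat_r; first exact: norm_nonneg.
          have hs0 : 0 <= s by lra.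
          have -> : Y n (Phi n s x) = Phi n s (Y n x).
          { apply: (uniq n (fun s => Y n (Phi n s x))) => //.
            - by apply: flow_comm.
            - by rewrite P0. }
          have -> : minus (opp (Phi n s (Y n x))) (opp (Y n x)) = minus (Y n x) (Phi n s (Y n x)) by vec.
          have k1 := norm_minus_trans (A x) (Y n x) (Phi n s (Y n x)).
          have k2 := norm_minus_trans y' (A x) (Phi n s (Y n x)).
          have k3 := norm_minus_trans (Phi n s y') y' (Phi n s (Y n x)).
          have k4 := contr n s (minus y' (Y n x)) hs0; rewrite minusP // in k4.
          have k5 := norm_minus_trans (A x) y' (Y n x).
          rewrite (norm_minus_sym y' (A x)) in k5.
          have k6 := smallP n s y' hs0 hy'.
          have k7 : s * norm (A y') <= e / 8.
          { have -> : e / 8 = (e / 8 / (norm (A y') + 1)) * (norm (A y') + 1) by field; lra.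
            apply: Rmult_le_compat; lra. }
          rewrite (norm_minus_sym y' (Phi n s y')) in k3.
          rewrite (norm_minus_sym (Y n x) (A x)) in k1.
          lra. }
      rewrite P0.
      have -> : minus x (minus x (scal 0 (Y n x))) = zero by vec.
      rewrite norm_zeroR Rplus_0_l => h1.
      have h2 := norm_minus_trans (minus x (scal t (Y n x))) (Phi n t x) (minus x (scal t (A x))).
      have h3 : norm (minus (minus x (scal t (Y n x))) (minus x (scal t (A x)))) <= t * (e / 24).
      { have -> : minus (minus x (scal t (Y n x))) (minus x (scal t (A x)))
          = scal t (minus (A x) (Y n x)) by vec.
        rewrite norm_scalR Rabs_pos_eq; last lra. apply: Rmult_le_compat_l; lra. }
      nra. }
    apply: (Rmult_lt_reg_l t) => //.
    rewrite -Rmult_assoc Rinv_r ?Rmult_1_l; last lra. nra. }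
  exists S; split; [split; [ | split; [ | split]] | ].
  - move=> t ht; split; first by move=> x y; apply: plusS.
    split; first by move=> a x; apply: scalS.
    exists 1 => x; rewrite Rmult_1_l; exact: contrS.
  - move=> x; apply: (tends_unique (hS 0 x (Rle_refl 0))).
    apply: (@tends_ext _ (fun _ => x)); first by move=> n; rewrite P0.
    exact: tends_const.
  - move=> s t x hs ht; apply: (tends_unique (hS (s + t) x ltac:(lra))).
    move=> e he; have [N1 h1] := hS s (S t x) hs (e / 2) ltac:(lra).
    have [N2 h2] := hS t x ht (e / 2) ltac:(lra).
    exists (Nat.max N1 N2) => n hn; rewrite lawP //.
    have k1 := h1 n ltac:(lia); have k2 := h2 n ltac:(lia).
    have k3 := norm_minus_trans (Phi n s (S t x)) (Phi n s (Phi n t x)) (S s (S t x)).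
    have k4 := contr n s (minus (Phi n t x) (S t x)) hs; rewrite minusP // in k4; lra.
  - move=> x; apply/filterlim_normP => e he; have [d [hd h]] := contS x e he.
    exists (mkposreal d hd) => t /= ht ht0; apply: h.
    have : Rabs (t - 0) < d := ht; rewrite Rminus_0_r Rabs_pos_eq; lra.
  - move=> x y; split; first by move=> [hx <-]; apply: genS.
    (* The generator extends [A] and inherits symmetry from each [S t], and a self-adjoint operator
       has no proper symmetric extension. Concretely, [<A v, x> = <v, y>] follows by passing to the
       limit in the difference quotients on both sides. *)
    move=> hlim; apply: sa_adjoint => // v hv.
    have symS t : 0 <= t -> inner (S t v) x = inner v (S t x).
    { move=> ht; have h1 := tends_inner (y := x) (hS t v ht).
      have h2 := tends_inner (y := v) (hS t x ht).
      have h3 : is_lim_seq (fun n => inner (Phi n t x) v) (inner (S t v) x).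
      { apply: is_lim_seq_ext h1 => n.
        have := flow_symmetric (linY n) (symY n) (Pf n v) (Pf n x) ht; rewrite !P0 => ->.
        exact: inner_sym. }
      have := is_lim_seq_unique _ _ h2; rewrite (is_lim_seq_unique _ _ h3).
      by case=> ->; rewrite inner_sym. }
    apply: cond_eq => e he.
    have hv' := proj1 (filterlim_normP _ _) (genS v hv) (e / 2 / (norm x + 1))
      ltac:(apply: Rdiv_lt_0_compat; [lra | have := norm_nonneg x; lra]).
    have hx' := proj1 (filterlim_normP _ _) hlim (e / 2 / (norm v + 1))
      ltac:(apply: Rdiv_lt_0_compat; [lra | have := norm_nonneg v; lra]).
    have hp : at_right 0 (fun t => 0 < t) by exists (mkposreal 1 Rlt_0_1).
    have [t [[ht1 ht2] ht0]] := filter_ex _ (filter_and _ _ (filter_and _ _ hv' hx') hp).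
    have E : inner (A v) x - inner v y
      = inner (minus (A v) (scal (/ t) (minus v (S t v)))) x
        + inner v (minus (scal (/ t) (minus x (S t x))) y).
    { rewrite !innerE symS; [ring | lra]. }
    rewrite E; apply: Rle_lt_trans (Rabs_triang _ _) _.
    have c1 := cauchy_schwarz (minus (A v) (scal (/ t) (minus v (S t v)))) x.
    have c2 := cauchy_schwarz v (minus (scal (/ t) (minus x (S t x))) y).
    rewrite norm_minus_sym in c1.
    have nx := norm_nonneg x; have nv := norm_nonneg v.
    have b1 : norm (minus (scal (/ t) (minus v (S t v))) (A v)) * norm x <= e / 2 / (norm x + 1) * norm x
      by apply: Rmult_le_compat_r => //; left.
    have b2 : norm v * norm (minus (scal (/ t) (minus x (S t x))) y) <= norm v * (e / 2 / (norm v + 1))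
      by apply: Rmult_le_compat_l => //; left.
    have b3 : e / 2 / (norm x + 1) * norm x < e / 2.
    { have {2}-> : e / 2 = e / 2 / (norm x + 1) * (norm x + 1) by field; lra.
      apply: Rmult_lt_compat_l; [apply: Rdiv_lt_0_compat | ]; lra. }
    have b4 : norm v * (e / 2 / (norm v + 1)) < e / 2.
    { have {2}-> : e / 2 = (norm v + 1) * (e / 2 / (norm v + 1)) by field; lra.
      apply: Rmult_lt_compat_r; [apply: Rdiv_lt_0_compat | ]; lra. }
    have := Rle_trans _ _ _ c1 b1; have := Rle_trans _ _ _ c2 b2; lra.
Qed.

End Yosida.

(** * Properties of a semigroup with given generator *)

Section UniformBoundedness.
Context {H : Hilbert}.
Implicit Types x y z : H.

(** A unit vector at which [L] reaches two thirds of its norm; the length of its image then replaces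
    the operator norm, at the price of the factor [3 / 2]. *)
Lemma almost_norming (L : H -> H) x0 : is_linear L -> 0 < norm (L x0) ->
  exists d, norm d = 1 /\ forall z, norm (L z) <= 3 / 2 * norm (L d) * norm z.
Proof.
  move=> hL h0; have [N [_ [le sup]]] := restricted_norm (V := fun _ => True) hL I (fun _ _ h => h).
  have nz x : 0 < norm (L x) -> x <> zero.
  { move=> h E0; have := le x I; rewrite E0 norm_zeroR -{1}E0; lra. }
  have N0 : 0 < N by have := le x0 I; have [h _] := unit_scal (nz _ h0); nra.
  have [x [_ [hx1 hx2]]] := sup (2 / 3 * N) ltac:(lra).
  have [hx0 hu] := unit_scal (nz x ltac:(lra)).
  exists (scal (/ norm x) x); split=> // z; apply: Rle_trans (le z I) _.
  apply: Rmult_le_compat_r; first exact: norm_nonneg.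
  rewrite lin_scal // norm_scalR Rabs_pos_eq; last by left; apply: Rinv_0_lt_compat.
  have : 1 <= / norm x by rewrite -Rinv_1; apply: Rinv_le_contravar.
  nra.
Qed.

(** [2 r L d] is the difference of the values of [L] at [x + r d] and [x - r d], so at one of these
    two points the image has length at least [r |L d|]. *)
Lemma gliding_step (L : H -> H) x d (r : R) : is_linear L -> norm d = 1 -> 0 <= r ->
  exists x', norm (minus x' x) <= r /\ norm (L d) * r <= norm (L x').
Proof.
  move=> hL hd hr.
  have E : norm (L d) * r = norm (scal r (L d)) by rewrite norm_scalR Rabs_pos_eq //; ring.
  have h2 : 2 * norm (scal r (L d)) <= norm (L (plus x (scal r d))) + norm (L (minus x (scal r d))).
  { have -> : 2 * norm (scal r (L d)) = norm (scal 2 (scal r (L d))) by rewrite (norm_scalR 2) Rabs_pos_eq; lra.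
    have -> : scal 2 (scal r (L d)) = minus (L (plus x (scal r d))) (L (minus x (scal r d))).
    { rewrite (linear_minus _ _ _ hL) (linear_plus _ hL) (linear_scal _ hL); vec. }
    exact: norm_triangle_minus. }
  have hrd : norm (scal r d) = r by rewrite norm_scalR hd Rabs_pos_eq //; ring.
  case: (Rle_dec (norm (L d) * r) (norm (L (plus x (scal r d))))) => h.
  - exists (plus x (scal r d)); split=> //.
    have -> : minus (plus x (scal r d)) x = scal r d by vec.
    lra.
  - exists (minus x (scal r d)); split; last by lra.
    have -> : minus (minus x (scal r d)) x = opp (scal r d) by vec.
    rewrite norm_opp; lra.
Qed.

(* Gliding hump (Sokal): no appeal to the Baire category theorem. *)
Theorem uniform_boundedness (T : nat -> H -> H) : (forall n, is_linear (T n)) ->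
  (forall x, exists C, forall n, norm (T n x) <= C) ->
  exists M, forall n x, norm (T n x) <= M * norm x.
Proof.
  move=> lin bnd; apply: NNPP => hn.
  have big M : exists n x, M * norm x < norm (T n x).
  { apply: NNPP => h; apply: hn; exists M => n x; apply: Rnot_lt_le => hl; apply: h; by exists n, x. }
  (* Moves of length [3^-k] against norms at least [6^k]: the moves are summable, while the product
     grows like [2^k]. *)
  have step (p : nat * H) : exists q : H * nat,
      norm (minus (fst q) (snd p)) <= (1 / 3) ^ fst p /\
      exists m, 6 ^ fst p <= m /\ m * (1 / 3) ^ fst p <= norm (T (snd q) (fst q)) /\
        forall z, norm (T (snd q) z) <= 3 / 2 * m * norm z.
  { case: p => k x /=; have hk : 0 <= (1 / 3) ^ k by apply: pow_le; lra.
    have h6 : 0 <= 6 ^ k by apply: pow_le; lra.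
    have [n [v hv]] := big (3 / 2 * 6 ^ k).
    have nv := norm_nonneg v.
    have hT : 0 < norm (T n v).
    { apply: Rle_lt_trans hv; apply: Rmult_le_pos => //; lra. }
    have [d [hd1 hd2]] := almost_norming (lin n) hT.
    have [x' [h1 h2]] := gliding_step x (lin n) hd1 hk.
    exists (x', n); split=> //; exists (norm (T n d)); split; last by split.
    have := hd2 v => h3; apply: Rnot_lt_le => h4.
    have : 3 / 2 * norm (T n d) * norm v <= 3 / 2 * 6 ^ k * norm v.
    { apply: Rmult_le_compat_r => //; lra. }
    lra. }
  have [F hF] := choose step.
  pose u := fix u k := match k with O => zero | S k => fst (F (k, u k)) end.
  have [|k|y hy] := @geometric_cauchy _ u 1 (1 / 3); first lra.
  { rewrite Rmult_1_l; exact: (proj1 (hF (k, u k))). }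
  have [C hC] := bnd y.
  (* All later moves together shift [u (S k)] by at most half of [3^-k], which costs [3 / 2] times
     [1 / 2], three quarters, of the image gained; the remaining quarter is at least [2^k / 4]. *)
  have key k : 2 ^ k <= 4 * C.
  { have [m [hm1 [hm2 hm3]]] := proj2 (hF (k, u k)); rewrite /= in hm1 hm2 hm3.
    set n := snd (F (k, u k)) in hm2 hm3.
    have h1 := hC n.
    have h2 := norm_le_minus (T n (u (S k))) (T n y).
    have h3 := hm3 (minus (u (S k)) y); rewrite (lin_minus _ _ (lin n)) in h3.
    have h4 := hy (S k); rewrite norm_minus_sym in h4.
    have hk : 0 < (1 / 3) ^ k by apply: pow_lt; lra.
    have h6 : 0 < 6 ^ k by apply: pow_lt; lra.
    have h5 : 3 / 2 * m * norm (minus (u (S k)) y) <= 3 / 2 * m * (1 / (1 - 1 / 3) * (1 / 3) ^ S k).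
    { apply: Rmult_le_compat_l; [lra | exact: h4]. }
    have E : 3 / 2 * m * (1 / (1 - 1 / 3) * (1 / 3) ^ S k) = 3 / 4 * (m * (1 / 3) ^ k) by rewrite /=; field.
    have E2 : 2 ^ k = 6 ^ k * (1 / 3) ^ k by rewrite -Rpow_mult_distr; congr (_ ^ _); field.
    have h7 : 6 ^ k * (1 / 3) ^ k <= m * (1 / 3) ^ k by apply: Rmult_le_compat_r; lra.
    change (fst (F (k, u k))) with (u (S k)) in hm2.
    rewrite E in h5; rewrite E2; lra. }
  have [N hN] := Pow_x_infinity 2 ltac:(rewrite Rabs_pos_eq; lra) (4 * C + 1).
  have := hN N (Nat.le_refl N); have := key N; rewrite Rabs_pos_eq; last by apply: pow_le; lra.
  lra.
Qed.

End UniformBoundedness.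

(* [S 0] may be a projection instead of the identity, so that this covers [exp (- t B) Q]. *)
Record decaying {H : Hilbert} (S : R -> H -> H) (a : R) : Prop := {
  decay_linear : forall t, 0 <= t -> is_linear (S t);
  decay_bound : forall t x, 0 <= t -> norm (S t x) <= exp (- a * t) * norm x;
  decay_semigroup : forall s t x, 0 <= s -> 0 <= t -> S (s + t) x = S s (S t x);
  decay_continuous : forall x t, continuous (fun s => S (Rmax 0 s) x) t
}.

Lemma Rmax0_lipschitz s t : Rabs (Rmax 0 s - Rmax 0 t) <= Rabs (s - t).
Proof.
  unfold Rmax; destruct (Rle_dec 0 s), (Rle_dec 0 t); unfold Rabs;
    repeat destruct Rcase_abs; lra.
Qed.

(** * Regularity and decay of an arbitrary semigroup generated by [-A] *)

Section Generated.
Context {H : Hilbert} (A : operator H) (S : R -> H -> H).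
Hypothesis sa : self_adjoint A.
Hypothesis gen : generated_by_opp A S.
Implicit Types x y z : H.

Lemma gen_linear t : 0 <= t -> is_linear (S t).
Proof.
  move=> ht; case: gen => [[h _] _]; have [h1 [h2 [C hC]]] := h t ht.
  split => //; exists (Rmax 1 C); split; first by apply: Rlt_le_trans (Rmax_l _ _); lra.
  move=> x; apply: Rle_trans (hC x) _; apply: Rmult_le_compat_r; [exact: norm_nonneg | exact: Rmax_r].
Qed.

Lemma gen_zero x : S 0 x = x.
Proof. by case: gen => [[_ [h _]] _]. Qed.

Lemma gen_semigroup s t x : 0 <= s -> 0 <= t -> S (s + t) x = S s (S t x).
Proof. case: gen => [[_ [_ [h _]]] _]; exact: h. Qed.

Lemma gen_right x e : 0 < e -> exists d, 0 < d /\ forall t, 0 <= t < d -> norm (minus (S t x) x) < e.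
Proof.
  move=> he; case: gen => [[_ [_ [_ h]]] _].
  have [d hd] := proj1 (filterlim_normP _ _) (h x) e he.
  exists d; split; first exact: cond_pos.
  move=> t ht; case: (Req_dec t 0) => [-> | n0].
  - by rewrite gen_zero minus_eq_zero norm_zeroR.
  - apply: hd; last lra. have : Rabs (t - 0) < d by rewrite Rminus_0_r Rabs_pos_eq; lra.
    by [].
Qed.

(* [C0_semigroup] bounds each [S t] separately; left continuity of the orbits needs a locally uniform bound. *)
Lemma gen_bounded_near0 : exists tau M, 0 < tau /\ 1 <= M /\
  forall t x, 0 <= t <= tau -> norm (S t x) <= M * norm x.
Proof.
  apply: NNPP => hn.
  (* Without a bound near 0, some [S (t n)] with [t n <= 1 / (n + 1)] has norm above [n + 1]; yet
     right continuity at 0 bounds every orbit along [t n], against uniform boundedness. *)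
  have bad n : exists t, 0 <= t <= / (INR n + 1) /\ exists x, (INR n + 1) * norm x < norm (S t x).
  { apply: NNPP => h; apply: hn; exists (/ (INR n + 1)), (INR n + 1).
    split; first exact: inv_succ_pos. split; first by have := pos_INR n; lra.
    move=> t x ht; apply: Rnot_lt_le => hl; apply: h; exists t; split=> //; by exists x. }
  have [t ht] := choose bad.
  have [|x|M hM] := @uniform_boundedness H (fun n => S (t n)).
  - move=> n; apply: gen_linear; exact: (proj1 (proj1 (ht n))).
  - have [d [hd h]] := gen_right x Rlt_0_1.
    have [N hN] := inv_succ_small hd.
    have fin k : exists C, forall n, (n < k)%nat -> norm (S (t n) x) <= C.
    { elim: k => [|k [C hC]]; first by exists 0 => n; lia.
      exists (Rmax C (norm (S (t k) x))) => n hn'; case: (Nat.eq_dec n k) => [-> | nk].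
      - exact: Rmax_r.
      - apply: Rle_trans (Rmax_l _ _); apply: hC; lia. }
    have [C hC] := fin N; exists (Rmax C (norm x + 1)) => n.
    case: (Compare_dec.le_lt_dec N n) => hnN; last by apply: Rle_trans (Rmax_l _ _); apply: hC.
    apply: Rle_trans (Rmax_r _ _); have := norm_le_minus (S (t n) x) x.
    have : norm (minus (S (t n) x) x) < 1.
    { apply: h; have := hN n hnN; have := proj1 (ht n); lra. }
    lra.
  - have [n hn'] := INR_unbounded M; have [x hx] := proj2 (ht n).
    have := hM n x; have := Rmult_le_compat_r (norm x) M (INR n + 1) (norm_nonneg x) ltac:(lra); lra.
Qed.

Lemma gen_bounded T : exists M, 0 < M /\ forall t x, 0 <= t <= T -> norm (S t x) <= M * norm x.
Proof.
  have [tau [M [htau [hM h]]]] := gen_bounded_near0.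
  have key k : exists M', 0 < M' /\ forall t x, 0 <= t <= INR k * tau -> norm (S t x) <= M' * norm x.
  { elim: k => [|k [M' [hM' IH]]].
    - exists 1; split; first lra. move=> t x; rewrite /= Rmult_0_l => ht; have -> : t = 0 by lra.
      rewrite gen_zero; lra.
    - exists (M * M' + M); split; first by nra. rewrite S_INR => t x ht.
      have nx := norm_nonneg x.
      case: (Rle_dec t tau) => h1.
      + have := h t x ltac:(lra).
        have := Rmult_le_pos _ _ (Rmult_le_pos M M' ltac:(lra) ltac:(lra)) nx; lra.
      + have -> : t = tau + (t - tau) by ring.
        rewrite gen_semigroup; try lra.
        apply: Rle_trans (h tau (S (t - tau) x) ltac:(lra)) _.
        have h3 := IH (t - tau) x ltac:(lra).
        apply: Rle_trans (Rmult_le_compat_l M _ _ ltac:(lra) h3) _; nra. }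
  have [k hk] := INR_unbounded (T / tau); have [M' [hM' h2]] := key k.
  exists M'; split=> // t x ht; apply: h2; split; first lra.
  apply: Rle_trans (proj2 ht) _; have -> : T = T / tau * tau by field; lra.
  apply: Rmult_le_compat_r; lra.
Qed.

Lemma gen_minus t x y : 0 <= t -> S t (minus x y) = minus (S t x) (S t y).
Proof. move=> ht; exact: (linear_minus _ _ _ (gen_linear ht)). Qed.

Lemma gen_close T M x e : (forall t y, 0 <= t <= T -> norm (S t y) <= M * norm y) -> 0 < M -> 0 < e ->
  exists d, 0 < d /\ forall s t, 0 <= s <= T -> 0 <= t <= T -> Rabs (s - t) < d ->
    norm (minus (S s x) (S t x)) < e.
Proof.
  move=> hb hM he; have [d [hd h]] := gen_right x (Rdiv_lt_0_compat _ _ he hM).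
  exists d; split=> //.
  have half s t : 0 <= s <= T -> 0 <= t <= T -> Rabs (s - t) < d -> s <= t -> norm (minus (S s x) (S t x)) < e.
  { move=> hs ht hst hle; have -> : t = s + (t - s) by ring.
    rewrite gen_semigroup -?gen_minus; try lra.
    apply: Rle_lt_trans (hb s _ hs) _.
    have -> : e = M * (e / M) by field; lra.
    apply: Rmult_lt_compat_l => //; rewrite norm_minus_sym; apply: h.
    move: hst; rewrite Rabs_left1; lra. }
  move=> s t hs ht hst; case: (Rle_dec s t) => hle; first exact: half.
  rewrite norm_minus_sym; apply: half => //; last lra. by rewrite Rabs_minus_sym.
Qed.

Lemma gen_continuous x t : continuous (fun s => S (Rmax 0 s) x) t.
Proof.
  apply/continuous_normP => e he.
  have [M [hM hb]] := gen_bounded (Rmax 0 t + 1).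
  have [d [hd h]] := gen_close x hb hM he.
  exists (Rmin d 1); split; first by apply: Rmin_glb_lt => //; lra.
  move=> s hs; have hl := Rmax0_lipschitz s t.
  have h1 : Rabs (s - t) < d := Rlt_le_trans _ _ _ hs (Rmin_l _ _).
  have h2 : Rabs (s - t) < 1 := Rlt_le_trans _ _ _ hs (Rmin_r _ _).
  have a := Rmax_l 0 s; have b := Rmax_l 0 t; have c := Rle_abs (Rmax 0 s - Rmax 0 t).
  apply: h; lra.
Qed.

(** [S t] commutes with the difference quotients at 0 and is continuous, so it carries their limit
    [A x] to the limit of the quotients at [S t x]. *)
Lemma gen_dom t x : 0 <= t -> dom A x -> dom A (S t x) /\ A (S t x) = S t (A x).
Proof.
  move=> ht hx; apply: (proj2 (proj2 gen _ _)).
  have := proj1 (proj2 gen x (A x)) (conj hx eq_refl) => h.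
  have lin := gen_linear ht.
  apply: (filterlim_ext_loc (fun s => S t (scal (/ s) (minus x (S s x))))).
  - exists (mkposreal 1 Rlt_0_1) => s _ hs.
    rewrite (linear_scal _ lin) gen_minus // -!gen_semigroup; try lra.
    by rewrite Rplus_comm.
  - apply: filterlim_comp h _; exact: (linear_cont (S t) (A x) lin).
Qed.

Lemma gen_quotient x e : dom A x -> 0 < e ->
  exists d, 0 < d /\ forall h, 0 < h < d -> norm (minus (minus x (S h x)) (scal h (A x))) <= e * h.
Proof.
  move=> hx he; have lim := proj1 (proj2 gen x (A x)) (conj hx eq_refl).
  have [d hd] := proj1 (filterlim_normP _ _) lim e he.
  exists d; split; first exact: cond_pos.
  move=> h hh.
  have k : norm (minus (scal (/ h) (minus x (S h x))) (A x)) < e.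
  { apply: hd; last lra. have : Rabs (h - 0) < d by rewrite Rminus_0_r Rabs_pos_eq; lra.
    by []. }
  have -> : minus (minus x (S h x)) (scal h (A x)) = scal h (minus (scal (/ h) (minus x (S h x))) (A x))
    by vec; field; lra.
  rewrite norm_scalR Rabs_pos_eq; nra.
Qed.

(** The generator only gives a right derivative at 0. For [s < t] the increment is [S s] applied to
    a right increment over [t - s], which produces [S s (A x)] in place of [S t (A x)]; strong
    continuity absorbs the change. *)
Lemma gen_derive x t : dom A x -> 0 < t ->
  is_derive (fun s => S (Rmax 0 s) x) t (opp (A (S t x))).
Proof.
  move=> hx ht; have ht0 : 0 <= t by lra.
  rewrite (proj2 (gen_dom ht0 hx)).
  apply/derive_normP => e he.
  have [M [hM hb]] := gen_bounded (t + 1).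
  have [d1 [hd1 k1]] := gen_quotient hx (e := e / 2 / M) ltac:(apply: Rdiv_lt_0_compat; lra).
  have [d2 [hd2 k2]] := gen_close (A x) hb hM (e := e / 2) ltac:(lra).
  exists (Rmin (Rmin d1 d2) (Rmin t 1)); split.
  { repeat apply: Rmin_glb_lt => //; lra. }
  move=> s hs.
  have l1 : Rabs (s - t) < d1 by apply: Rlt_le_trans hs (Rle_trans _ _ _ (Rmin_l _ _) (Rmin_l _ _)).
  have l2 : Rabs (s - t) < d2 by apply: Rlt_le_trans hs (Rle_trans _ _ _ (Rmin_l _ _) (Rmin_r _ _)).
  have l3 : Rabs (s - t) < t by apply: Rlt_le_trans hs (Rle_trans _ _ _ (Rmin_r _ _) (Rmin_l _ _)).
  have l4 : Rabs (s - t) < 1 by apply: Rlt_le_trans hs (Rle_trans _ _ _ (Rmin_r _ _) (Rmin_r _ _)).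
  have [a1 a2] := Rabs_def2 _ _ l3.
  have [a3 a4] := Rabs_def2 _ _ l4.
  have hM1 : M * (e / 2 / M) = e / 2 by field; lra.
  rewrite !Rmax_right; try lra.
  have piece r h : 0 <= r <= t + 1 -> 0 < h < d1 ->
    norm (S r (minus (minus x (S h x)) (scal h (A x)))) <= e / 2 * h.
  { move=> hr hh; apply: Rle_trans (hb r _ hr) _; rewrite -hM1 Rmult_assoc.
    apply: Rmult_le_compat_l; [lra | exact: k1]. }
  case: (Rtotal_order s t) => [hst | [-> | hst]].
  - rewrite Rabs_left in l1 *; try lra.
    have E : minus (minus (S s x) (S t x)) (scal (s - t) (opp (S t (A x))))
      = plus (S s (minus (minus x (S (t - s) x)) (scal (t - s) (A x))))
             (scal (t - s) (minus (S s (A x)) (S t (A x)))).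
    { rewrite !gen_minus ?(linear_scal _ (gen_linear (t := s) _)) -?gen_semigroup; try lra.
      have -> : s + (t - s) = t by ring. vec. }
    apply: Rle_trans (norm_split E) _.
    have p1 := piece s (t - s) ltac:(lra) ltac:(lra).
    have p2 := k2 s t ltac:(lra) ltac:(lra) l2.
    rewrite norm_scalR Rabs_pos_eq; last lra.
    have : (t - s) * norm (minus (S s (A x)) (S t (A x))) <= (t - s) * (e / 2) by apply: Rmult_le_compat_l; lra.
    lra.
  - have -> : minus (minus (S t x) (S t x)) (scal (t - t) (opp (S t (A x)))) = zero by vec.
    rewrite norm_zeroR; apply: Rmult_le_pos; [lra | exact: Rabs_pos].
  - rewrite Rabs_right in l1 *; try lra.
    have -> : minus (minus (S s x) (S t x)) (scal (s - t) (opp (S t (A x))))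
      = opp (S t (minus (minus x (S (s - t) x)) (scal (s - t) (A x)))).
    { rewrite !gen_minus ?(linear_scal _ (gen_linear ht0)) -?gen_semigroup; try lra.
      have -> : t + (s - t) = s by ring. vec. }
    rewrite norm_opp; apply: Rle_trans (piece t (s - t) ltac:(lra) ltac:(lra)) _.
    apply: Rmult_le_compat_r; lra.
Qed.

(** [exp (2 c s) |S s x|^2] is nonincreasing: with [z = S s x] its derivative is twice the weight
    times [c |z|^2 - <A z, z>]. *)
Lemma gen_decay_dom c t x : bounded_below_by c A -> 0 <= t -> dom A x ->
  norm (S t x) <= exp (- c * t) * norm x.
Proof.
  move=> hc ht hx.
  pose z s := S (Rmax 0 s) x.
  pose F s := exp (2 * c * s) * inner (z s) (z s).
  pose dF s := exp (2 * c * s) * (2 * c * inner (z s) (z s) - 2 * inner (A (z s)) (z s)).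
  have h : F t - F 0 <= 0 * (t - 0).
  { apply: (@mvt_le F dF) => //.
    - move=> s _; apply: (continuous_mult (fun s => exp (2 * c * s)) (fun s => inner (z s) (z s))).
      + apply: ex_derive_continuous; by auto_derive.
      + apply: (continuous_ext (fun s => norm (z s) ^ 2)); first by move=> r; rewrite inner_norm.
        apply: (continuous_comp (fun s => norm (z s)) (fun r => r ^ 2)).
        * apply: continuous_norm_fun; exact: gen_continuous.
        * apply: ex_derive_continuous; by auto_derive.
    - move=> s hs; have hz : z s = S s x by rewrite /z Rmax_right //; lra.
      have d := gen_derive hx (proj1 hs); rewrite -hz in d.
      have E : dF s = plus (mult (2 * c * exp (2 * c * s)) (inner (z s) (z s)))
         (mult (exp (2 * c * s)) (inner (opp (A (z s))) (z s) + inner (z s) (opp (A (z s))))).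
      { rewrite /dF /plus /mult /= inner_opp inner_opp_r (inner_sym (z s) (A _)); ring. }
      rewrite E; apply: (is_derive_mult (fun s => exp (2 * c * s)) (fun s => inner (z s) (z s))).
      + auto_derive => //; ring.
      + exact: derive_inner.
      + exact: Rmult_comm.
    - move=> s hs; have hz : z s = S s x by rewrite /z Rmax_right //; lra.
      have dz : dom A (z s) by rewrite hz; apply: (proj1 (gen_dom _ hx)); lra.
      have := hc _ dz; rewrite -inner_norm => hcz.
      have := exp_pos (2 * c * s); rewrite /dF; nra. }
  apply: norm_le_sq.
  - apply: Rmult_le_pos; [left; exact: exp_pos | exact: norm_nonneg].
  - move: h; rewrite /F /z Rmax_right // Rmax_left; last lra.
    rewrite gen_zero Rmult_0_r exp_0 Rmult_1_l (inner_norm x) => h.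
    have E : exp (- c * t) ^ 2 * exp (2 * c * t) = 1.
    { rewrite /= Rmult_1_r -!exp_plus -exp_0; congr exp; ring. }
    have e1 := exp_pos (- c * t); have e2 := exp_pos (2 * c * t).
    apply: (Rmult_le_reg_l (exp (2 * c * t))) => //.
    have -> : exp (2 * c * t) * (exp (- c * t) * norm x) ^ 2
      = (exp (- c * t) ^ 2 * exp (2 * c * t)) * norm x ^ 2 by ring.
    rewrite E; lra.
Qed.

Theorem gen_decaying c : bounded_below_by c A -> decaying S c.
Proof.
  move=> hc; split.
  - exact: gen_linear.
  - move=> t x ht; apply: le_epsilon => e he.
    have [M [hM hb]] := gen_bounded t.
    have ec := exp_pos (- c * t).
    have [y [hy hxy]] := sa_dense sa x (r := e / (M + exp (- c * t))) ltac:(apply: Rdiv_lt_0_compat; lra).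
    have h1 := norm_le_minus (S t x) (S t y).
    have h2 := hb t (minus x y) ltac:(lra); rewrite gen_minus // in h2.
    have h3 := gen_decay_dom hc ht hy.
    have h4 := norm_le_minus y x; rewrite (norm_minus_sym y x) in h4.
    have h5 : exp (- c * t) * norm y <= exp (- c * t) * (norm x + norm (minus x y))
      by apply: Rmult_le_compat_l; lra.
    have h6 : (M + exp (- c * t)) * norm (minus x y) <= (M + exp (- c * t)) * (e / (M + exp (- c * t)))
      by apply: Rmult_le_compat_l; lra.
    have E : (M + exp (- c * t)) * (e / (M + exp (- c * t))) = e by field; lra.
    lra.
  - exact: gen_semigroup.
  - exact: gen_continuous.
Qed.

(** The difference [w] to the expected curve satisfies [w' = - k w] and [w 0 = 0], so the energy
    estimate with [rho = 0] makes it vanish. Every semigroup with this generator is thereby known on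
    eigenvectors. *)
Lemma gen_eigen e k t : dom A e -> A e = scal k e -> 0 <= k -> 0 <= t -> S t e = scal (exp (- k * t)) e.
Proof.
  move=> he Ae hk ht; apply: minus_eq0.
  have := @energy_le _ (fun s => minus (S (Rmax 0 s) e) (scal (exp (- k * s)) e))
    (fun s => minus (opp (A (S s e))) (scal (- k * exp (- k * s)) e)) 0 t ht (Rle_refl 0).
  rewrite !Rmax_right //; last lra.
  rewrite gen_zero.
  have -> : minus e (scal (exp (- k * 0)) e) = zero by rewrite Rmult_0_r exp_0; vec.
  have dexp s : is_derive (fun s => scal (exp (- k * s)) e) s (scal (- k * exp (- k * s)) e).
  { apply: is_derive_scal_l; auto_derive => //; ring. }
  rewrite norm_zeroR => h.
  have := norm_nonneg (minus (S t e) (scal (exp (- k * t)) e)).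
  have : norm (minus (S t e) (scal (exp (- k * t)) e)) <= 0 + 0 * t; last lra.
  apply: h.
  - move=> s _; apply: continuous_minus; first exact: gen_continuous.
    apply: derive_continuous; exact: dexp.
  - move=> s hs; apply: derive_minus; last exact: dexp. apply: gen_derive => //; lra.
  - move=> s hs; rewrite Rmax_right; last lra.
    have hs0 : 0 <= s by lra.
    rewrite (proj2 (gen_dom hs0 he)) Ae (linear_scal _ (gen_linear hs0)).
    set w := minus (S s e) (scal (exp (- k * s)) e).
    have -> : minus (opp (scal k (S s e))) (scal (- k * exp (- k * s)) e) = scal (- k) w by rewrite /w; vec.
    rewrite inner_scal inner_norm; have := pow2_ge_0 (norm w); nra.
Qed.

End Generated.

Lemma semigroup_generated {H : Hilbert} (A : operator H) : self_adjoint A -> bounded_below_by 0 A ->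
  generated_by_opp A (semigroup A).
Proof.
  move=> sa pos; rewrite /semigroup; apply: epsilon_spec; exact: sa_generates.
Qed.

(** * Eigenbases of operators with compact resolvent *)

Section Orthonormal.
Context {H : Hilbert} (e : nat -> H).
Implicit Types x y z : H.

Definition partial (c : nat -> R) N : H := sum_n (fun k => scal (c k) (e k)) N.

Lemma inner_sum_n (a : nat -> H) N z : inner (sum_n a N) z = sum_n (fun k => inner (a k) z) N :> R.
Proof.
  elim: N => [|N IH]; first by rewrite !sum_O.
  by rewrite !sum_Sn inner_plus IH.
Qed.

Lemma sum_n_zero N : sum_n (fun _ => 0) N = 0 :> R.
Proof. elim: N => [|N IH]; [by rewrite sum_O | by rewrite sum_Sn IH /plus /= Rplus_0_r]. Qed.

Lemma sum_n_delta (c : nat -> R) j N :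
  sum_n (fun k => c k * (if Nat.eq_dec k j then 1 else 0)) N
    = (if Compare_dec.le_dec j N then c j else 0) :> R.
Proof.
  elim: N => [|N IH].
  - rewrite sum_O; case: Nat.eq_dec => h1; case: Compare_dec.le_dec => h2; try lia; subst; ring.
  - rewrite sum_Sn IH; change (@plus _) with Rplus.
    destruct (Nat.eq_dec (S N) j), (Compare_dec.le_dec j N), (Compare_dec.le_dec j (S N));
      try lia; subst; ring.
Qed.

Definition orthonormal := forall j k, inner (e j) (e k) = if Nat.eq_dec j k then 1 else 0.
Hypothesis orth : orthonormal.

Lemma orthonormal_norm k : norm (e k) = 1.
Proof.
  have h := orth k k; rewrite inner_norm in h; case: Nat.eq_dec h => // _ h.
  have := norm_nonneg (e k); nra.
Qed.

Lemma partial_coord c N j : inner (partial c N) (e j) = if Compare_dec.le_dec j N then c j else 0.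
Proof.
  rewrite /partial inner_sum_n -sum_n_delta; apply: sum_n_ext => k; by rewrite inner_scal orth.
Qed.

Definition coords x k := inner x (e k).

(** The remainder [r] is orthogonal to the partial sum, hence [|r|^2 = <r, x>]. *)
Lemma partial_le x N : norm (minus x (partial (coords x) N)) <= norm x.
Proof.
  set s := partial _ N; set r := minus x s.
  have rs : inner r s = 0.
  { rewrite inner_sym /s /partial inner_sum_n -(sum_n_zero N).
    apply: sum_n_ext_loc => k hk; rewrite inner_scal (inner_sym _ r) /r inner_minus partial_coord.
    case: Compare_dec.le_dec => // _; by rewrite /coords Rminus_diag Rmult_0_r. }
  have : inner r r <= norm r * norm x.
  { have -> : inner r r = inner r x by rewrite {2}/r inner_minus_r rs; ring.
    exact: inner_le. }
  rewrite inner_norm => h; have := norm_nonneg r.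
  case: (Req_dec (norm r) 0) => [-> _ | n0 n1]; first exact: norm_nonneg.
  apply: (Rmult_le_reg_l (norm r)); lra.
Qed.

Lemma partial_minus c d N : partial (fun k => c k - d k) N = minus (partial c N) (partial d N).
Proof.
  rewrite /partial; elim: N => [|N IH]; first by rewrite !sum_O; vec.
  rewrite !sum_Sn IH; vec.
Qed.

Lemma lin_partial (L : H -> H) (nu c : nat -> R) N : is_linear L -> (forall k, L (e k) = scal (nu k) (e k)) ->
  L (partial c N) = partial (fun k => nu k * c k) N.
Proof.
  move=> hL hnu; rewrite /partial; elim: N => [|N IH].
  - rewrite !sum_O lin_scal // hnu; vec.
  - rewrite !sum_Sn lin_plus // IH lin_scal // hnu; vec.
Qed.

(** Otherwise infinitely many images [nu k e k] have length at least [c]; being orthogonal, they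
    stay at distance at least [c] from each other, and no subsequence converges. *)
Lemma compact_eigenvalues_small (T : H -> H) (nu : nat -> R) c : compact_map T ->
  (forall k, T (e k) = scal (nu k) (e k)) -> 0 < c ->
  exists N, forall k, (N <= k)%nat -> Rabs (nu k) < c.
Proof.
  move=> cT hnu hc; apply: NNPP => hn.
  have bad N : exists k, (N <= k)%nat /\ c <= Rabs (nu k).
  { apply: NNPP => h; apply: hn; exists N => k hk; apply: Rnot_le_lt => hl; apply: h; by exists k. }
  have [j hj] := choose bad.
  pose s := fix s n := match n with O => j 0%nat | S n => j (S (s n)) end.
  have hs n : (s n < s (S n))%nat by have := proj1 (hj (S (s n))); rewrite /=; lia.
  have hcs n : c <= Rabs (nu (s n)) by case: n => [|n]; apply: (proj2 (hj _)).
  have mono n m : (n < m)%nat -> (s n < s m)%nat.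
  { elim: m => [|m IH] hnm; first lia. have := hs m.
    case: (Nat.eq_dec n m) => [-> // | nm]. have := IH ltac:(lia); lia. }
  have [k [y [hk lim]]] := cT (fun n => e (s n)) ltac:(exists 1 => n; rewrite orthonormal_norm; lra).
  have {}lim : tends (fun n => T (e (s (k n)))) y by apply/tends_filterlim.
  have [N hN] := lim (c / 2) ltac:(lra).
  have h1 := hN N (Nat.le_refl N); have h2 := hN (S N) (Nat.le_succ_diag_r N).
  have h3 := norm_minus_trans y (T (e (s (k N)))) (T (e (s (k (S N))))).
  rewrite (norm_minus_sym y) in h3.
  set a := s (k N) in h1 h3; set b := s (k (S N)) in h2 h3.
  have hab : a <> b by have := mono _ _ (hk N); rewrite -/a -/b; lia.
  have E : norm (minus (T (e a)) (T (e b))) ^ 2 = nu a ^ 2 + nu b ^ 2.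
  { rewrite -inner_norm !hnu !innerE !orth.
    repeat (case: Nat.eq_dec => ? //); try (subst; congruence); ring. }
  have ha : c ^ 2 <= nu a ^ 2 by rewrite -(pow2_abs (nu a)); apply: pow_incr; split; [lra | exact: hcs].
  have hb : 0 <= nu b ^ 2 by apply: pow2_ge_0.
  have : norm (minus (T (e a)) (T (e b))) ^ 2 < c ^ 2.
  { have := norm_nonneg (minus (T (e a)) (T (e b))).
    have : norm (minus (T (e a)) (T (e b))) < c by lra. nra. }
  lra.
Qed.

End Orthonormal.

(** * Spectral theorem for compact symmetric operators *)

Section HilbertSchmidt.
Context {H : Hilbert} (T : H -> H).
Hypothesis linT : is_linear T.
Hypothesis symT : symmetric T.
Hypothesis compT : compact_map T.
Implicit Types x y z : H.

Lemma subseq_ge (k : nat -> nat) n : (forall n, (k n < k (S n))%nat) -> (n <= k n)%nat.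
Proof. move=> hk; elim: n => [|n IH]; first lia. have := hk n; lia. Qed.

Lemma eigenvector_normalize (V : H -> Prop) nu x : (forall (a : R) x, V x -> V (scal a x)) ->
  V x -> x <> zero -> T x = scal nu x ->
  exists v, V v /\ norm v = 1 /\ T v = scal nu v.
Proof.
  move=> hs hx nx hT; exists (scal (/ norm x) x); split; first exact: hs.
  split; first exact: (proj2 (unit_scal nx)).
  rewrite lin_scal // hT; vec.
Qed.

(* On [V] the norm [m] of [T] is attained by some [z] with [T (T z) = m^2 z]: then [T z + m z] is an
   eigenvector for [m], unless it vanishes and [T z = - m z]. *)
Lemma extremal_eigenvector (V : H -> Prop) :
  (forall x y, V x -> V y -> V (plus x y)) -> (forall (a : R) x, V x -> V (scal a x)) ->
  (forall (u : nat -> H) x, (forall n, V (u n)) -> tends u x -> V x) ->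
  (forall x, V x -> V (T x)) -> (exists x, V x /\ x <> zero) ->
  exists v nu, V v /\ norm v = 1 /\ T v = scal nu v /\ forall x, V x -> norm (T x) <= Rabs nu * norm x.
Proof.
  move=> Vp Vs Vc VT [x0 [Vx0 nx0]].
  have V0 : V zero.
  { have -> : zero = scal 0 x0 by vec. exact: Vs. }
  have [m [m0 [le sup]]] := restricted_norm linT V0 Vs.
  case: (Rle_lt_or_eq_dec _ _ m0) => [mp | Em]; last first.
  { have [|v [h1 [h2 h3]]] := @eigenvector_normalize V 0 x0 Vs Vx0 nx0.
    - apply: minus_eq0; have := le x0 Vx0; rewrite -Em.
      have -> : minus (T x0) (scal 0 x0) = T x0 by vec.
      have := norm_nonneg (T x0); lra.
    - exists v, 0; do 3!(split=> //); move=> x hx; rewrite Rabs_R0 Em; exact: le. }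
  have [u hu] : exists u : nat -> H, forall n, V (u n) /\ norm (u n) <= 1 /\
      m * (1 - / (INR n + 1)) < norm (T (u n)).
  { apply: (@choose _ _ (fun n x => V x /\ norm x <= 1 /\ m * (1 - / (INR n + 1)) < norm (T x))) => n.
    apply: sup; have := inv_succ_pos n; nra. }
  have [k [y [hk lim]]] := compT (x := u) ltac:(exists 1 => n; exact: (proj1 (proj2 (hu n)))).
  have {}lim : tends (fun n => T (u (k n))) y by apply/tends_filterlim.
  have Vy : V y by apply: (Vc _ _ _ lim) => n; apply: VT; exact: (proj1 (hu _)).
  pose z := scal (/ m ^ 2) (T y).
  have m2 : 0 < m ^ 2 by nra.
  have limTT := tends_linear linT lim.
  (* Expanding the square and using [|T (T u)| <= m |T u|] leaves at most [m^4 |u|^2 - m^2 |T u|^2],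
     which tends to 0 because [|T u|] tends to [m]. So [m^2 u] follows [T (T u)], which converges
     along the subsequence given by compactness. *)
  have close n : norm (minus (T (T (u n))) (scal (m ^ 2) (u n))) ^ 2 <= 2 * m ^ 4 * / (INR n + 1).
  { have [hV [h1 h2]] := hu n; rewrite -inner_norm !innerE.
    rewrite (inner_sym (u n) (T (T (u n)))) (symT (T (u n)) (u n)) !inner_norm.
    have h3 := le _ (VT _ hV).
    have h4 : norm (T (T (u n))) ^ 2 <= m ^ 2 * norm (T (u n)) ^ 2.
    { rewrite -Rpow_mult_distr; apply: pow_incr; split=> //; exact: norm_nonneg. }
    have hp := inv_succ_pos n; set q := / (INR n + 1) in hp h2 *.
    have h5 : norm (u n) ^ 2 <= 1.
    { rewrite -(pow1 2); apply: pow_incr; split=> //; exact: norm_nonneg. }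
    have h6 : m ^ 4 * norm (u n) ^ 2 <= m ^ 4 * 1 by apply: Rmult_le_compat_l => //; nra.
    have h7 : m ^ 2 * (1 - 2 * q) <= norm (T (u n)) ^ 2.
    { case: (Rle_dec q 1) => hq.
      - apply: (Rle_trans _ ((m * (1 - q)) ^ 2)); first by nra.
        apply: pow_incr; split; [apply: Rmult_le_pos; lra | lra].
      - apply: (Rle_trans _ 0); [nra | exact: pow2_ge_0]. }
    have h8 : m ^ 2 * (m ^ 2 * (1 - 2 * q)) <= m ^ 2 * norm (T (u n)) ^ 2 by apply: Rmult_le_compat_l => //; lra.
    have E4 : m ^ 4 = m ^ 2 * m ^ 2 by ring.
    rewrite E4 in h6 *; lra. }
  have limz : tends (fun n => u (k n)) z.
  { move=> e he.
    have [N1 h1] := limTT (m ^ 2 * (e / 2)) ltac:(apply: Rmult_lt_0_compat; lra).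
    have [N2 h2] := @inv_succ_small ((e / 2) ^ 2 / 2) ltac:(nra).
    exists (Nat.max N1 N2) => n hn.
    have k1 : norm (minus (T (T (u (k n)))) (T y)) < m ^ 2 * (e / 2) by apply: h1; lia.
    have k2 := h2 (k n) ltac:(have := subseq_ge n hk; lia).
    have k3 := close (k n).
    have k4 : norm (minus (T (T (u (k n)))) (scal (m ^ 2) (u (k n)))) < m ^ 2 * (e / 2).
    { have p1 : 0 <= m ^ 2 * (e / 2) by apply: Rmult_le_pos; lra.
      have p2 : 2 * m ^ 4 * / (INR (k n) + 1) < (m ^ 2 * (e / 2)) ^ 2.
      { have -> : (m ^ 2 * (e / 2)) ^ 2 = 2 * m ^ 4 * ((e / 2) ^ 2 / 2) by field.
        apply: Rmult_lt_compat_l => //; nra. }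
      have p3 := norm_nonneg (minus (T (T (u (k n)))) (scal (m ^ 2) (u (k n)))).
      apply: Rnot_le_lt => hle; have := pow_incr _ _ 2 (conj p1 hle); lra. }
    have k5 := norm_minus_trans (T (T (u (k n)))) (scal (m ^ 2) (u (k n))) (T y).
    rewrite (norm_minus_sym (scal (m ^ 2) (u (k n))) (T (T _))) in k5.
    have E5 : minus (u (k n)) z = scal (/ m ^ 2) (minus (scal (m ^ 2) (u (k n))) (T y)).
    { rewrite /z; vec; field; lra. }
    rewrite E5 norm_scalR Rabs_pos_eq; last by left; apply: Rinv_0_lt_compat.
    apply: (Rmult_lt_reg_l (m ^ 2)) => //.
    rewrite -Rmult_assoc Rinv_r ?Rmult_1_l; last lra.
    apply: (Rle_lt_trans _ _ _ k5). lra. }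
  have Tz : T z = y := tends_unique (tends_linear linT limz) lim.
  have Ty : T y = scal (m ^ 2) z by rewrite /z; vec; field; lra.
  have Vz : V z by apply: Vs; apply: VT.
  have ny : y <> zero.
  { move=> E0; have [N1 h1] := lim (m / 2) ltac:(lra).
    have [N2 h2] := @inv_succ_small (1 / 2) ltac:(lra).
    set n := Nat.max N1 N2.
    have k1 := h1 n ltac:(lia).
    have k2 := h2 (k n) ltac:(have := subseq_ge n hk; lia).
    have k3 := proj2 (proj2 (hu (k n))).
    have k4 := norm_le_minus (T (u (k n))) y; rewrite {1}E0 norm_zeroR in k4.
    have : m * (1 / 2) < m * (1 - / (INR (k n) + 1)) by apply: Rmult_lt_compat_l => //; lra.
    lra. }
  have nz : z <> zero by move=> E0; apply: ny; rewrite -Tz E0; apply: (linear_zero _ linT).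
  case: (classic (plus y (scal m z) = zero)) => hw.
  - have [|v [h1 [h2 h3]]] := @eigenvector_normalize V (- m) z Vs Vz nz.
    + rewrite Tz; have -> : y = minus (plus y (scal m z)) (scal m z) by vec.
      rewrite hw; vec.
    + exists v, (- m); do 3!(split=> //); move=> x hx; rewrite Rabs_Ropp Rabs_pos_eq //; exact: le.
  - have [||v [h1 [h2 h3]]] := @eigenvector_normalize V m (plus y (scal m z)) Vs _ hw.
    + apply: Vp => //; exact: Vs.
    + rewrite lin_plus // lin_scal // Tz Ty; vec.
    + exists v, m; do 3!(split=> //); move=> x hx; rewrite Rabs_pos_eq //; exact: le.
Qed.

Definition orth_to (l : list H) x := forall w, List.In w l -> inner x w = 0.
(** The last clause, maximality of [|nu|] on the orthogonal complement, is what later bounds [T] on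
    the remainders of the expansion. *)
Definition extremal (l : list H) v := norm v = 1 /\ orth_to l v /\
  exists nu, T v = scal nu v /\ forall x, orth_to l x -> norm (T x) <= Rabs nu * norm x.

Lemma extremal_exists l : (forall w, List.In w l -> exists nu, T w = scal nu w) ->
  (exists x, orth_to l x /\ x <> zero) -> exists v, extremal l v.
Proof.
  move=> hl nt; have [||||v [nu [h1 [h2 [h3 h4]]]]] := extremal_eigenvector (V := orth_to l) _ _ _ _ nt.
  - by move=> x y hx hy w hw; rewrite inner_plus hx // hy //; ring.
  - by move=> a x hx w hw; rewrite inner_scal hx //; ring.
  - move=> u x hu lim w hw.
    have h := tends_inner (y := w) lim.
    have h0 : is_lim_seq (fun n => inner (u n) w) 0.
    { apply: (is_lim_seq_ext (fun _ => 0)); last exact: is_lim_seq_const.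
      by move=> n; rewrite hu. }
    have := is_lim_seq_unique _ _ h; rewrite (is_lim_seq_unique _ _ h0); by case.
  - move=> x hx w hw; have [nu hnu] := hl w hw.
    by rewrite symT hnu inner_scal_r hx //; ring.
  - exists v; split=> //; split=> //; by exists nu.
Qed.

Definition next_eigenvector (l : list H) : H := epsilon (inhabits zero) (extremal l).
Fixpoint chosen n : list H := match n with O => nil | S n => cons (next_eigenvector (chosen n)) (chosen n) end.

Lemma chosen_in n w : List.In w (chosen n) <-> exists k, (k < n)%nat /\ w = next_eigenvector (chosen k).
Proof.
  elim: n => [|n IH] /=.
  - split=> // [[k [hk _]]]; lia.
  - rewrite IH; split.
    + move=> [<- | [k [hk ->]]]; [exists n | exists k]; split=> //; lia.
    + move=> [k [hk ->]]; case: (Nat.eq_dec k n) => [-> | nk]; first by left.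
      right; exists k; split=> //; lia.
Qed.

(** Strong induction: infinite dimension provides a nonzero vector orthogonal to the finite list,
    since otherwise each [x] would equal its projection onto the span. *)
Lemma chosen_extremal n : infinite_dimensional H -> extremal (chosen n) (next_eigenvector (chosen n)).
Proof.
  move=> inf; elim/(well_founded_induction Wf_nat.lt_wf): n => n IH.
  rewrite /next_eigenvector; apply: epsilon_spec; apply: extremal_exists.
  - move=> w /chosen_in [k [hk ->]]; have [_ [_ [nu [hnu _]]]] := IH k hk; by exists nu.
  - apply: NNPP => hn; apply: inf.
    pose e k := next_eigenvector (chosen k).
    have orth j k : (j < n)%nat -> (k < n)%nat -> inner (e j) (e k) = if Nat.eq_dec j k then 1 else 0.
    { move=> hj hk; case: Nat.eq_dec => [-> | njk].
      - rewrite inner_norm (proj1 (IH k hk)); ring.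
      - case: (Compare_dec.lt_dec k j) => h.
        + apply: (proj1 (proj2 (IH j hj))); apply/chosen_in; by exists k.
        + rewrite inner_sym; apply: (proj1 (proj2 (IH k hk))); apply/chosen_in; exists j; split=> //; lia. }
    (* [sum_n] includes the index [n], while only the vectors of index below [n] are in the list, so
       the last coefficient is set to 0. *)
    exists n, e => x _; exists (fun k => if Compare_dec.lt_dec k n then inner x (e k) else 0).
    set s := sum_n _ n; apply: NNPP => hs; apply: hn; exists (minus x s); split; last first.
    { move=> E0; apply: hs; apply: minus_eq0; by rewrite E0 norm_zeroR. }
    move=> w /chosen_in [j [hj ->]]; rewrite -/(e j) inner_minus /s inner_sum_n.
    have -> : sum_n (fun k => inner (scal (if Compare_dec.lt_dec k n then inner x (e k) else 0) (e k)) (e j)) n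
      = sum_n (fun k => inner x (e k) * (if Nat.eq_dec k j then 1 else 0)) n.
    { apply: sum_n_ext => k; rewrite inner_scal; case: Compare_dec.lt_dec => hk; first by rewrite orth.
      case: Nat.eq_dec => hkj; [lia | by rewrite Rmult_0_l Rmult_0_r]. }
    rewrite sum_n_delta; case: Compare_dec.le_dec => h; [ring | lia].
Qed.

(** The remainder of [T y] after the index [n] is [T] of the remainder of [y], which is orthogonal
    to all eigenvectors up to [n]; maximality bounds it by [|nu (S n)| |y|], and the eigenvalues
    tend to 0. Dense range extends this to all [x], and injectivity makes the eigenvalues
    nonzero. *)
Theorem hilbert_schmidt : infinite_dimensional H -> (forall x, T x = zero -> x = zero) ->
  (forall x r, 0 < r -> exists y, norm (minus x (T y)) < r) ->
  exists e nu, orthonormal e /\ (forall k, nu k <> 0 /\ T (e k) = scal (nu k) (e k)) /\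
    forall x, tends (partial e (coords e x)) x.
Proof.
  move=> inf inj dns; pose e k := next_eigenvector (chosen k).
  have hg k : extremal (chosen k) (e k) := chosen_extremal k inf.
  have [nu hnu] : exists nu : nat -> R, forall k, T (e k) = scal (nu k) (e k) /\
      forall x, orth_to (chosen k) x -> norm (T x) <= Rabs (nu k) * norm x.
  { apply: (@choose _ _ (fun k (c : R) => T (e k) = scal c (e k) /\
      forall x, orth_to (chosen k) x -> norm (T x) <= Rabs c * norm x)) => k; exact: (proj2 (proj2 (hg k))). }
  have orth : orthonormal e.
  { move=> j k; case: Nat.eq_dec => [-> | njk].
    - rewrite inner_norm (proj1 (hg k)); ring.
    - case: (Compare_dec.lt_dec k j) => h.
      + apply: (proj1 (proj2 (hg j))); apply/chosen_in; by exists k.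
      + rewrite inner_sym; apply: (proj1 (proj2 (hg k))); apply/chosen_in; exists j; split=> //; lia. }
  have Te k : T (e k) = scal (nu k) (e k) := proj1 (hnu k).
  exists e, nu; split=> //; split.
  - move=> k; split=> // E0; have := Te k; rewrite E0 => E1.
    have := orthonormal_norm orth k; rewrite (inj (e k)); first by rewrite norm_zeroR; lra.
    rewrite E1; vec.
  - move=> x r hr; have [y hy] := dns x (r / 2) ltac:(lra).
    have ny := norm_nonneg y.
    have [N hN] := compact_eigenvalues_small orth (nu := nu) (c := r / 2 / (norm y + 1)) compT Te
      ltac:(apply: Rdiv_lt_0_compat; lra).
    exists N => n hn.
    have h1 : norm (minus (T y) (partial e (coords e (T y)) n)) <= r / 2.
    { have -> : minus (T y) (partial e (coords e (T y)) n) = T (minus y (partial e (coords e y) n)).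
      { rewrite lin_minus // (lin_partial _ _ linT Te); congr (minus _ _).
        apply: sum_n_ext => k; congr (scal _ _); by rewrite /coords symT Te inner_scal_r. }
      have := proj2 (hnu (S n)) (minus y (partial e (coords e y) n)) => h.
      apply: (Rle_trans _ _ _ (h _)).
      - move=> w /chosen_in [j [hj ->]]; rewrite -/(e j) inner_minus (partial_coord orth).
        case: Compare_dec.le_dec => hjn; [rewrite /coords; ring | lia].
      - have h2 := partial_le orth y n; have h3 := hN (S n) ltac:(lia).
        have -> : r / 2 = r / 2 / (norm y + 1) * (norm y + 1) by field; lra.
        apply: Rmult_le_compat; [exact: Rabs_pos | exact: norm_nonneg | lra | lra]. }
    have h2 := partial_le orth (minus x (T y)) n.
    have h3 : partial e (coords e (minus x (T y))) n = minus (partial e (coords e x) n) (partial e (coords e (T y)) n).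
    { rewrite -partial_minus; apply: sum_n_ext => k; congr (scal _ _); by rewrite /coords inner_minus. }
    rewrite h3 in h2; rewrite norm_minus_sym.
    have E : minus x (partial e (coords e x) n)
      = plus (minus (minus x (T y)) (minus (partial e (coords e x) n) (partial e (coords e (T y)) n)))
             (minus (T y) (partial e (coords e (T y)) n)) by vec.
    have := norm_split E; lra.
Qed.

End HilbertSchmidt.

(** The resolvent [T] at [l0] is symmetric, compact and injective, with dense range [dom A]; an
    eigenvalue [nu] of [T] corresponds to the eigenvalue [l0 + 1 / nu] of [A]. *)
Lemma self_adjoint_eigenbasis {H : Hilbert} (A : operator H) : infinite_dimensional H ->
  self_adjoint A -> compact_resolvent A -> exists e l, eigenbasis A e l.
Proof.
  move=> inf sa [l0 [T [[hT1 [hT2 [C hC]]] cT]]].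
  have dT y : dom A (T y) by have [_ [h _]] := hT1 y I.
  have AT y : minus (A (T y)) (scal l0 (T y)) = y by have [_ [_ h]] := hT1 y I.
  have TA x : dom A x -> T (minus (A x) (scal l0 x)) = x by move=> hx; have [_ h] := hT2 x I hx.
  have linT : is_linear T.
  { split.
    - move=> x y; rewrite -{1}(AT x) -{1}(AT y) -(TA (plus (T x) (T y))); last by apply: dom_plus.
      congr T; rewrite op_plus //; vec.
    - move=> a x; rewrite -{1}(AT x) -(TA (scal a (T x))); last by apply: dom_scal.
      congr T; rewrite op_scalE //; vec.
    - exists (Rmax 1 C); split; first by apply: Rlt_le_trans (Rmax_l _ _); lra.
      move=> x; apply: Rle_trans (hC x I) _; apply: Rmult_le_compat_r; [exact: norm_nonneg | exact: Rmax_r]. }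
  have symT : symmetric T.
  { move=> x y; have h := sa_symmetric sa (dT x) (dT y).
    have : inner (T x) (minus (A (T y)) (scal l0 (T y))) = inner (minus (A (T x)) (scal l0 (T x))) (T y)
      by rewrite !innerE h.
    by rewrite !AT. }
  have [||e [nu [orth [hnu lim]]]] := hilbert_schmidt linT symT cT inf.
  - move=> x hx; rewrite -(AT x) hx.
    have h0 : T zero = zero := linear_zero _ linT.
    have := AT zero; by rewrite h0.
  - move=> x r hr; have [y [hy h]] := sa_dense sa x hr.
    by exists (minus (A y) (scal l0 y)); rewrite TA.
  - exists e, (fun k => l0 + / nu k); split; [ | split=> //].
    + move=> k; have [n0 Te] := hnu k.
      have de : dom A (e k).
      { have -> : e k = scal (/ nu k) (T (e k)) by rewrite Te; vec; field.
        exact: dom_scal. }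
      split=> //; have := AT (e k); rewrite Te op_scalE // => E.
      have -> : A (e k) = scal (/ nu k) (plus (minus (scal (nu k) (A (e k))) (scal l0 (scal (nu k) (e k))))
         (scal (l0 * nu k) (e k))) by vec; field.
      rewrite E; vec; field; done.
    + move=> x; apply/tends_filterlim; exact: lim.
Qed.

(** * Spectral splitting *)

Section Coordinates.
Context {H : Hilbert} (e : nat -> H).
Hypothesis orth : orthonormal e.
Hypothesis complete : forall x, tends (partial e (coords e x)) x.
Implicit Types x y z : H.

Lemma coord_ext x y : (forall k, inner x (e k) = inner y (e k)) -> x = y.
Proof.
  move=> h; apply: (tends_unique (complete x)); apply: tends_ext (complete y) => n.
  apply: sum_n_ext => k; congr (scal _ _); by rewrite /coords h.
Qed.

Lemma parseval x y : is_lim_seq (fun n => sum_n (fun k => inner x (e k) * inner y (e k)) n) (inner x y).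
Proof.
  apply: (is_lim_seq_ext _ _ _ _ (tends_inner (y := y) (complete x))) => n.
  rewrite /partial inner_sum_n; apply: sum_n_ext => k; by rewrite inner_scal (inner_sym (e k)).
Qed.

Lemma sum_n_le_R (a b : nat -> R) n : (forall k, a k <= b k) -> sum_n a n <= sum_n b n.
Proof.
  move=> h; elim: n => [|n IH]; first by rewrite !sum_O.
  rewrite !sum_Sn; exact: Rplus_le_compat.
Qed.

Lemma sum_n_scalR c (a : nat -> R) n : c * sum_n a n = sum_n (fun k => c * a k) n :> R.
Proof.
  elim: n => [|n IH]; first by rewrite !sum_O.
  by rewrite !sum_Sn -IH /plus /= Rmult_plus_distr_l.
Qed.

Lemma coord_form_ge x y c : (forall k, c * inner x (e k) ^ 2 <= inner y (e k) * inner x (e k)) ->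
  c * norm x ^ 2 <= inner y x.
Proof.
  move=> h; rewrite -inner_norm.
  change (Rbar_le (c * inner x x) (inner y x)).
  apply: (is_lim_seq_le _ _ _ _ _ _ (@parseval y x)); last first.
  - exact: (is_lim_seq_scal_l _ c _ (@parseval x x)).
  - move=> n; cbv beta; rewrite sum_n_scalR; apply: sum_n_le_R => k; have := h k; lra.
Qed.

Lemma coord_norm_le x y c : 0 <= c -> (forall k, Rabs (inner y (e k)) <= c * Rabs (inner x (e k))) ->
  norm y <= c * norm x.
Proof.
  move=> hc h; apply: norm_le_sq; first by apply: Rmult_le_pos => //; exact: norm_nonneg.
  rewrite Rpow_mult_distr -inner_norm.
  change (Rbar_le (inner y y) (c ^ 2 * inner x x)).
  apply: (is_lim_seq_le _ _ _ _ _ (@parseval y y)); last first.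
  - exact: (is_lim_seq_scal_l _ (c ^ 2) _ (@parseval x x)).
  - move=> n; cbv beta; rewrite sum_n_scalR; apply: sum_n_le_R => k.
    have := pow_incr _ _ 2 (conj (Rabs_pos _) (h k)); rewrite Rpow_mult_distr !pow2_abs; lra.
Qed.

(** By continuity [L] may be evaluated on the partial sums, whose coordinate of index [k] no longer
    changes from the index [k] on. *)
Lemma lin_coord (L : H -> H) (c : nat -> R) x k : is_linear L -> (forall j, L (e j) = scal (c j) (e j)) ->
  inner (L x) (e k) = c k * inner x (e k).
Proof.
  move=> hL hc.
  have h := tends_inner (y := e k) (tends_linear hL (complete x)).
  have h0 : is_lim_seq (fun n => inner (L (partial e (coords e x) n)) (e k)) (c k * inner x (e k)).
  { apply: (is_lim_seq_ext_loc (fun _ => c k * inner x (e k))); last exact: is_lim_seq_const.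
    exists k => n hn; rewrite (lin_partial _ _ hL hc) (partial_coord orth).
    by case: Compare_dec.le_dec. }
  have := is_lim_seq_unique _ _ h; rewrite (is_lim_seq_unique _ _ h0); by case.
Qed.

End Coordinates.

Lemma lin_minus_fun {H : Hilbert} (L K : H -> H) : is_linear L -> is_linear K ->
  is_linear (fun x => minus (L x) (K x)).
Proof.
  move=> hL hK; apply: (is_linear_comp (fun x => (L x, opp (K x))) (fun p => plus (fst p) (snd p))).
  - apply: is_linear_prod => //; apply: (is_linear_comp K opp) => //; exact: is_linear_opp.
  - exact: is_linear_plus.
Qed.

(* A spectral splitting of a nonnegative operator: [e], [l] are eigenvectors and eigenvalues, only the
   indices [k <= N] have [l k <= Lam], and [P] is the projection onto the corresponding eigenvectors. *)
Record splitting {H : Hilbert} (A : operator H) (Lam : R) (P : H -> H)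
    (e : nat -> H) (l : nat -> R) (N : nat) : Prop := {
  split_orth : orthonormal e;
  split_eigen : forall k, dom A (e k) /\ A (e k) = scal (l k) (e k);
  split_complete : forall x, tends (partial e (coords e x)) x;
  split_nonneg : forall k, 0 <= l k;
  split_finite : forall k, l k <= Lam -> (k <= N)%nat;
  split_P : forall x, P x = partial e (fun k => (if Rle_dec (l k) Lam then 1 else 0) * inner x (e k)) N
}.

Lemma series_partial {H : Hilbert} (a : nat -> H) N x : is_series a x ->
  (forall k, (N < k)%nat -> a k = zero) -> x = sum_n a N.
Proof.
  move=> /tends_filterlim hx ha; apply: (tends_unique hx) => r hr; exists N => n hn.
  have -> : sum_n a n = sum_n a N.
  { elim: n hn => [|n IH] hn; first by have -> : N = 0%nat by lia.
    case: (Nat.eq_dec N (S n)) => [-> // | hN].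
    rewrite sum_Sn (ha (S n)) ?plus_zero_r; [apply: IH; lia | lia]. }
  by rewrite minus_eq_zero norm_zeroR.
Qed.

(** The compact resolvent at [l0] has eigenvalues [1 / (l k - l0)], which tend to 0, so only
    finitely many [l k] stay below [Lam]. The eigenbasis is arbitrary because the one behind the
    functional calculus is not under control. *)
Lemma eigenvalues_finite {H : Hilbert} (A : operator H) e l Lam : self_adjoint A -> bounded_below_by 0 A ->
  compact_resolvent A -> eigenbasis A e l ->
  (forall k, 0 <= l k) /\ exists N, forall k, l k <= Lam -> (k <= N)%nat.
Proof.
  move=> sa pos [l0 [T [[hT1 [hT2 _]] cT]]] [he [orth _]].
  have l_ge k : 0 <= l k.
  { have [hd hA] := he k; have := pos _ hd; rewrite hA inner_scal orth.
    case: Nat.eq_dec => // _; lra. }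
  split=> //.
  have TA k : T (scal (l k - l0) (e k)) = e k.
  { have [hd hA] := he k; have [_ h] := hT2 (e k) I hd; rewrite -{2}h hA; congr T; vec. }
  have ne k : l k - l0 <> 0.
  { move=> E0; have := TA k; rewrite E0.
    have -> : scal 0 (e k) = scal 0 (scal (l 0%nat) (e 0%nat)) by vec.
    have T0 : T zero = zero.
    { have [_ h] := hT2 zero I (dom_zero sa).
      have z0 : A zero = zero.
      { have -> : zero = scal 0 (zero : H) by vec. rewrite (op_scalE sa); [vec | exact: dom_zero]. }
      rewrite z0 in h; apply: eq_trans h; congr T; vec. }
    have -> : scal 0 (scal (l 0%nat) (e 0%nat)) = zero by vec.
    rewrite T0 => E1; have := orthonormal_norm orth k; rewrite -E1 norm_zeroR; lra. }
  have linT (a : R) k : T (scal a (e k)) = scal (a / (l k - l0)) (e k).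
  { have [hd hA] := he k.
    have hd2 : dom A (scal (a / (l k - l0)) (e k)) by apply: dom_scal.
    have [_ h] := hT2 _ I hd2; apply: eq_trans h; rewrite op_scalE // hA; congr T.
    vec; field; exact: ne. }
  have Te k : T (e k) = scal (/ (l k - l0)) (e k).
  { have {1}-> : e k = scal 1 (e k) by vec. by rewrite linT /Rdiv Rmult_1_l. }
  (* If [l k <= Lam] then, [l k] being nonnegative, [|l k - l0| <= |Lam| + |l0|]; the extra 1 makes
     the comparison strict and the denominator positive. *)
  set c := / (Rabs Lam + Rabs l0 + 1).
  have cp : 0 < Rabs Lam + Rabs l0 + 1 by have := Rabs_pos Lam; have := Rabs_pos l0; lra.
  have [N hN] := compact_eigenvalues_small orth cT Te (Rinv_0_lt_compat _ cp).
  exists N => k hk; case: (Compare_dec.le_lt_dec k N) => // hkN; exfalso.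
  have := hN k ltac:(lia); rewrite Rabs_inv => h.
  have h1 : 0 < Rabs (l k - l0) by apply: Rabs_pos_lt; exact: ne.
  have := Rinv_lt_contravar _ _ (Rmult_lt_0_compat _ _ (Rinv_0_lt_compat _ h1) (Rinv_0_lt_compat _ cp)) h.
  rewrite !Rinv_inv => h2.
  have := Rabs_triang (l k) (- l0); rewrite Rabs_Ropp (Rabs_pos_eq (l k)) //.
  have := Rle_abs Lam; rewrite /Rminus in h2; lra.
Qed.

Lemma Pproj_splitting {H : Hilbert} (A : operator H) mu eps : infinite_dimensional H ->
  self_adjoint A -> bounded_below_by 0 A -> compact_resolvent A ->
  exists e l N, splitting A (Lambda mu eps) (Pproj A mu eps) e l N.
Proof.
  move=> inf sa pos cr; set Lam := Lambda mu eps.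
  have ind r : 0 <= r -> indicator 0 Lam r = if Rle_dec r Lam then 1 else 0.
  { by move=> hr; rewrite /indicator; case: Rle_dec. }
  have [T0 hT0] : exists T, is_funcalc A (indicator 0 Lam) T.
  { have [e [l he]] := self_adjoint_eigenbasis inf sa cr.
    have [l0 [N hN]] := eigenvalues_finite Lam sa pos cr he.
    exists (fun x => partial e (fun k => indicator 0 Lam (l k) * inner x (e k)) N).
    exists e, l; split=> // x; apply/tends_filterlim => r hr; exists N => n hn.
    have -> : sum_n (fun k => scal (indicator 0 Lam (l k) * inner x (e k)) (e k)) n
      = partial e (fun k => indicator 0 Lam (l k) * inner x (e k)) N.
    { elim: n hn => [|n IH] hn; first by have -> : N = 0%nat by lia.
      case: (Nat.eq_dec N (S n)) => [-> // | hNn].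
      rewrite sum_Sn IH; last lia.
      rewrite ind //; case: Rle_dec => hl; first by have := hN _ hl; lia.
      vec. }
    by rewrite /= minus_eq_zero norm_zeroR. }
  have : is_funcalc A (indicator 0 Lam) (Pproj A mu eps).
  { rewrite /Pproj /funcalc; apply: epsilon_spec; by exists T0. }
  (* This eigenbasis comes from the specification of the chosen [Pproj] and may differ from the one
     that showed existence, so finiteness is derived for it again. *)
  move=> [e [l [he hP]]].
  have [l0 [N hN]] := eigenvalues_finite Lam sa pos cr he.
  exists e, l, N; case: (he) => h1 [h2 h3]; split=> //.
  - move=> x; apply/tends_filterlim; exact: h3.
  - move=> x; rewrite (series_partial (N := N) (hP x)).
    + apply: sum_n_ext => k; by rewrite ind.
    + move=> k hk; rewrite ind //; case: Rle_dec => hl; first by have := hN _ hl; lia.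
      vec.
Qed.

(** * Functions of [A] on the lower spectral subspace *)

Section Splitting.
Context {H : Hilbert} (A : operator H) (Lam : R) (P : H -> H) (e : nat -> H) (l : nat -> R) (N : nat).
Hypothesis sp : splitting A Lam P e l N.
Hypothesis sa : self_adjoint A.
Implicit Types x y z : H.

Definition chi k : R := if Rle_dec (l k) Lam then 1 else 0.

Let orth := split_orth sp.
Let complete := split_complete sp.

Lemma chi_cases k : (chi k = 1 /\ l k <= Lam) \/ (chi k = 0 /\ Lam < l k).
Proof. rewrite /chi; case: Rle_dec => h; [by left | right; split=> //; lra]. Qed.

(* The operator [phi(A) P], for a function [phi] on the eigenvalues. *)
Definition mult_op (phi : nat -> R) x := partial e (fun k => chi k * (phi k * inner x (e k))) N.

Lemma mult_op_coord phi x k : inner (mult_op phi x) (e k) = chi k * phi k * inner x (e k).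
Proof.
  rewrite /mult_op (partial_coord orth); case: Compare_dec.le_dec => h; first by ring.
  case: (chi_cases k) => [[_ hl] | [-> _]]; last by ring.
  case: h; exact: (split_finite sp).
Qed.

Lemma mult_op_bounded phi : exists M, 0 < M /\ forall x, norm (mult_op phi x) <= M * norm x.
Proof.
  have key n : exists M, 0 < M /\ forall x, norm (partial e (fun k => chi k * (phi k * inner x (e k))) n) <= M * norm x.
  { have term k x : norm (scal (chi k * (phi k * inner x (e k))) (e k)) <= Rabs (chi k * phi k) * norm x.
    { rewrite norm_scalR (orthonormal_norm orth) Rmult_1_r -Rmult_assoc Rabs_mult.
      apply: Rmult_le_compat_l; first exact: Rabs_pos.
      have := cauchy_schwarz x (e k); rewrite (orthonormal_norm orth); lra. }
    rewrite /partial; elim: n => [|n [M [hM IH]]].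
    - exists (Rabs (chi 0%nat * phi 0%nat) + 1); split; first by have := Rabs_pos (chi 0%nat * phi 0%nat); lra.
      move=> x; rewrite sum_O; have := term 0%nat x; have := norm_nonneg x; lra.
    - exists (M + Rabs (chi (S n) * phi (S n))); split; first by have := Rabs_pos (chi (S n) * phi (S n)); lra.
      move=> x; rewrite sum_Sn; apply: Rle_trans (norm_triangleR _ _) _.
      have := term (S n) x; have := IH x; lra. }
  exact: key.
Qed.

Lemma mult_op_linear phi : is_linear (mult_op phi).
Proof.
  split.
  - move=> x y; apply: (coord_ext complete) => k.
    rewrite mult_op_coord (inner_plus (mult_op phi x)) !mult_op_coord inner_plus; ring.
  - move=> a x; apply: (coord_ext complete) => k.
    rewrite mult_op_coord (inner_scal a (mult_op phi x)) mult_op_coord inner_scal; ring.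
  - exact: mult_op_bounded.
Qed.

Lemma mult_op_symmetric phi : symmetric (mult_op phi).
Proof.
  move=> x y; have h1 := parseval complete (x := mult_op phi x) (y := y); have h2 := parseval complete (x := x) (y := mult_op phi y).
  have := is_lim_seq_unique _ _ h1.
  rewrite (Lim_seq_ext _ (fun n => sum_n (fun k => inner x (e k) * inner (mult_op phi y) (e k)) n)).
  - rewrite (is_lim_seq_unique _ _ h2); by case.
  - move=> n; apply: sum_n_ext => k; rewrite !mult_op_coord.
    have -> : chi k * phi k * inner x (e k) * inner y (e k) = inner x (e k) * (chi k * phi k * inner y (e k)) by ring.
    by [].
Qed.

Lemma mult_op_dom phi x : dom A (mult_op phi x) /\
  A (mult_op phi x) = mult_op (fun k => l k * phi k) x.
Proof.
  rewrite /mult_op /partial; elim: N => [|n [hd hA]].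
  - rewrite !sum_O; have [h1 h2] := split_eigen sp 0; split; first exact: dom_scal.
    rewrite op_scalE // h2; vec.
  - rewrite !sum_Sn; have [h1 h2] := split_eigen sp (S n).
    split; first by apply: dom_plus => //; apply: dom_scal.
    rewrite op_plus ?op_scalE // ?h2 ?hA //; last exact: dom_scal. vec.
Qed.

Lemma P_mult x : P x = mult_op (fun _ => 1) x.
Proof. rewrite (split_P sp) /mult_op; apply: sum_n_ext => k; congr (scal _ _); by rewrite Rmult_1_l. Qed.

Lemma P_coord x k : inner (P x) (e k) = chi k * inner x (e k).
Proof. by rewrite P_mult mult_op_coord Rmult_1_r. Qed.

Lemma P_linear : is_linear P.
Proof. apply: (is_linear_ext _ _ (fun x => eq_sym (P_mult x))); exact: mult_op_linear. Qed.

Lemma P_symmetric : symmetric P.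
Proof. move=> x y; rewrite !P_mult; exact: mult_op_symmetric. Qed.

Lemma chi_idem k : chi k * chi k = chi k.
Proof. by case: (chi_cases k) => [[-> _] | [-> _]]; ring. Qed.

Lemma P_idem x : P (P x) = P x.
Proof. apply: (coord_ext complete) => k; by rewrite !P_coord -Rmult_assoc chi_idem. Qed.

Lemma P_range x : range P x <-> P x = x.
Proof. by split => [[y ->] | h]; [exact: P_idem | exists x]. Qed.

Lemma P_norm x : norm (P x) <= norm x.
Proof.
  rewrite -(Rmult_1_l (norm x)); apply: (coord_norm_le complete); first lra.
  move=> k; rewrite P_coord Rabs_mult; apply: Rmult_le_compat_r; first exact: Rabs_pos.
  case: (chi_cases k) => [[-> _] | [-> _]]; rewrite Rabs_pos_eq; lra.
Qed.

Definition coproj x := minus x (P x).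

Lemma Q_coord x k : inner (coproj x) (e k) = (1 - chi k) * inner x (e k).
Proof. rewrite /coproj inner_minus P_coord; ring. Qed.

Lemma Q_linear : is_linear coproj.
Proof. apply: (lin_minus_fun (is_linear_id (V := H)) P_linear). Qed.

Lemma Q_symmetric : symmetric coproj.
Proof. move=> x y; by rewrite /coproj inner_minus inner_minus_r P_symmetric. Qed.

Lemma Q_idem x : coproj (coproj x) = coproj x.
Proof. apply: (coord_ext complete) => k; rewrite !Q_coord.
  case: (chi_cases k) => [[-> _] | [-> _]]; ring. Qed.

Lemma PQ_zero x : P (coproj x) = zero.
Proof. by rewrite /coproj (lin_minus _ _ P_linear) P_idem minus_eq_zero. Qed.

Lemma range_P_finite : finite_dimensional (range P).
Proof.
  exists N, e => x /P_range <-; rewrite (split_P sp).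
  by exists (fun k => chi k * inner x (e k)).
Qed.

(* [AP] is [A P] and [spectral_group t] is [exp (- t A) P], for [t] of either sign. *)
Definition AP x := mult_op l x.
Definition spectral_group t x := mult_op (fun k => exp (- l k * t)) x.
Local Notation E := spectral_group.

Lemma AP_P x : dom A (P x) /\ A (P x) = AP x.
Proof.
  rewrite P_mult; have [h1 h2] := mult_op_dom (fun _ => 1) x; split=> //; rewrite h2.
  rewrite /AP /mult_op; apply: sum_n_ext => k; by rewrite Rmult_1_r.
Qed.

Lemma AP_range x : P (AP x) = AP x.
Proof. apply: (coord_ext complete) => k; rewrite P_coord !mult_op_coord -!Rmult_assoc chi_idem; ring. Qed.

Lemma E_linear t : is_linear (E t).
Proof. exact: mult_op_linear. Qed.

Lemma E_P t x : E t (P x) = E t x.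
Proof.
  apply: (coord_ext complete) => k; rewrite !mult_op_coord P_coord.
  case: (chi_cases k) => [[-> _] | [-> _]]; ring.
Qed.

Lemma E_zero x : E 0 x = P x.
Proof. apply: (coord_ext complete) => k; rewrite mult_op_coord P_coord Rmult_0_r exp_0; ring. Qed.

(** For [t <= 0] the factor [exp (- l k * t)] increases with [l k], so an upper bound of the lower
    eigenvalues governs the backward growth. *)
Lemma E_bound b t x : (forall k, l k <= Lam -> l k <= b) -> t <= 0 -> norm (E t x) <= exp (- b * t) * norm x.
Proof.
  move=> hb ht; apply: (coord_norm_le complete); first by left; apply: exp_pos.
  move=> k; rewrite mult_op_coord Rabs_mult; apply: Rmult_le_compat_r; first exact: Rabs_pos.
  have e1 := exp_pos (- l k * t); have e2 := exp_pos (- b * t).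
  case: (chi_cases k) => [[-> hl] | [-> _]]; last by rewrite Rmult_0_l Rabs_R0; lra.
  rewrite Rmult_1_l Rabs_pos_eq; last lra.
  have h := hb k hl; case: (Rle_lt_or_eq_dec (- l k * t) (- b * t)); first by nra.
  - move=> h1; left; exact: exp_increasing.
  - move=> ->; lra.
Qed.

(** The product rule behind variation of constants. The lower part is a finite sum, so it is
    computed coordinate by coordinate and no operator-valued derivative occurs. *)
Lemma E_derive (p : R -> H) p' t s : is_derive p s p' ->
  is_derive (fun s => E (t - s) (p s)) s (E (t - s) (plus p' (AP (p s)))).
Proof.
  move=> hp.
  have -> : E (t - s) (plus p' (AP (p s)))
    = sum_n (fun k => scal (chi k * (exp (- l k * (t - s)) * (inner p' (e k) + l k * inner (p s) (e k)))) (e k)) N.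
  { apply: (coord_ext complete) => k; rewrite mult_op_coord inner_plus mult_op_coord.
    rewrite (partial_coord orth (fun k => chi k * (exp (- l k * (t - s)) * (inner p' (e k) + l k * inner (p s) (e k))))).
    cbv beta; case: Compare_dec.le_dec => h.
    - case: (chi_cases k) => [[-> _] | [-> _]]; ring.
    - case: (chi_cases k) => [[_ hl] | [-> _]]; last by ring.
      case: h; exact: (split_finite sp). }
  apply: (is_derive_sum_n (fun k s => scal (chi k * (exp (- l k * (t - s)) * inner (p s) (e k))) (e k))) => k hk.
  apply: is_derive_scal_l; apply: is_derive_scal.
  have -> : exp (- l k * (t - s)) * (inner p' (e k) + l k * inner (p s) (e k))
    = plus (mult (l k * exp (- l k * (t - s))) (inner (p s) (e k)))
           (mult (exp (- l k * (t - s))) (inner p' (e k) + inner (p s) zero)).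
  { rewrite inner_zero_r /plus /mult /=; ring. }
  apply: (is_derive_mult (fun s => exp (- l k * (t - s))) (fun s => inner (p s) (e k))).
  - auto_derive => //; rewrite /Rminus; ring.
  - apply: (derive_inner (g := fun _ => e k) hp); exact: is_derive_const.
  - exact: Rmult_comm.
Qed.

End Splitting.

(** * Spectra and semigroups of the two parts *)

Section SplitSpectrum.
Context {H : Hilbert} (A : operator H) (Lam : R) (P : H -> H) (e : nat -> H) (l : nat -> R) (N : nat).
Hypothesis sp : splitting A Lam P e l N.
Hypothesis sa : self_adjoint A.
Implicit Types x y z : H.

Let orth := split_orth sp.
Let complete := split_complete sp.
Let coordE := (mult_op_coord sp, P_coord sp, Q_coord sp).

Lemma A_coord x k : dom A x -> inner (A x) (e k) = l k * inner x (e k).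
Proof.
  move=> hx; have [h1 h2] := split_eigen sp k.
  by rewrite (sa_symmetric sa hx h1) h2 inner_scal_r.
Qed.

Lemma P_e k : l k <= Lam -> P (e k) = e k.
Proof.
  move=> hk; apply: (coord_ext complete) => j; rewrite (P_coord sp) orth.
  case: Nat.eq_dec => [<- | _]; last by ring.
  case: (chi_cases Lam l k) => [[-> _] | [_ h]]; lra.
Qed.

Lemma P_e0 k : Lam < l k -> P (e k) = zero.
Proof.
  move=> hk; apply: (coord_ext complete) => j; rewrite (P_coord sp) orth inner_zero.
  case: Nat.eq_dec => [<- | _]; last by ring.
  case: (chi_cases Lam l k) => [[_ h] | [-> _]]; lra.
Qed.

Lemma Q_range x : range (coproj P) x <-> coproj P x = x.
Proof. by split => [[y ->] | h]; [exact: Q_idem sp y | exists x]. Qed.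

Lemma Q_range0 x : range (coproj P) x <-> P x = zero.
Proof.
  rewrite Q_range; split => h; first by rewrite -h (PQ_zero sp).
  rewrite /coproj h; vec.
Qed.

(** A resolvent [T] would have to send [(A - l k) (e k) = 0] both to [e k] and to 0. *)
Lemma eigenvalue_spectrum (V : H -> Prop) k : V zero -> V (e k) -> spectrum_on V A (l k).
Proof.
  move=> V0 Ve [T [h1 [h2 _]]].
  have [d hA] := split_eigen sp k.
  have [_ k1] := h2 _ Ve d; have [_ k2] := h2 _ V0 (dom_zero sa).
  have A0 : A zero = zero.
  { have E0 : zero = scal 0 (zero : H) by vec.
    by rewrite {1}E0 (op_scalE sa 0 (dom_zero sa)); vec. }
  rewrite hA minus_eq_zero in k1; rewrite A0 in k2.
  have E1 : minus zero (scal (l k) zero) = (zero : H) by vec.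
  rewrite E1 k1 in k2; have := orthonormal_norm orth k; rewrite k2 norm_zeroR; lra.
Qed.

(** Away from the eigenvalues up to [Lam] the resolvent is explicit: division of the coordinates by
    [l k - r], bounded because the sum is finite. *)
Lemma spectrum_P r : spectrum_on (range P) A r -> exists k, l k <= Lam /\ r = l k.
Proof.
  move=> hr; apply: NNPP => hn; apply: hr.
  have ne k : l k <= Lam -> l k - r <> 0.
  { move=> hk E0; apply: hn; exists k; split=> //; lra. }
  pose phi k := / (l k - r).
  have chi_phi k : chi Lam l k * (phi k * (l k - r)) = chi Lam l k.
  { case: (chi_cases Lam l k) => [[-> h] | [-> _]]; last by ring.
    rewrite /phi Rinv_l; [ring | exact: ne]. }
  exists (mult_op Lam e l N phi); split; [ | split].
  - move=> y /(P_range sp) hy; have [d hA] := mult_op_dom sp sa phi y; split; [ | split=> //].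
    + apply/(P_range sp); apply: (coord_ext complete) => k; rewrite !coordE -!Rmult_assoc (chi_idem Lam l).
      by [].
    + apply: (coord_ext complete) => k; rewrite inner_minus A_coord // inner_scal (mult_op_coord sp).
      have Ey := P_coord sp y k; rewrite hy in Ey.
      transitivity (chi Lam l k * (phi k * (l k - r)) * inner y (e k)); first by ring.
      by rewrite chi_phi -Ey.
  - move=> x /(P_range sp) hx d; have [_ hA] := AP_P sp sa x; rewrite hx in hA; split.
    + apply/(P_range sp); apply: (coord_ext complete) => k.
      rewrite (P_coord sp) inner_minus A_coord // inner_scal.
      have Ex := P_coord sp x k; rewrite hx in Ex.
      transitivity ((l k - r) * (chi Lam l k * inner x (e k))); first by ring.
      rewrite -Ex; ring.
    + apply: (coord_ext complete) => k; rewrite (mult_op_coord sp) inner_minus A_coord // inner_scal.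
      have Ex := P_coord sp x k; rewrite hx in Ex.
      transitivity (chi Lam l k * (phi k * (l k - r)) * inner x (e k)); first by ring.
      by rewrite chi_phi -Ex.
  - have [M [_ hM]] := mult_op_bounded sp phi; exists M => y _; exact: hM.
Qed.

Lemma spectrum_P_sup : let b := real (Lub_Rbar (spectrum_on (range P) A)) in
  0 <= b /\ forall k, l k <= Lam -> l k <= b.
Proof.
  have [h1 h2] := Lub_Rbar_correct (spectrum_on (range P) A).
  set L := Lub_Rbar _ in h1 h2 *.
  have mem k : l k <= Lam -> Rbar_le (l k) L.
  { move=> hk; apply: h1; apply: eigenvalue_spectrum.
    - apply/(P_range sp); exact: (linear_zero _ (P_linear sp)).
    - apply/(P_range sp); exact: P_e. }
  have up : Rbar_le L Lam.
  { apply: h2 => r /spectrum_P [k [hk ->]]; exact: hk. }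
  (* [p_infty] is excluded by [up]. For [m_infty] no eigenvalue lies below [Lam] and [real] returns
     0. A finite negative value is impossible, since the eigenvalues are nonnegative and an empty
     spectrum has supremum [m_infty]. *)
  case EL : L mem up => [r | | ] mem up //=.
  - split; last exact: mem.
    apply: Rnot_lt_le => hr.
    have : Rbar_le L m_infty; last by rewrite EL.
    apply: h2 => r' /spectrum_P [k [hk _]].
    have := mem k hk; have := split_nonneg sp k; rewrite /=; lra.
  - split; first lra. move=> k /mem; by [].
Qed.

(* [A + Lam P - r >= Lam - r > 0] is invertible and agrees with [A - r] on the range of [1 - P]. *)
Lemma spectrum_Q r : spectrum_on (range (coproj P)) A r -> Lam <= r.
Proof.
  move=> hr; apply: Rnot_lt_le => hl; apply: hr.
  pose K (x : H) : H := minus (scal Lam (P x)) (scal r x).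
  pose B := {| dom := dom A; op := fun x => plus (A x) (K x) |}.
  have linK : is_linear K.
  { apply: lin_minus_fun; last by apply: is_linear_scal_r; exact: Rmult_comm.
    apply: (is_linear_comp P (fun x => scal Lam x)); first exact: (P_linear sp).
    apply: is_linear_scal_r; exact: Rmult_comm. }
  have sB : self_adjoint B.
  { apply: (@sa_perturb _ A sa B 1 K R1_neq_R0 linK) => //.
    - move=> x y; rewrite /K !innerE (P_symmetric sp); ring.
    - move=> x; rewrite /= scal_one //. }
  have Bcoord x k : dom A x -> inner (B x) (e k) = (l k + Lam * chi Lam l k - r) * inner x (e k).
  { move=> hx; rewrite /= /K inner_plus inner_minus !inner_scal A_coord // (P_coord sp); ring. }
  have bpos k : Lam - r <= l k + Lam * chi Lam l k - r.
  { have := split_nonneg sp k; case: (chi_cases Lam l k) => [[-> _] | [-> h]]; lra. }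
  have bB : bounded_below_by (Lam - r) B.
  { move=> x hx; apply: (coord_form_ge complete) => k; rewrite Bcoord //.
    have := bpos k; have := pow2_ge_0 (inner x (e k)); nra. }
  have cp : 0 < Lam - r by lra.
  have [T hT] := choose (fun y => sa_surjective sB y cp bB).
  exists T; split; [ | split].
  - move=> y /Q_range0 hy; have [d hB] := hT y.
    have PT : P (T y) = zero.
    { apply: (coord_ext complete) => k; rewrite inner_zero (P_coord sp).
      case: (chi_cases Lam l k) => [[E1 _] | [-> _]]; last by ring.
      have := Bcoord (T y) k d; rewrite hB.
      have := P_coord sp y k; rewrite hy inner_zero E1 => E2 E3.
      have := bpos k; rewrite E1 in E3 * => hb.
      have : (l k + Lam * 1 - r) * inner (T y) (e k) = 0 by lra.
      case/Rmult_integral => h; lra. }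
    split; first by apply/Q_range0. split=> //.
    rewrite -{3}hB /= /K PT; vec.
  - move=> x /Q_range0 hx d; split.
    + apply/Q_range0; apply: (coord_ext complete) => k.
      rewrite (P_coord sp) inner_minus inner_scal A_coord // inner_zero.
      have := P_coord sp x k; rewrite hx inner_zero => E0.
      have -> : chi Lam l k * (l k * inner x (e k) - r * inner x (e k)) = (l k - r) * (chi Lam l k * inner x (e k)) by ring.
      rewrite -E0; ring.
    + have [d2 hB] := hT (minus (A x) (scal r x)).
      apply: minus_eq0; set w := minus (T _) x.
      have dw : dom B w by apply: (dom_minus sB).
      have Bw : B w = zero.
      { rewrite /w (op_minus sB) // hB /= /K hx; vec. }
      have := norm_op_ge cp bB dw; rewrite Bw norm_zeroR.
      have := norm_nonneg w; nra.
  - exists (/ (Lam - r)) => y _; have [d hB] := hT y.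
    have := norm_op_ge cp bB d; rewrite hB => h.
    apply: (Rmult_le_reg_l (Lam - r)) => //; rewrite -Rmult_assoc Rinv_r ?Rmult_1_l; lra.
Qed.

Lemma spectrum_Q_inf : let g := real (Glb_Rbar (spectrum_on (range (coproj P)) A)) in
  Lam <= g /\ forall k, Lam < l k -> g <= l k.
Proof.
  have [h1 h2] := Glb_Rbar_correct (spectrum_on (range (coproj P)) A).
  set L := Glb_Rbar _ in h1 h2 *.
  have mem k : Lam < l k -> Rbar_le L (l k).
  { move=> hk; apply: h1; apply: eigenvalue_spectrum; apply/Q_range0.
    - exact: (linear_zero _ (P_linear sp)).
    - exact: P_e0. }
  have low : Rbar_le Lam L by apply: h2 => r /spectrum_Q.
  (* Indices with [l k <= Lam] are at most [N], so the upper part is never empty and the infimum is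
     finite. *)
  have big : Lam < l (S N).
  { apply: Rnot_le_lt => h; have := split_finite sp h; lia. }
  case EL : L mem low => [r | | ] mem low //=.
  by have := mem _ big.
Qed.

End SplitSpectrum.

(** * The renormalized semigroup in coordinates *)

Section SplitSemigroup.
Context {H : Hilbert} (A : operator H) (Lam : R) (P : H -> H) (e : nat -> H) (l : nat -> R) (N : nat).
Hypothesis sp : splitting A Lam P e l N.
Hypothesis sa : self_adjoint A.
Hypothesis pos : bounded_below_by 0 A.
Context (c : R).
Hypothesis hc : 0 < c.
Implicit Types x y z : H.

Let orth := split_orth sp.
Let complete := split_complete sp.

Definition lifted : operator H := {| dom := dom A; op := fun x => plus (A x) (scal c (coproj P x)) |}.

Lemma lifted_sa : self_adjoint lifted.
Proof.
  apply: (@sa_perturb _ A sa lifted 1 (fun x => scal c (coproj P x)) R1_neq_R0) => //.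
  - apply: (is_linear_comp (coproj P) (fun x => scal c x)); first exact: (Q_linear sp).
    apply: is_linear_scal_r; exact: Rmult_comm.
  - move=> x y; by rewrite inner_scal inner_scal_r (Q_symmetric sp).
  - by move=> x; rewrite /= scal_one.
Qed.

Lemma lifted_pos : bounded_below_by 0 lifted.
Proof.
  move=> x hx; rewrite /= inner_plus inner_scal -(Q_idem sp x) (Q_symmetric sp) inner_norm.
  have := pos hx; have := Rmult_le_pos _ _ (Rlt_le _ _ hc) (pow2_ge_0 (norm (coproj P x))).
  lra.
Qed.

Definition kappa k := l k + c * (1 - chi Lam l k).

Lemma kappa_nonneg k : 0 <= kappa k.
Proof.
  rewrite /kappa; have := split_nonneg sp k.
  case: (chi_cases Lam l k) => [[-> _] | [-> _]]; lra.
Qed.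

Lemma lifted_eigen k : dom lifted (e k) /\ lifted (e k) = scal (kappa k) (e k).
Proof.
  have [d hA] := split_eigen sp k; split=> //=; rewrite hA.
  apply: (coord_ext complete) => j.
  rewrite inner_plus !inner_scal (Q_coord sp) orth.
  case: Nat.eq_dec => [<- | _]; [rewrite /kappa; ring | ring].
Qed.

Context (S : R -> H -> H).
Hypothesis gen : generated_by_opp lifted S.

Lemma S_coord t x k : 0 <= t -> inner (S t x) (e k) = exp (- kappa k * t) * inner x (e k).
Proof.
  move=> ht; apply: (lin_coord orth complete (c := fun k => exp (- kappa k * t))); first exact: (gen_linear gen).
  move=> j; have [d hB] := lifted_eigen j.
  apply: (gen_eigen gen) => //; exact: kappa_nonneg.
Qed.

(* [exp (- t B) Q], where [B] is the lifted operator and [Q = 1 - P]. *)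
Definition SQ t x := S t (coproj P x).

Lemma SQ_coord t x k : 0 <= t -> inner (SQ t x) (e k) = exp (- kappa k * t) * ((1 - chi Lam l k) * inner x (e k)).
Proof. by move=> ht; rewrite /SQ S_coord // (Q_coord sp). Qed.

(** The lift acts only above [Lam], so on the range of [P] the semigroup is that of [A] and extends
    to negative times, which is what allows [p] to be integrated backward. *)
Lemma S_split t x : 0 <= t -> S t x = plus (spectral_group Lam e l N t x) (SQ t x).
Proof.
  move=> ht; apply: (coord_ext complete) => k.
  rewrite inner_plus S_coord // SQ_coord // (mult_op_coord sp).
  rewrite /kappa; case: (chi_cases Lam l k) => [[-> _] | [-> _]]; last by ring.
  have -> : - (l k + c * (1 - 1)) * t = - l k * t by ring. ring.
Qed.

Lemma Q_SQ t x : 0 <= t -> coproj P (SQ t x) = SQ t x.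
Proof.
  move=> ht; apply: (coord_ext complete) => k; rewrite (Q_coord sp) SQ_coord //.
  case: (chi_cases Lam l k) => [[-> _] | [-> _]]; ring.
Qed.

Lemma SQ_decaying a : (forall k, Lam < l k -> a <= l k + c) -> decaying SQ a.
Proof.
  move=> ha; split.
  - move=> t ht; apply: (is_linear_comp (coproj P) (S t)); first exact: (Q_linear sp). exact: (gen_linear gen).
  - move=> t x ht; apply: (coord_norm_le complete); first by left; apply: exp_pos.
    move=> k; rewrite SQ_coord // !Rabs_mult -Rmult_assoc.
    apply: Rmult_le_compat_r; first exact: Rabs_pos.
    have e1 := exp_pos (- a * t); have e2 := exp_pos (- kappa k * t).
    rewrite (Rabs_pos_eq (exp _)); last lra.
    case: (chi_cases Lam l k) => [[E1 _] | [E1 hl]].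
    + rewrite E1 Rminus_diag Rabs_R0; lra.
    + rewrite E1 Rminus_0_r Rabs_R1 Rmult_1_r.
      have h := ha k hl; have hk : a <= kappa k by rewrite /kappa E1; lra.
      case: (Rle_lt_or_eq_dec (- kappa k * t) (- a * t)); first by nra.
      * move=> h1; left; exact: exp_increasing.
      * move=> ->; lra.
  - move=> s t x hs ht; rewrite {2}/SQ Q_SQ // /SQ; exact: (gen_semigroup gen).
  - move=> x t; exact: (gen_continuous gen).
Qed.

End SplitSemigroup.

(** * Mild solutions *)

Lemma exp_le x y : x <= y -> exp x <= exp y.
Proof. case=> [h | ->]; [left; exact: exp_increasing | exact: Rle_refl]. Qed.

Lemma exp_small r : 0 < r -> exists x0, forall x, x0 <= x -> exp (- x) < r.
Proof.
  move=> hr; exists (/ r) => x hx; rewrite exp_Ropp -(Rinv_inv r).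
  have h0 : 0 < / r by apply: Rinv_0_lt_compat.
  apply: Rinv_0_lt_contravar => //; have := exp_ineq1_le x; lra.
Qed.

Section Mild.
Context {X : Hilbert} (S : R -> X -> X) (a : R).
Hypothesis hS : decaying S a.
Hypothesis a0 : 0 <= a.
Implicit Types (F u : R -> X).

Definition mild F u t0 t :=
  is_RInt (fun s => S (t - s) (F s)) t0 t (minus (u t) (S (t - t0) (u t0))).

Lemma decay_contraction t x : 0 <= t -> norm (S t x) <= norm x.
Proof.
  move=> ht; apply: Rle_trans (decay_bound hS x ht) _.
  rewrite -{2}(Rmult_1_l (norm x)); apply: Rmult_le_compat_r; first exact: norm_nonneg.
  rewrite -exp_0; apply: exp_le; nra.
Qed.

(** [Rmax] extends the integrand continuously beyond [s = t], where the values of [S] are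
    arbitrary. *)
Lemma duhamel_continuous F t s : (forall r, continuous F r) -> continuous (fun s => S (Rmax 0 (t - s)) (F s)) s.
Proof.
  move=> cF.
  apply: (continuous_dominated (k := fun r => norm (minus (F r) (F s))
    + norm (minus (S (Rmax 0 (t - r)) (F s)) (S (Rmax 0 (t - s)) (F s))))).
  - apply: (continuous_plus (V := R_NormedModule)); apply: continuous_dist => //.
    apply: (continuous_comp (fun r => t - r) (fun r => S (Rmax 0 r) (F s))); last exact: (decay_continuous hS).
    apply: ex_derive_continuous; by auto_derive.
  - rewrite !minus_eq_zero norm_zeroR; lra.
  - move=> r; apply: Rle_trans (norm_minus_trans (S (Rmax 0 (t - r)) (F s)) _ _) _.
    apply: Rplus_le_compat_r; rewrite -(lin_minus _ _ (decay_linear hS (Rmax_l 0 (t - r)))).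
    apply: decay_contraction; exact: Rmax_l.
Qed.

Definition duhamel F t0 t := RInt (fun s => S (Rmax 0 (t - s)) (F s)) t0 t.

Lemma duhamel_is F t0 t : (forall r, continuous F r) -> t0 <= t ->
  is_RInt (fun s => S (t - s) (F s)) t0 t (duhamel F t0 t).
Proof.
  move=> cF ht; apply: (is_RInt_ext (fun s => S (Rmax 0 (t - s)) (F s))).
  - move=> s; rewrite (Rmin_left t0 t) // (Rmax_right t0 t) // => hs; rewrite (Rmax_right 0); [by [] | lra].
  - apply: RInt_is => s; exact: duhamel_continuous.
Qed.

(** As [eta < a], the integral of [exp (- a (t - s)) exp (- eta s)] over any interval ending at [t]
    is at most [exp (- eta t) / (a - eta)]. The bound is uniform in [t0], which may therefore tend
    to [- oo]. *)
Lemma duhamel_bound F eta C t0 t v : eta < a -> 0 <= C -> t0 <= t ->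
  (forall s, t0 <= s <= t -> norm (F s) <= C * exp (- eta * s)) ->
  is_RInt (fun s => S (t - s) (F s)) t0 t v -> norm v <= C / (a - eta) * exp (- eta * t).
Proof.
  move=> he hC ht hF hv.
  have hI := @is_RInt_exp (C * exp (- a * t)) (a - eta) t0 t ltac:(lra).
  apply: (Rle_trans _ (C * exp (- a * t) / (a - eta) * (exp ((a - eta) * t) - exp ((a - eta) * t0)))).
  - apply: (RInt_norm_le ht _ hv hI) => s hs.
    apply: Rle_trans (decay_bound hS _ _) _; first lra.
    apply: Rle_trans (Rmult_le_compat_l _ _ _ (Rlt_le _ _ (exp_pos _)) (hF s hs)) _.
    right; have -> : exp (- a * (t - s)) * (C * exp (- eta * s)) = C * (exp (- a * (t - s)) * exp (- eta * s)) by ring.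
    rewrite Rmult_assoc -!exp_plus; congr (_ * exp _); ring.
  - have h1 := exp_pos ((a - eta) * t0).
    have h2 : 0 <= C * exp (- a * t) / (a - eta).
    { apply: Rdiv_le_0_compat; last lra. apply: Rmult_le_pos => //; left; exact: exp_pos. }
    apply: (Rle_trans _ (C * exp (- a * t) / (a - eta) * exp ((a - eta) * t))).
    { apply: Rmult_le_compat_l => //; lra. }
    right; have -> : - eta * t = - a * t + (a - eta) * t by ring.
    rewrite exp_plus; field; lra.
Qed.

Lemma duhamel_crude F M t0 t v : t0 <= t -> (forall s, norm (F s) <= M) ->
  is_RInt (fun s => S (t - s) (F s)) t0 t v -> norm v <= M * (t - t0).
Proof.
  move=> ht hF hv.
  have hI := is_RInt_const (V := R_NormedModule) t0 t M.
  have E : scal (t - t0) M = M * (t - t0) by rewrite /scal /= /mult /=; ring.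
  rewrite -E; apply: (RInt_norm_le ht _ hv hI) => s hs.
  apply: Rle_trans (hF s); apply: decay_contraction; lra.
Qed.

Lemma duhamel_step F t0 t t1 v w : t0 <= t -> t <= t1 ->
  is_RInt (fun s => S (t - s) (F s)) t0 t v -> is_RInt (fun s => S (t1 - s) (F s)) t t1 w ->
  is_RInt (fun s => S (t1 - s) (F s)) t0 t1 (plus (S (t1 - t) v) w).
Proof.
  move=> h1 h2 hv hw; apply: is_RInt_Chasles hw.
  apply: (is_RInt_ext (fun s => S (t1 - t) (S (t - s) (F s)))).
  - move=> s; rewrite (Rmin_left _ _ _) // (Rmax_right _ _ _) // => hs.
    rewrite -(decay_semigroup hS); try lra. congr (S _ _); ring.
  - apply: is_RInt_linear hv; apply: (decay_linear hS); lra.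
Qed.

Lemma is_RInt_eq F t0 t v w : is_RInt F t0 t v -> is_RInt F t0 t w -> v = w.
Proof. by move=> h1 h2; rewrite -(is_RInt_unique _ _ _ _ h1) (is_RInt_unique _ _ _ _ h2). Qed.

(** The integral over a point vanishes. When [S 0] is a projection this says that [u t] lies in its
    range. *)
Lemma mild_point F u t : mild F u t t -> u t = S 0 (u t).
Proof.
  move=> h; have := is_RInt_eq h (is_RInt_point _ t); rewrite Rminus_diag => E0.
  by apply: minus_eq0; rewrite E0 norm_zeroR.
Qed.

(** Left continuity cannot come from running the semigroup backward: [u t] and [u t1] are both
    compared with the free evolution from the earlier time [t1 - tau], and the forcing contributes
    at most [3 M tau] in all. *)
Lemma mild_continuous F u M : (forall s, norm (F s) <= M) ->
  (forall t0 t, t0 <= t -> mild F u t0 t) -> forall t, continuous u t.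
Proof.
  move=> hF hu t1; apply/continuous_normP => e he.
  have M0 : 0 <= M by apply: Rle_trans (hF 0); exact: norm_nonneg.
  set tau := e / 2 / (4 * (M + 1)).
  have ht : 0 < tau by apply: Rdiv_lt_0_compat; lra.
  have hMt : 3 * (M * tau) < e / 2.
  { have -> : e / 2 = 4 * ((M + 1) * tau) by rewrite /tau; field; lra. nra. }
  set t0 := t1 - tau.
  have [d [hd k]] := proj1 (continuous_normP _ _) (@decay_continuous _ _ _ hS (u t0) tau) (e / 2) ltac:(lra).
  exists (Rmin d tau); split; first by apply: Rmin_glb_lt.
  move=> t hs.
  have b1 : Rabs (t - t1) < d := Rlt_le_trans _ _ _ hs (Rmin_l _ _).
  have [b2 b3] := Rabs_def2 _ _ (Rlt_le_trans _ _ _ hs (Rmin_r _ _)).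
  have g1 := duhamel_crude (t0 := t0) (t := t) ltac:(rewrite /t0; lra) hF (hu t0 t ltac:(rewrite /t0; lra)).
  have g2 := duhamel_crude (t0 := t0) (t := t1) ltac:(rewrite /t0; lra) hF (hu t0 t1 ltac:(rewrite /t0; lra)).
  have g3 := k (t - t0) ltac:(have -> : t - t0 - tau = t - t1 by rewrite /t0; ring).
  have g3' := g3 b1.
  rewrite !Rmax_right in g3'; try (rewrite /t0; lra).
  have E1 : t1 - t0 = tau by rewrite /t0; ring.
  rewrite E1 in g2.
  have g4 := norm_minus_trans (S (t - t0) (u t0)) (u t) (u t1).
  have g5 := norm_minus_trans (S tau (u t0)) (S (t - t0) (u t0)) (u t1).
  rewrite (norm_minus_sym (S tau (u t0)) (u t1)) in g5.
  have g6 : M * (t - t0) <= M * (2 * tau) by apply: Rmult_le_compat_l => //; rewrite /t0; lra.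
  lra.
Qed.

Lemma tends_ext_loc (v w : nat -> X) x n0 : (forall n, (n0 <= n)%nat -> v n = w n) -> tends v x -> tends w x.
Proof.
  move=> h hv e he; have [n1 h1] := hv e he; exists (Nat.max n0 n1) => n hn.
  rewrite -h; [apply: h1; lia | lia].
Qed.

(** The integral from [- oo], obtained as the limit of the solutions started from 0 at time [- n];
    these form a Cauchy sequence because the influence of the start decays at rate [a]. *)
Theorem bounded_solution F M : 0 < a -> (forall s, continuous F s) -> (forall s, norm (F s) <= M) ->
  exists u, (forall t, continuous u t) /\ (forall t, norm (u t) <= M / a) /\
    forall t0 t, t0 <= t -> mild F u t0 t.
Proof.
  move=> ap cF hF.
  have M0 : 0 <= M by apply: Rle_trans (hF 0); exact: norm_nonneg.
  have bnd t0 t : t0 <= t -> norm (duhamel F t0 t) <= M / a.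
  { move=> ht; have := @duhamel_bound F 0 M t0 t (duhamel F t0 t) ap M0 ht _ (duhamel_is cF ht).
    rewrite Rminus_0_r Ropp_0 Rmult_0_l exp_0 Rmult_1_r; apply=> s _; by rewrite Rmult_0_l exp_0 Rmult_1_r. }
  have chasles t0 t t1 : t0 <= t -> t <= t1 ->
    duhamel F t0 t1 = plus (S (t1 - t) (duhamel F t0 t)) (duhamel F t t1).
  { move=> h1 h2; apply: (is_RInt_eq (duhamel_is cF (Rle_trans _ _ _ h1 h2))).
    by apply: duhamel_step => //; apply: duhamel_is. }
  have [u hu] : exists u : R -> X, forall t, tends (fun n => duhamel F (- INR n) t) (u t).
  { apply: (@choose _ _ (fun t x => tends (fun n => duhamel F (- INR n) t) x)) => t.
    apply: tends_cauchy => e he.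
    have [x0 hx0] := @exp_small (e / 2 / (M / a + 1))
      ltac:(apply: Rdiv_lt_0_compat; [lra | have := Rdiv_le_0_compat _ _ M0 ap; lra]).
    have [N hN] := INR_unbounded (Rmax (- t) (x0 / a - t)).
    have hMa := Rdiv_le_0_compat _ _ M0 ap.
    have close n : (N <= n)%nat -> norm (minus (duhamel F (- INR n) t) (duhamel F (- INR N) t)) < e / 2.
    { move=> hn; have hn' := le_INR _ _ hn; have m1 := Rmax_l (- t) (x0 / a - t); have m2 := Rmax_r (- t) (x0 / a - t).
      rewrite (chasles (- INR n) (- INR N) t); try lra.
      have -> : minus (plus (S (t - - INR N) (duhamel F (- INR n) (- INR N))) (duhamel F (- INR N) t))
        (duhamel F (- INR N) t) = S (t - - INR N) (duhamel F (- INR n) (- INR N)) by vec.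
      apply: Rle_lt_trans (decay_bound hS _ _) _; first lra.
      have h1 : exp (- a * (t - - INR N)) < e / 2 / (M / a + 1).
      { have -> : - a * (t - - INR N) = - (a * (t + INR N)) by ring.
        apply: hx0; have -> : x0 = a * (x0 / a) by field; lra.
        apply: Rmult_le_compat_l; lra. }
      have h2 := bnd (- INR n) (- INR N) ltac:(lra).
      apply: (Rle_lt_trans _ (exp (- a * (t - - INR N)) * (M / a + 1))).
      - apply: Rmult_le_compat_l; [left; exact: exp_pos | lra].
      - have -> : e / 2 = e / 2 / (M / a + 1) * (M / a + 1) by field; split; lra.
        apply: Rmult_lt_compat_r; lra. }
    exists N => n m hn hm; have c1 := close n hn; have c2 := close m hm.
    have := norm_minus_trans (duhamel F (- INR N) t) (duhamel F (- INR n) t) (duhamel F (- INR m) t).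
    rewrite (norm_minus_sym (duhamel F (- INR N) t) (duhamel F (- INR m) t)); lra. }
  have mu t0 t : t0 <= t -> mild F u t0 t.
  { move=> ht; rewrite /mild.
    have -> : minus (u t) (S (t - t0) (u t0)) = duhamel F t0 t; last exact: duhamel_is.
    have -> : u t = plus (S (t - t0) (u t0)) (duhamel F t0 t); last by vec.
    apply: (tends_unique (hu t)).
    have [N hN] := INR_unbounded (- t0).
    have lin := decay_linear hS (t := t - t0) ltac:(lra).
    apply: (@tends_ext_loc (fun n => plus (S (t - t0) (duhamel F (- INR n) t0)) (duhamel F t0 t)) _ _ N).
    - move=> n hn; symmetry; apply: chasles => //; have := le_INR _ _ hn; lra.
    - apply: tends_plus; last exact: tends_const. exact: (tends_linear lin (hu t0)). }
  exists u; split; [ | split=> //].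
  - exact: (mild_continuous hF mu).
  - move=> t; apply: (tends_norm_le (hu t)); have [N hN] := INR_unbounded (- t).
    exists N => n hn; apply: bnd; have := le_INR _ _ hn; lra.
Qed.

Lemma mild_minus F1 F2 u1 u2 t0 t : t0 <= t -> mild F1 u1 t0 t -> mild F2 u2 t0 t ->
  mild (fun s => minus (F1 s) (F2 s)) (fun s => minus (u1 s) (u2 s)) t0 t.
Proof.
  move=> ht h1 h2; rewrite /mild (lin_minus _ _ (decay_linear hS (t := t - t0) _)); last lra.
  have -> : minus (minus (u1 t) (u2 t)) (minus (S (t - t0) (u1 t0)) (S (t - t0) (u2 t0)))
    = minus (minus (u1 t) (S (t - t0) (u1 t0))) (minus (u2 t) (S (t - t0) (u2 t0))) by vec.
  apply: (is_RInt_ext (fun s => minus (S (t - s) (F1 s)) (S (t - s) (F2 s)))).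
  - move=> s; rewrite (Rmin_left _ _ _) // (Rmax_right _ _ _) // => hs.
    rewrite (lin_minus _ _ (decay_linear hS (t := t - s) _)) //; lra.
  - exact: (is_RInt_minus _ _ _ _ _ _ h1 h2).
Qed.

(** A solution bounded in the past forgets its initial value: as [t0] tends to [- oo] the term
    [S (t - t0) (u t0)] disappears and only the integral remains. So boundedness replaces an initial
    condition for [u] and [q]. *)
Lemma mild_decay F u eta C B : 0 < a -> eta < a -> 0 <= C ->
  (forall t0 t, t0 <= t -> t <= 0 -> mild F u t0 t) -> (forall t, t <= 0 -> norm (u t) <= B) ->
  (forall s, s <= 0 -> norm (F s) <= C * exp (- eta * s)) ->
  forall t, t <= 0 -> norm (u t) <= C / (a - eta) * exp (- eta * t).
Proof.
  move=> ap he hC hu hB hF t ht; apply: le_epsilon => r hr.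
  have B0 : 0 <= B by apply: Rle_trans (hB t ht); exact: norm_nonneg.
  have [x0 hx0] := @exp_small (r / (B + 1)) ltac:(apply: Rdiv_lt_0_compat; lra).
  set t0 := t - Rmax 0 (x0 / a).
  have m1 := Rmax_l 0 (x0 / a); have m2 := Rmax_r 0 (x0 / a).
  have h0 : t0 <= t by rewrite /t0; lra.
  have h1 := duhamel_bound he hC h0 (fun s hs => hF s (Rle_trans _ _ _ (proj2 hs) ht)) (hu t0 t h0 ht).
  have h2 := norm_le_minus (u t) (S (t - t0) (u t0)).
  have h3 : norm (S (t - t0) (u t0)) <= r.
  { apply: Rle_trans (decay_bound hS _ _) _; first lra.
    have h4 : exp (- a * (t - t0)) < r / (B + 1).
    { have -> : - a * (t - t0) = - (a * Rmax 0 (x0 / a)) by rewrite /t0; ring.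
      apply: hx0; have {1}-> : x0 = a * (x0 / a) by field; lra.
      apply: Rmult_le_compat_l; lra. }
    have -> : r = r / (B + 1) * (B + 1) by field; lra.
    apply: Rmult_le_compat; [left; exact: exp_pos | exact: norm_nonneg | lra | ].
    have := hB t0 ltac:(lra); lra. }
  lra.
Qed.

Lemma mild_shift F u t0 t r : mild F u (t0 + r) (t + r) -> mild (fun s => F (s + r)) (fun s => u (s + r)) t0 t.
Proof.
  rewrite /mild => h.
  have E0 : t + r - (t0 + r) = t - t0 by ring.
  rewrite E0 in h.
  apply: (is_RInt_ext (fun s => scal 1 (S (t + r - (1 * s + r)) (F (1 * s + r))))).
  - move=> s _; rewrite scal_one Rmult_1_l; congr (S _ _); ring.
  - apply: (is_RInt_comp_lin (fun s => S (t + r - s) (F s))); by rewrite !Rmult_1_l.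
Qed.

Lemma mild_ext F1 F2 u1 u2 t0 t : t0 <= t -> (forall s, t0 <= s <= t -> F1 s = F2 s /\ u1 s = u2 s) ->
  mild F1 u1 t0 t -> mild F2 u2 t0 t.
Proof.
  move=> ht h hm; rewrite /mild -(proj2 (h t0 ltac:(lra))) -(proj2 (h t ltac:(lra))).
  apply: is_RInt_ext hm => s; rewrite (Rmin_left _ _ _) // (Rmax_right _ _ _) // => hs.
  by rewrite (proj1 (h s ltac:(lra))).
Qed.

End Mild.

(** * The Lyapunov-Perron fixed point *)

Section SpectralGroup.
Context {H : Hilbert} (A : operator H) (Lam : R) (P : H -> H) (e : nat -> H) (l : nat -> R) (N : nat).
Hypothesis sp : splitting A Lam P e l N.
Implicit Types (F p : R -> H) (x : H).

Local Notation E := (spectral_group Lam e l N).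
Local Notation AP := (AP Lam e l N).

Lemma continuous_inner_l F x t : continuous F t -> continuous (fun s => inner (F s) x) t.
Proof.
  move=> /continuous_normP hF; apply/filterlim_locally => r.
  have nx := norm_nonneg x; have hr := cond_pos r.
  have [d [hd h]] := hF (r / (norm x + 1)) ltac:(apply: Rdiv_lt_0_compat; lra).
  exists (mkposreal d hd) => s hs; have := h s hs => h1.
  change (Rabs (inner (F s) x - inner (F t) x) < r); rewrite -inner_minus.
  apply: Rle_lt_trans (cauchy_schwarz _ _) _.
  apply: (Rle_lt_trans _ (norm (minus (F s) (F t)) * (norm x + 1))).
  - apply: Rmult_le_compat_l; [exact: norm_nonneg | lra].
  - have -> : pos r = r / (norm x + 1) * (norm x + 1) by field; lra.
    apply: Rmult_lt_compat_r => //; lra.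
Qed.

Lemma continuous_sum_n (a : nat -> R -> H) n s : (forall k, continuous (a k) s) ->
  continuous (fun s => sum_n (fun k => a k s) n) s.
Proof.
  move=> h; elim: n => [|n IH].
  - apply: (continuous_ext (a 0%nat)) => // r; by rewrite sum_O.
  - apply: (continuous_ext (fun s => plus (sum_n (fun k => a k s) n) (a (S n) s))).
    + by move=> r; rewrite sum_Sn.
    + exact: continuous_plus.
Qed.

Lemma E_continuous F t s : continuous F s -> continuous (fun s => E (t - s) (F s)) s.
Proof.
  move=> cF; apply: (continuous_sum_n (a := fun k s => scal (chi Lam l k * (exp (- l k * (t - s)) * inner (F s) (e k))) (e k))) => k.
  apply: continuous_scal_l; apply: (continuous_scal_r (V := R_NormedModule)).
  apply: (continuous_mult (fun s => exp (- l k * (t - s))) (fun s => inner (F s) (e k))).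
  - apply: ex_derive_continuous; by auto_derive.
  - exact: continuous_inner_l.
Qed.

(** The mild formulation with a group in place of the semigroup, meaningful for [t < t0] too. *)
Definition pgroup F p t0 t :=
  is_RInt (fun s => E (t - s) (F s)) t0 t (minus (p t) (E (t - t0) (p t0))).

Lemma pgroup_derive F p : (forall s, continuous F s) -> (forall s, P (p s) = p s) ->
  (forall s, is_derive p s (minus (P (F s)) (AP (p s)))) -> forall t0 t, pgroup F p t0 t.
Proof.
  move=> cF hP hd t0 t; rewrite /pgroup.
  have {1}-> : p t = E (t - t) (p t) by rewrite Rminus_diag (E_zero sp) hP.
  apply: (is_RInt_derive (fun s => E (t - s) (p s))) => s _; last exact: E_continuous.
  have -> : E (t - s) (F s) = E (t - s) (plus (minus (P (F s)) (AP (p s))) (AP (p s))).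
  { rewrite -(E_P sp); congr (E _ _); vec. }
  exact: (E_derive sp).
Qed.

Lemma range_invariant (p : R -> H) (p' : R -> H) : (forall s, is_derive p s (p' s)) ->
  (forall s, P (p' s) = p' s) -> P (p 0) = p 0 -> forall t, P (p t) = p t.
Proof.
  move=> hd hp' h0 t.
  have d s : is_derive (fun s => coproj P (p s)) s zero.
  { have -> : zero = coproj P (p' s) by rewrite /coproj hp' minus_eq_zero.
    apply: derive_linear => //; exact: (Q_linear sp). }
  have Q0 : coproj P (p 0) = zero by rewrite /coproj h0 minus_eq_zero.
  have Qt : coproj P (p t) = zero.
  { case: (Rtotal_order 0 t) => [h | [<- // | h]].
    - by rewrite -Q0; symmetry; apply: (eq_is_derive (fun s => coproj P (p s))).
    - by rewrite -Q0; apply: (eq_is_derive (fun s => coproj P (p s))). }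
  symmetry; apply: minus_eq0; change (norm (coproj P (p t)) = 0); by rewrite Qt norm_zeroR.
Qed.

(** The equation is solved in all of [H], where its field is Lipschitz because [AP] is bounded; the
    field takes values in the range of [P], so the curve stays there. *)
Lemma pgroup_exists F M (p0 : H) : (forall s, continuous F s) -> (forall s, norm (F s) <= M) -> P p0 = p0 ->
  exists p, p 0 = p0 /\ (forall t, continuous p t) /\ (forall t, P (p t) = p t) /\
    forall t0 t, pgroup F p t0 t.
Proof.
  move=> cF hF hp0.
  have linAP : is_linear AP := mult_op_linear sp l.
  have [C [hC hb]] := linear_norm _ linAP.
  have [||| p [h0 hd]] := @picard _ (fun s x => minus (P (F s)) (AP x)) p0 C (M + norm (AP p0)).
  - move=> s x z.
    have -> : minus (minus (P (F s)) (AP x)) (minus (P (F s)) (AP z)) = opp (AP (minus x z))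
      by rewrite (lin_minus _ _ linAP); vec.
    rewrite norm_opp; exact: hb.
  - move=> x s; apply: continuous_minus; last exact: continuous_const.
    apply: continuous_linear => //; exact: (P_linear sp).
  - move=> s; apply: Rle_trans (norm_triangle_minus _ _) _; apply: Rplus_le_compat_r.
    apply: Rle_trans (P_norm sp _) _; exact: hF.
  - have hP : forall t, P (p t) = p t.
    { apply: (range_invariant hd); last by rewrite h0.
      move=> s; by rewrite (lin_minus _ _ (P_linear sp)) (P_idem sp) (AP_range sp). }
    exists p; split=> //; split; [ | split=> //].
    + move=> t; exact: derive_continuous (hd t).
    + exact: pgroup_derive.
Qed.

Context (b : R).
Hypothesis hb : forall k, l k <= Lam -> l k <= b.

(** Integration runs backward from 0. As [b < eta], the integral of
    [exp (- b (t - s)) exp (- eta s)] from [t] to 0 is at most [exp (- eta t) / (eta - b)]; unlike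
    for [u] and [q], the initial value remains. *)
Lemma pgroup_decay F p eta C t : b < eta -> 0 <= C -> t <= 0 -> pgroup F p 0 t ->
  (forall s, s <= 0 -> norm (F s) <= C * exp (- eta * s)) ->
  norm (p t) <= (norm (p 0) + C / (eta - b)) * exp (- eta * t).
Proof.
  move=> he hC ht hp hF.
  have hp' := is_RInt_swap _ _ _ _ hp.
  have hI := @is_RInt_exp (C * exp (- b * t)) (b - eta) t 0 ltac:(lra).
  have h1 := RInt_norm_le ht (g := fun s => C * exp (- b * t) * exp ((b - eta) * s)) _ hp' hI.
  rewrite norm_opp in h1.
  have h2 : norm (minus (p t) (E (t - 0) (p 0)))
    <= C * exp (- b * t) / (b - eta) * (exp ((b - eta) * 0) - exp ((b - eta) * t)).
  { apply: h1 => s hs; apply: Rle_trans (E_bound sp _ hb _) _; first lra.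
    apply: Rle_trans (Rmult_le_compat_l _ _ _ (Rlt_le _ _ (exp_pos _)) (hF s (proj2 hs))) _.
    right; have -> : exp (- b * (t - s)) * (C * exp (- eta * s)) = C * (exp (- b * (t - s)) * exp (- eta * s)) by ring.
    rewrite Rmult_assoc -!exp_plus; congr (_ * exp _); ring. }
  have h3 := norm_le_minus (p t) (E (t - 0) (p 0)).
  have h4 := E_bound sp (p 0) hb (t := t - 0) ltac:(lra).
  have h5 : exp (- b * (t - 0)) <= exp (- eta * t) by apply: exp_le; nra.
  have h6 : exp (- b * (t - 0)) * norm (p 0) <= exp (- eta * t) * norm (p 0)
    by apply: Rmult_le_compat_r => //; exact: norm_nonneg.
  have h7 : C * exp (- b * t) / (b - eta) * (exp ((b - eta) * 0) - exp ((b - eta) * t))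
    <= C / (eta - b) * exp (- eta * t).
  { have -> : exp (- eta * t) = exp (- b * t) * exp ((b - eta) * t) by rewrite -exp_plus; congr exp; ring.
    have -> : C * exp (- b * t) / (b - eta) * (exp ((b - eta) * 0) - exp ((b - eta) * t))
      = C / (eta - b) * (exp (- b * t) * exp ((b - eta) * t)) - C / (eta - b) * exp (- b * t).
    { rewrite Rmult_0_r exp_0; field; lra. }
    have := Rmult_le_pos _ _ (Rdiv_le_0_compat C (eta - b) hC ltac:(lra)) (Rlt_le _ _ (exp_pos (- b * t))).
    lra. }
  lra.
Qed.

Lemma pgroup_minus F1 F2 p1 p2 t0 t : pgroup F1 p1 t0 t -> pgroup F2 p2 t0 t ->
  pgroup (fun s => minus (F1 s) (F2 s)) (fun s => minus (p1 s) (p2 s)) t0 t.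
Proof.
  move=> h1 h2; rewrite /pgroup (lin_minus _ _ (E_linear sp _)).
  have -> : minus (minus (p1 t) (p2 t)) (minus (E (t - t0) (p1 t0)) (E (t - t0) (p2 t0)))
    = minus (minus (p1 t) (E (t - t0) (p1 t0))) (minus (p2 t) (E (t - t0) (p2 t0))) by vec.
  apply: (is_RInt_ext (fun s => minus (E (t - s) (F1 s)) (E (t - s) (F2 s)))).
  - move=> s _; by rewrite (lin_minus _ _ (E_linear sp _)).
  - exact: (is_RInt_minus _ _ _ _ _ _ h1 h2).
Qed.

Lemma pgroup_shift F p t0 t r : pgroup F p (t0 + r) (t + r) ->
  pgroup (fun s => F (s + r)) (fun s => p (s + r)) t0 t.
Proof.
  rewrite /pgroup => h; have E0 : t + r - (t0 + r) = t - t0 by ring.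
  rewrite E0 in h.
  apply: (is_RInt_ext (fun s => scal 1 (E (t + r - (1 * s + r)) (F (1 * s + r))))).
  - move=> s _; rewrite scal_one Rmult_1_l; congr (E _ _); ring.
  - apply: (is_RInt_comp_lin (fun s => E (t + r - s) (F s))); by rewrite !Rmult_1_l.
Qed.

Lemma pgroup_ext F1 F2 p1 p2 t0 t : (forall s, Rmin t0 t <= s <= Rmax t0 t -> F1 s = F2 s /\ p1 s = p2 s) ->
  pgroup F1 p1 t0 t -> pgroup F2 p2 t0 t.
Proof.
  move=> h hm; rewrite /pgroup -(proj2 (h t0 (conj (Rmin_l _ _) (Rmax_l _ _)))) -(proj2 (h t (conj (Rmin_r _ _) (Rmax_r _ _)))).
  apply: is_RInt_ext hm => s hs; by rewrite (proj1 (h s ltac:(lra))).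
Qed.

End SpectralGroup.

Section LyapunovPerron.
Context {X H : Hilbert} (SX : R -> X -> X) (SH : R -> H -> H) (aX aQ a b : R).
Context (A : operator H) (Lam : R) (P : H -> H) (e : nat -> H) (l : nat -> R) (N : nat).
Hypothesis hX : decaying SX aX.
Hypothesis hQ : decaying SH aQ.
Hypothesis QSH : forall t x, 0 <= t -> coproj P (SH t x) = SH t x.
Hypothesis sp : splitting A Lam P e l N.
Hypothesis hb : forall k, l k <= Lam -> l k <= b.
Hypothesis b0 : 0 <= b.
Hypothesis hab : b < a.
Hypothesis haX : a <= aX.
Hypothesis haQ : a <= aQ.
Context (f : X * H -> X) (g : X * H -> H) (Mf Mg L : R).
Hypothesis bf : forall w, norm (f w) <= Mf.
Hypothesis bg : forall w, norm (g w) <= Mg.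
Hypothesis L0 : 0 <= L.
Hypothesis lf : forall w z, dist (f w) (f z) <= L * dist_sum w z.
Hypothesis lg : forall w z, dist (g w) (g z) <= L * dist_sum w z.
Definition LPconst := 6 * L / (a - b).
Hypothesis hK : LPconst < 1.
Local Notation K := LPconst.

(* With the weight [exp (eta t)], [eta] the midpoint of the gap, each of the three Lyapunov-Perron integrals has
   Lipschitz constant [L / gam], [gam] being half the gap; hence the constant [LPconst = 3 L / gam]. *)
Definition eta := (a + b) / 2.
Definition gam := (a - b) / 2.

Definition wcurve (u : R -> X) (p q : R -> H) (s : R) : X * H := (u s, plus (p s) (q s)).

(* The curve [(u, p + q)] solves the linear problem with forcing [(F, G)] on nonpositive times; continuity is
   required at all times only to be able to use total functions, values at positive times being irrelevant. *)
Record solves (u : R -> X) (p q : R -> H) (F : R -> X) (G : R -> H) : Prop := {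
  sol_cu : forall t, continuous u t;
  sol_cp : forall t, continuous p t;
  sol_cq : forall t, continuous q t;
  sol_bu : forall t, t <= 0 -> norm (u t) <= Mf / aX;
  sol_bq : forall t, t <= 0 -> norm (q t) <= Mg / aQ;
  sol_P : forall t, t <= 0 -> P (p t) = p t;
  sol_Q : forall t, t <= 0 -> coproj P (q t) = q t;
  sol_u : forall t0 t, t0 <= t -> t <= 0 -> mild SX F u t0 t;
  sol_q : forall t0 t, t0 <= t -> t <= 0 -> mild SH G q t0 t;
  sol_p : forall t0 t, t0 <= 0 -> t <= 0 -> pgroup Lam e l N G p t0 t
}.

Definition traj u p q := solves u p q (fun s => f (wcurve u p q s)) (fun s => g (wcurve u p q s)).

Lemma aX_nonneg : 0 <= aX. Proof. lra. Qed.
Lemma aQ_nonneg : 0 <= aQ. Proof. lra. Qed.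
Lemma gam_pos : 0 < gam. Proof. rewrite /gam; lra. Qed.
Lemma eta_pos : 0 < eta. Proof. rewrite /eta; lra. Qed.
Lemma K_gam : K = 3 * L / gam. Proof. rewrite /LPconst /gam; field; lra. Qed.
Lemma K_nonneg : 0 <= K.
Proof. apply: Rdiv_le_0_compat; lra. Qed.
Lemma Mf_nonneg : 0 <= Mf.
Proof. apply: Rle_trans (bf (zero, zero)); exact: norm_nonneg. Qed.
Lemma Mg_nonneg : 0 <= Mg.
Proof. apply: Rle_trans (bg (zero, zero)); exact: norm_nonneg. Qed.

Lemma weight_ge1 s : s <= 0 -> 1 <= exp (- eta * s).
Proof. move=> hs; rewrite -exp_0; apply: exp_le; have := eta_pos; nra. Qed.

Lemma rate_le r C s : eta + gam <= r -> 0 <= C -> C / (r - eta) * exp (- eta * s) <= C / gam * exp (- eta * s).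
Proof.
  move=> hr hC; apply: Rmult_le_compat_r; first by left; apply: exp_pos.
  apply: Rmult_le_compat_l => //; apply: Rinv_le_contravar; [exact: gam_pos | lra].
Qed.

Lemma solves_diff u1 p1 q1 F1 G1 u2 p2 q2 F2 G2 C : 0 <= C ->
  solves u1 p1 q1 F1 G1 -> solves u2 p2 q2 F2 G2 ->
  (forall s, s <= 0 -> norm (minus (F1 s) (F2 s)) <= C * exp (- eta * s)) ->
  (forall s, s <= 0 -> norm (minus (G1 s) (G2 s)) <= C * exp (- eta * s)) ->
  forall t, t <= 0 ->
    norm (minus (u1 t) (u2 t)) <= C / gam * exp (- eta * t) /\
    norm (minus (p1 t) (p2 t)) <= (norm (minus (p1 0) (p2 0)) + C / gam) * exp (- eta * t) /\
    norm (minus (q1 t) (q2 t)) <= C / gam * exp (- eta * t).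
Proof.
  move=> hC s1 s2 hF hG t ht; split; [ | split].
  - apply: Rle_trans (rate_le (r := aX) t _ hC); last by rewrite /eta /gam; lra.
    apply: (mild_decay hX aX_nonneg (F := fun s => minus (F1 s) (F2 s)) (u := fun s => minus (u1 s) (u2 s))
             (B := Mf / aX + Mf / aX)) => //; rewrite ?/eta; try lra.
    + move=> t0 t1 h1 h2; apply: (mild_minus hX) => //; [exact: (sol_u s1) | exact: (sol_u s2)].
    + move=> r hr; apply: Rle_trans (norm_triangle_minus _ _) _.
      apply: Rplus_le_compat; [exact: (sol_bu s1) | exact: (sol_bu s2)].
  - have -> : gam = eta - b by rewrite /gam /eta; field.
    apply: (pgroup_decay sp hb (F := fun s => minus (G1 s) (G2 s)) (p := fun s => minus (p1 s) (p2 s))) => //.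
    + rewrite /eta; lra.
    + apply: (pgroup_minus sp); [apply: (sol_p s1) | apply: (sol_p s2)]; lra.
  - apply: Rle_trans (rate_le (r := aQ) t _ hC); last by rewrite /eta /gam; lra.
    apply: (mild_decay hQ aQ_nonneg (F := fun s => minus (G1 s) (G2 s)) (u := fun s => minus (q1 s) (q2 s))
             (B := Mg / aQ + Mg / aQ)) => //; rewrite ?/eta; try lra.
    + move=> t0 t1 h1 h2; apply: (mild_minus hQ) => //; [exact: (sol_q s1) | exact: (sol_q s2)].
    + move=> r hr; apply: Rle_trans (norm_triangle_minus _ _) _.
      apply: Rplus_le_compat; [exact: (sol_bq s1) | exact: (sol_bq s2)].
Qed.

Definition gap3 (u1 u2 : R -> X) (p1 p2 q1 q2 : R -> H) t :=
  norm (minus (u1 t) (u2 t)) + norm (minus (p1 t) (p2 t)) + norm (minus (q1 t) (q2 t)).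

Lemma wcurve_dist u1 u2 p1 p2 q1 q2 t :
  dist_sum (wcurve u1 p1 q1 t) (wcurve u2 p2 q2 t) <= gap3 u1 u2 p1 p2 q1 q2 t.
Proof.
  change (norm (minus (u1 t) (u2 t)) + norm (minus (plus (p1 t) (q1 t)) (plus (p2 t) (q2 t)))
    <= gap3 u1 u2 p1 p2 q1 q2 t).
  rewrite /gap3.
  have E : minus (plus (p1 t) (q1 t)) (plus (p2 t) (q2 t))
    = plus (minus (p1 t) (p2 t)) (minus (q1 t) (q2 t)) by vec.
  have := norm_split E; lra.
Qed.

Lemma f_diff u1 u2 p1 p2 q1 q2 t :
  norm (minus (f (wcurve u1 p1 q1 t)) (f (wcurve u2 p2 q2 t))) <= L * gap3 u1 u2 p1 p2 q1 q2 t.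
Proof. apply: Rle_trans (lf _ _) _; apply: Rmult_le_compat_l => //; exact: wcurve_dist. Qed.

Lemma g_diff u1 u2 p1 p2 q1 q2 t :
  norm (minus (g (wcurve u1 p1 q1 t)) (g (wcurve u2 p2 q2 t))) <= L * gap3 u1 u2 p1 p2 q1 q2 t.
Proof. apply: Rle_trans (lg _ _) _; apply: Rmult_le_compat_l => //; exact: wcurve_dist. Qed.

(** Only [p] carries an initial value; each component contributes [L c / gam], and the three
    together [K c]. *)
Lemma contraction_step u1 p1 q1 u2 p2 q2 v1 r1 s1 v2 r2 s2 c :
  0 <= c ->
  solves v1 r1 s1 (fun s => f (wcurve u1 p1 q1 s)) (fun s => g (wcurve u1 p1 q1 s)) ->
  solves v2 r2 s2 (fun s => f (wcurve u2 p2 q2 s)) (fun s => g (wcurve u2 p2 q2 s)) ->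
  (forall t, t <= 0 -> gap3 u1 u2 p1 p2 q1 q2 t <= c * exp (- eta * t)) ->
  forall t, t <= 0 -> gap3 v1 v2 r1 r2 s1 s2 t <= (norm (minus (r1 0) (r2 0)) + K * c) * exp (- eta * t).
Proof.
  move=> hc h1 h2 hg t ht.
  have Lc : 0 <= L * c by apply: Rmult_le_pos.
  have hF s : s <= 0 -> norm (minus (f (wcurve u1 p1 q1 s)) (f (wcurve u2 p2 q2 s))) <= L * c * exp (- eta * s).
  { move=> hs; apply: Rle_trans (f_diff _ _ _ _ _ _ _) _; rewrite Rmult_assoc; apply: Rmult_le_compat_l => //; exact: hg. }
  have hG s : s <= 0 -> norm (minus (g (wcurve u1 p1 q1 s)) (g (wcurve u2 p2 q2 s))) <= L * c * exp (- eta * s).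
  { move=> hs; apply: Rle_trans (g_diff _ _ _ _ _ _ _) _; rewrite Rmult_assoc; apply: Rmult_le_compat_l => //; exact: hg. }
  have [k1 [k2 k3]] := solves_diff Lc h1 h2 hF hG ht.
  rewrite /gap3 K_gam.
  have -> : (norm (minus (r1 0) (r2 0)) + 3 * L / gam * c) * exp (- eta * t)
    = L * c / gam * exp (- eta * t) + (norm (minus (r1 0) (r2 0)) + L * c / gam) * exp (- eta * t)
      + L * c / gam * exp (- eta * t) by field; have := gam_pos; lra.
  lra.
Qed.

(** Forcings differ by at most [2 (Mf + Mg)], and each of the three integrals contributes the factor
    [1 / gam]. This is the a priori finite distance from which the contraction is iterated. *)
Definition crude_const := 6 * (Mf + Mg) / gam.

Lemma crude_const_nonneg : 0 <= crude_const.
Proof. apply: Rdiv_le_0_compat; [have := Mf_nonneg; have := Mg_nonneg; lra | exact: gam_pos]. Qed.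

Lemma crude_gap v1 r1 s1 v2 r2 s2 F1 G1 F2 G2 :
  solves v1 r1 s1 F1 G1 -> solves v2 r2 s2 F2 G2 ->
  (forall s, norm (F1 s) <= Mf) -> (forall s, norm (F2 s) <= Mf) ->
  (forall s, norm (G1 s) <= Mg) -> (forall s, norm (G2 s) <= Mg) ->
  forall t, t <= 0 -> gap3 v1 v2 r1 r2 s1 s2 t <= (norm (minus (r1 0) (r2 0)) + crude_const) * exp (- eta * t).
Proof.
  move=> h1 h2 b1 b2 b3 b4 t ht.
  have m1 := Mf_nonneg; have m2 := Mg_nonneg.
  have bd (V : Hilbert) (x y : V) M s : s <= 0 -> norm x <= M -> norm y <= M -> M <= Mf + Mg ->
    norm (minus x y) <= 2 * (Mf + Mg) * exp (- eta * s).
  { move=> hs hx hy hM; have := norm_triangle_minus x y; have := weight_ge1 hs; nra. }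
  have [k1 [k2 k3]] := solves_diff (C := 2 * (Mf + Mg)) ltac:(lra) h1 h2
    (fun s hs => bd X _ _ Mf s hs (b1 s) (b2 s) ltac:(lra))
    (fun s hs => bd H _ _ Mg s hs (b3 s) (b4 s) ltac:(lra)) ht.
  rewrite /gap3.
  have -> : (norm (minus (r1 0) (r2 0)) + crude_const) * exp (- eta * t)
    = 2 * (Mf + Mg) / gam * exp (- eta * t) + (norm (minus (r1 0) (r2 0)) + 2 * (Mf + Mg) / gam) * exp (- eta * t)
      + 2 * (Mf + Mg) / gam * exp (- eta * t) by rewrite /crude_const; field; have := gam_pos; lra.
  lra.
Qed.

Lemma le_of_geometric x y c k : 0 <= k < 1 -> (forall n, x <= y + c * k ^ n) -> x <= y.
Proof.
  move=> hk h; apply: le_epsilon => r hr.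
  have /is_lim_seq_spec hl := pow_lim0 c hk.
  have [n hn] := hl (mkposreal r hr).
  have := hn n (Nat.le_refl n); rewrite Rminus_0_r /= => /Rabs_def2 [h1 _].
  have := h n; lra.
Qed.

(* A bound [c exp (- eta t)] on the distance improves to [(d + K c) exp (- eta t)], [d] the distance of the [p] components
   at time 0; iterate. *)
Lemma traj_gap u1 p1 q1 u2 p2 q2 : traj u1 p1 q1 -> traj u2 p2 q2 ->
  forall t, t <= 0 -> gap3 u1 u2 p1 p2 q1 q2 t <= norm (minus (p1 0) (p2 0)) / (1 - K) * exp (- eta * t).
Proof.
  move=> h1 h2 t ht; set d := norm (minus (p1 0) (p2 0)).
  have d0 : 0 <= d by exact: norm_nonneg.
  have k0 := K_nonneg; have c0 := crude_const_nonneg.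
  have key n : forall t, t <= 0 -> gap3 u1 u2 p1 p2 q1 q2 t <= (d / (1 - K) + (d + crude_const) * K ^ n) * exp (- eta * t).
  { elim: n => [|n IH] s hs.
    - have hd : 0 <= d / (1 - K) by apply: Rdiv_le_0_compat; lra.
      apply: Rle_trans (crude_gap h1 h2 _ _ _ _ hs) _ => //.
      apply: Rmult_le_compat_r; [left; exact: exp_pos | rewrite -/d /=; lra].
    - have hc : 0 <= d / (1 - K) + (d + crude_const) * K ^ n.
      { apply: Rplus_le_le_0_compat; first by apply: Rdiv_le_0_compat; lra.
        apply: Rmult_le_pos; [lra | exact: pow_le]. }
      apply: Rle_trans (contraction_step hc h1 h2 IH hs) _.
      right; rewrite -/d /=; field; lra. }
  apply: (@le_of_geometric _ _ ((d + crude_const) * exp (- eta * t)) K) => // n.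
  apply: Rle_trans (key n t ht) _; right; ring.
Qed.

Lemma traj_unique u1 p1 q1 u2 p2 q2 : traj u1 p1 q1 -> traj u2 p2 q2 -> p1 0 = p2 0 ->
  forall t, t <= 0 -> u1 t = u2 t /\ p1 t = p2 t /\ q1 t = q2 t.
Proof.
  move=> h1 h2 h0 t ht; have := traj_gap h1 h2 ht.
  rewrite h0 minus_eq_zero norm_zeroR /Rdiv !Rmult_0_l /gap3.
  have n1 := norm_nonneg (minus (u1 t) (u2 t)); have n2 := norm_nonneg (minus (p1 t) (p2 t)).
  have n3 := norm_nonneg (minus (q1 t) (q2 t)).
  move=> h; split; [ | split]; apply: minus_eq0; lra.
Qed.

Lemma solves_ext u p q F1 G1 F2 G2 : (forall s, s <= 0 -> F1 s = F2 s /\ G1 s = G2 s) ->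
  solves u p q F1 G1 -> solves u p q F2 G2.
Proof.
  move=> h [c1 c2 c3 h1 h2 h3 h4 h5 h6 h7]; split=> //.
  - move=> t0 t h0 ht; apply: (mild_ext h0 _ (h5 t0 t h0 ht)) => s hs; split=> //.
    apply: (proj1 (h s _)); lra.
  - move=> t0 t h0 ht; apply: (mild_ext h0 _ (h6 t0 t h0 ht)) => s hs; split=> //.
    apply: (proj2 (h s _)); lra.
  - move=> t0 t h0 ht; apply: pgroup_ext (h7 t0 t h0 ht) => s hs; split=> //.
    apply: (proj2 (h s _)); have := Rmax_lub _ _ _ h0 ht; lra.
Qed.

Lemma traj_shift u p q r : r <= 0 -> traj u p q ->
  traj (fun s => u (s + r)) (fun s => p (s + r)) (fun s => q (s + r)).
Proof.
  move=> hr [c1 c2 c3 h1 h2 h3 h4 h5 h6 h7].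
  have cs (V : Hilbert) (v : R -> V) t : (forall t, continuous v t) -> continuous (fun s => v (s + r)) t.
  { move=> cv; apply: (continuous_comp (fun s => s + r) v); last exact: cv.
    apply: ex_derive_continuous; by auto_derive. }
  split.
  - move=> t; exact: cs.
  - move=> t; exact: cs.
  - move=> t; exact: cs.
  - move=> t ht; apply: h1; lra.
  - move=> t ht; apply: h2; lra.
  - move=> t ht; apply: h3; lra.
  - move=> t ht; apply: h4; lra.
  - move=> t0 t h0 ht; apply: (mild_shift (F := fun s => f (wcurve u p q s)) (u := u)); apply: h5; lra.
  - move=> t0 t h0 ht; apply: (mild_shift (F := fun s => g (wcurve u p q s)) (u := q)); apply: h6; lra.
  - move=> t0 t h0 ht; apply: (pgroup_shift (F := fun s => g (wcurve u p q s)) (p := p)); apply: h7; lra.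
Qed.

(** Estimates hold for [t <= 0] only, whereas limits of curves are taken on all of [R]; keeping the
    value at 0 for positive times reconciles the two. *)
Definition frozen {V : Hilbert} (v : R -> V) := forall t, v t = v (Rmin t 0).

Lemma Rmin0_continuous t : continuous (fun s => Rmin s 0) t.
Proof.
  apply/(filterlim_locally (F := locally t)) => r; exists r => s hs.
  have : Rabs (s - t) < r := hs.
  change (Rabs (s - t) < r -> Rabs (Rmin s 0 - Rmin t 0) < r).
  unfold Rmin; destruct (Rle_dec s 0), (Rle_dec t 0); unfold Rabs; repeat destruct Rcase_abs; lra.
Qed.

Lemma freeze {V : Hilbert} (v : R -> V) : (forall t, continuous v t) ->
  (forall t, continuous (fun s => v (Rmin s 0)) t) /\ frozen (fun s => v (Rmin s 0)) /\
  forall t, t <= 0 -> v (Rmin t 0) = v t.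
Proof.
  move=> cv; split; [ | split].
  - move=> t; apply: (continuous_comp (fun s => Rmin s 0) v); [exact: Rmin0_continuous | exact: cv].
  - move=> t; rewrite (Rmin_left (Rmin t 0) 0) //; exact: Rmin_r.
  - by move=> t ht; rewrite Rmin_left.
Qed.

Lemma solver p0 (F : R -> X) (G : R -> H) : P p0 = p0 ->
  (forall s, continuous F s) -> (forall s, continuous G s) ->
  (forall s, norm (F s) <= Mf) -> (forall s, norm (G s) <= Mg) ->
  exists u p q, solves u p q F G /\ p 0 = p0 /\ frozen u /\ frozen p /\ frozen q.
Proof.
  move=> hp0 cF cG bF bG.
  have [u [cu [bu mu]]] := bounded_solution hX ltac:(lra) ltac:(lra) cF bF.
  have [q [cq [bq mq]]] := bounded_solution hQ ltac:(lra) ltac:(lra) cG bG.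
  have [p [hp [cp [Pp mp]]]] := pgroup_exists sp cG bG hp0.
  have [fu1 [fu2 fu3]] := freeze cu; have [fp1 [fp2 fp3]] := freeze cp; have [fq1 [fq2 fq3]] := freeze cq.
  exists (fun s => u (Rmin s 0)), (fun s => p (Rmin s 0)), (fun s => q (Rmin s 0)); split.
  - split=> //.
    + move=> t ht; rewrite fq3 //.
      by rewrite (mild_point (mq t t (Rle_refl t))) QSH //; apply: Rle_refl.
    + move=> t0 t h0 ht; apply: (mild_ext h0 _ (mu t0 t h0)) => s hs; split=> //; rewrite fu3 //; lra.
    + move=> t0 t h0 ht; apply: (mild_ext h0 _ (mq t0 t h0)) => s hs; split=> //; rewrite fq3 //; lra.
    + move=> t0 t h0 ht; apply: pgroup_ext (mp t0 t) => s hs; split=> //; rewrite fp3 //.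
      have := Rmax_lub _ _ _ h0 ht; lra.
  - by rewrite Rmin_left; [ | exact: Rle_refl].
Qed.

Lemma wcurve_continuous_f u p q s : (forall t, continuous u t) -> (forall t, continuous p t) -> (forall t, continuous q t) ->
  continuous (fun s => f (wcurve u p q s)) s /\ continuous (fun s => g (wcurve u p q s)) s.
Proof.
  move=> cu cp cq.
  have key (V : Hilbert) (h : X * H -> V) : (forall w z, dist (h w) (h z) <= L * dist_sum w z) ->
    continuous (fun s => h (wcurve u p q s)) s.
  { move=> lh; apply: (continuous_dominated (k := fun t => L * gap3 u (fun _ => u s) p (fun _ => p s) q (fun _ => q s) t)).
    - apply: (continuous_scal_r (V := R_NormedModule)).
      apply: (continuous_plus (V := R_NormedModule)); last exact: continuous_dist.
      apply: (continuous_plus (V := R_NormedModule)); exact: continuous_dist.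
    - rewrite /gap3 !minus_eq_zero !norm_zeroR; ring.
    - move=> t; apply: Rle_trans (lh _ _) _; apply: Rmult_le_compat_l => //.
      exact: (wcurve_dist u (fun _ => u s) p (fun _ => p s) q (fun _ => q s)). }
  by split; apply: key.
Qed.

Record curves := { st_u : R -> X; st_p : R -> H; st_q : R -> H }.
Definition st_cont (x : curves) := (forall t, continuous (st_u x) t) /\ (forall t, continuous (st_p x) t) /\
  (forall t, continuous (st_q x) t).
Definition st_frozen (x : curves) := frozen (st_u x) /\ frozen (st_p x) /\ frozen (st_q x).
(** One step of the Lyapunov-Perron map, as a relation: [y] solves the linear problem whose forcing
    is read along [x]. *)
Definition st_step p0 (x y : curves) :=
  solves (st_u y) (st_p y) (st_q y) (fun s => f (wcurve (st_u x) (st_p x) (st_q x) s))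
    (fun s => g (wcurve (st_u x) (st_p x) (st_q x) s)) /\ st_p y 0 = p0 /\ st_frozen y.

Lemma step_exists p0 x : P p0 = p0 -> st_cont x -> exists y, st_step p0 x y.
Proof.
  move=> hp0 [cu [cp cq]].
  have [|||| u [p [q [h1 [h2 h3]]]]] := @solver p0 (fun s => f (wcurve (st_u x) (st_p x) (st_q x) s))
    (fun s => g (wcurve (st_u x) (st_p x) (st_q x) s)) hp0.
  - move=> s; exact: (proj1 (wcurve_continuous_f s cu cp cq)).
  - move=> s; exact: (proj2 (wcurve_continuous_f s cu cp cq)).
  - move=> s; exact: bf.
  - move=> s; exact: bg.
  - by exists {| st_u := u; st_p := p; st_q := q |}.
Qed.

Lemma st_step_cont p0 x y : st_step p0 x y -> st_cont y.
Proof. move=> [[c1 c2 c3 _ _ _ _ _ _ _] _]; by split; [ | split]. Qed.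

Definition st_gap x y := gap3 (st_u x) (st_u y) (st_p x) (st_p y) (st_q x) (st_q y).

Lemma traj_exists p0 : P p0 = p0 -> exists u p q, traj u p q /\ p 0 = p0.
Proof.
  move=> hp0.
  have [F hF] : exists F : curves -> curves, forall x, st_cont x -> st_step p0 x (F x).
  { apply: (@choose _ _ (fun x y => st_cont x -> st_step p0 x y)) => x.
    case: (classic (st_cont x)) => h; last by exists x.
    have [y hy] := step_exists hp0 h; by exists y. }
  pose x0 := {| st_u := fun _ => zero; st_p := fun _ => zero; st_q := fun _ => zero |}.
  (* The sequence begins with [F x0]: [x0] is not itself the output of a step, and [crude_gap]
     compares outputs only. *)
  pose x := fix x n := match n with O => F x0 | S n => F (x n) end.
  have c0 : st_cont x0 by split; [ | split] => t; apply: continuous_const.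
  have cx n : st_cont (x n).
  { elim: n => [|n IH]; apply: (st_step_cont (p0 := p0)); apply: hF => //. }
  have step n : st_step p0 (x n) (x (S n)) := hF (x n) (cx n).
  have k0 := K_nonneg; have cc := crude_const_nonneg.
  have gap0 n t : t <= 0 -> st_gap (x (S n)) (x n) t <= crude_const * K ^ n * exp (- eta * t).
  { elim: n t => [|n IH] t ht.
    - have [s1 [e1 _]] := step 0%nat; have [s0 [e0 _]] := hF x0 c0.
      have := crude_gap s1 s0 (fun s => bf _) (fun s => bf _) (fun s => bg _) (fun s => bg _) ht.
      rewrite e1 e0 minus_eq_zero norm_zeroR /= Rplus_0_l Rmult_1_r; by apply.
    - have [s1 [e1 _]] := step (S n); have [s0 [e0 _]] := step n.
      have hc : 0 <= crude_const * K ^ n by apply: Rmult_le_pos => //; exact: pow_le.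
      have := contraction_step hc s1 s0 IH ht.
      rewrite e1 e0 minus_eq_zero norm_zeroR Rplus_0_l => h; apply: Rle_trans h _.
      right; rewrite /=; ring. }
  pose W s := exp (- eta * Rmin s 0).
  have cW s : continuous W s.
  { apply: (continuous_comp (fun s => Rmin s 0) (fun r => exp (- eta * r))); first exact: Rmin0_continuous.
    apply: ex_derive_continuous; by auto_derive. }
  have fr n : st_frozen (x n).
  { case: n => [|n]; [exact: (proj2 (proj2 (hF x0 c0))) | exact: (proj2 (proj2 (step n)))]. }
  have hK' : 0 <= K < 1 by [].
  have gapW n s : st_gap (x (S n)) (x n) (Rmin s 0) <= crude_const * K ^ n * W s := gap0 n _ (Rmin_r _ _).
  rewrite /st_gap /gap3 in gapW.
  have dU n s : norm (minus (st_u (x (S n)) s) (st_u (x n) s)) <= crude_const * K ^ n * W s.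
  { rewrite (proj1 (fr (S n)) s) (proj1 (fr n) s); apply: Rle_trans (gapW n s).
    have := norm_nonneg (minus (st_p (x (S n)) (Rmin s 0)) (st_p (x n) (Rmin s 0))).
    have := norm_nonneg (minus (st_q (x (S n)) (Rmin s 0)) (st_q (x n) (Rmin s 0))); lra. }
  have dP n s : norm (minus (st_p (x (S n)) s) (st_p (x n) s)) <= crude_const * K ^ n * W s.
  { rewrite (proj1 (proj2 (fr (S n))) s) (proj1 (proj2 (fr n)) s); apply: Rle_trans (gapW n s).
    have := norm_nonneg (minus (st_u (x (S n)) (Rmin s 0)) (st_u (x n) (Rmin s 0))).
    have := norm_nonneg (minus (st_q (x (S n)) (Rmin s 0)) (st_q (x n) (Rmin s 0))); lra. }
  have dQ n s : norm (minus (st_q (x (S n)) s) (st_q (x n) s)) <= crude_const * K ^ n * W s.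
  { rewrite (proj2 (proj2 (fr (S n))) s) (proj2 (proj2 (fr n)) s); apply: Rle_trans (gapW n s).
    have := norm_nonneg (minus (st_u (x (S n)) (Rmin s 0)) (st_u (x n) (Rmin s 0))).
    have := norm_nonneg (minus (st_p (x (S n)) (Rmin s 0)) (st_p (x n) (Rmin s 0))); lra. }
  have [u [cu hu]] := @weighted_limit X (fun n => st_u (x n)) W crude_const K hK' (fun n => proj1 (cx n)) cW dU.
  have [p [cp hp]] := @weighted_limit H (fun n => st_p (x n)) W crude_const K hK' (fun n => proj1 (proj2 (cx n))) cW dP.
  have [q [cq hq]] := @weighted_limit H (fun n => st_q (x n)) W crude_const K hK' (fun n => proj2 (proj2 (cx n))) cW dQ.
  pose z := {| st_u := u; st_p := p; st_q := q |}.
  have cz : st_cont z by split; [ | split].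
  have [sz [ez _]] := hF z cz.
  have dz n t : t <= 0 -> st_gap z (x n) t <= 3 * (crude_const / (1 - K)) * K ^ n * exp (- eta * t).
  { move=> ht; have h1 := hu n t; have h2 := hp n t; have h3 := hq n t.
    have EW : W t = exp (- eta * t) by rewrite /W Rmin_left.
    rewrite EW in h1 h2 h3; rewrite /st_gap /gap3 /=; lra. }
  (* The limit [z] is so far only continuous. It is a fixed point on nonpositive times because [z]
     and [F z] are both geometrically close to [x (S n)]. *)
  have zF t : t <= 0 -> u t = st_u (F z) t /\ p t = st_p (F z) t /\ q t = st_q (F z) t.
  { move=> ht.
    have c3 : 0 <= 3 * (crude_const / (1 - K)) by apply: Rmult_le_pos; [lra | apply: Rdiv_le_0_compat; lra].
    have dF n : st_gap (F z) (x (S n)) t <= 3 * (crude_const / (1 - K)) * K ^ S n * exp (- eta * t).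
    { have [s0 [e0 _]] := step n.
      have hc : 0 <= 3 * (crude_const / (1 - K)) * K ^ n by apply: Rmult_le_pos => //; exact: pow_le.
      have := contraction_step hc sz s0 (dz n) ht.
      rewrite ez e0 minus_eq_zero norm_zeroR Rplus_0_l => h; apply: Rle_trans h _.
      right; rewrite /=; ring. }
    have G0 : st_gap z (F z) t <= 0.
    { apply: (@le_of_geometric _ _ (6 * (crude_const / (1 - K)) * K * exp (- eta * t)) K) => // n.
      have h1 := dz (S n) t ht; have h2 := dF n.
      have t1 := norm_minus_trans (st_u (x (S n)) t) (u t) (st_u (F z) t).
      have t2 := norm_minus_trans (st_p (x (S n)) t) (p t) (st_p (F z) t).
      have t3 := norm_minus_trans (st_q (x (S n)) t) (q t) (st_q (F z) t).
      rewrite (norm_minus_sym (st_u (x (S n)) t) (st_u (F z) t)) in t1.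
      rewrite (norm_minus_sym (st_p (x (S n)) t) (st_p (F z) t)) in t2.
      rewrite (norm_minus_sym (st_q (x (S n)) t) (st_q (F z) t)) in t3.
      have E1 : K ^ S n = K * K ^ n by [].
      rewrite E1 in h1 h2; move: (x (S n)) h1 h2 t1 t2 t3 => y h1 h2 t1 t2 t3.
      rewrite /st_gap /gap3 /= in h1 h2 *; lra. }
    rewrite /st_gap /gap3 /= in G0.
    have n1 := norm_nonneg (minus (u t) (st_u (F z) t)); have n2 := norm_nonneg (minus (p t) (st_p (F z) t)).
    have n3 := norm_nonneg (minus (q t) (st_q (F z) t)).
    split; [ | split]; apply: minus_eq0; lra. }
  (* [F z], unlike [z], satisfies the integral equations by construction; as it agrees with [z] for
     [t <= 0], its forcing may be read along itself. *)
  exists (st_u (F z)), (st_p (F z)), (st_q (F z)); split=> //.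
  apply: solves_ext sz => s hs; have [E1 [E2 E3]] := zF s hs.
  by rewrite /wcurve /= E1 E2 E3.
Qed.

(* The graph maps are the values at time 0 of the trajectory through [P x]. *)
Lemma graph_exists : exists (hu : H -> X) (hq : H -> H),
  (forall u p q, traj u p q -> forall t, t <= 0 -> u t = hu (p t) /\ q t = hq (p t)) /\
  (forall x, norm (hu x) <= Mf / aX) /\ (forall x, norm (hq x) <= Mg / aQ) /\
  (forall x, coproj P (hq x) = hq x) /\
  (forall x y, norm (minus (hu x) (hu y)) <= L / gam / (1 - K) * norm (minus (P x) (P y))) /\
  (forall x y, norm (minus (hq x) (hq y)) <= L / gam / (1 - K) * norm (minus (P x) (P y))).
Proof.
  have [Z hZ] : exists Z : H -> curves, forall x, traj (st_u (Z x)) (st_p (Z x)) (st_q (Z x)) /\ st_p (Z x) 0 = P x.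
  { apply: (@choose _ _ (fun x z => traj (st_u z) (st_p z) (st_q z) /\ st_p z 0 = P x)) => x.
    have [u [p [q [h1 h2]]]] := traj_exists (P_idem sp x).
    by exists {| st_u := u; st_p := p; st_q := q |}. }
  have z0 : 0 <= 0 by exact: Rle_refl.
  have lips x y : norm (minus (st_u (Z x) 0) (st_u (Z y) 0)) <= L / gam / (1 - K) * norm (minus (P x) (P y)) /\
     norm (minus (st_q (Z x) 0) (st_q (Z y) 0)) <= L / gam / (1 - K) * norm (minus (P x) (P y)).
  { have [h1 e1] := hZ x; have [h2 e2] := hZ y.
    set d := norm (minus (P x) (P y)).
    have d0 : 0 <= d by exact: norm_nonneg.
    (* The weighted distance of the two trajectories is at most [d / (1 - K)]; one more use of the
       linear estimate gains [L / gam] for [u] and [q], which have no initial term. *)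
    have hc : 0 <= L * (d / (1 - K)) by apply: Rmult_le_pos => //; apply: Rdiv_le_0_compat; lra.
    have gp s : s <= 0 -> gap3 (st_u (Z x)) (st_u (Z y)) (st_p (Z x)) (st_p (Z y)) (st_q (Z x)) (st_q (Z y)) s
       <= d / (1 - K) * exp (- eta * s).
    { move=> hs; have := traj_gap h1 h2 hs; by rewrite e1 e2. }
    have [k1 [_ k3]] := solves_diff hc h1 h2
      (fun s hs => Rle_trans _ _ _ (f_diff _ _ _ _ _ _ _) (Rle_trans _ _ _ (Rmult_le_compat_l _ _ _ L0 (gp s hs))
         (Req_le _ _ (eq_sym (Rmult_assoc _ _ _)))))
      (fun s hs => Rle_trans _ _ _ (g_diff _ _ _ _ _ _ _) (Rle_trans _ _ _ (Rmult_le_compat_l _ _ _ L0 (gp s hs))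
         (Req_le _ _ (eq_sym (Rmult_assoc _ _ _))))) z0.
    rewrite Rmult_0_r exp_0 Rmult_1_r in k1 k3.
    have E : L / gam / (1 - K) * d = L * (d / (1 - K)) / gam by field; have := gam_pos; lra.
    by rewrite E. }
  exists (fun x => st_u (Z x) 0), (fun x => st_q (Z x) 0); split; [ | split; [ | split; [ | split; [ | split]]]].
  (* The trajectory shifted by [t] has [p t] as its [p] component at time 0, so by uniqueness it is
     the one that defines the graph over [p t]. *)
  - move=> u p q ht t h0; have [h1 e1] := hZ (p t).
    have h2 := traj_shift h0 ht.
    have E0 : p (0 + t) = st_p (Z (p t)) 0 by rewrite e1 Rplus_0_l (sol_P ht).
    have [E1 [_ E3]] := traj_unique h2 h1 E0 z0.
    by rewrite Rplus_0_l in E1 E3.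
  - move=> x; exact: (sol_bu (proj1 (hZ x))).
  - move=> x; exact: (sol_bq (proj1 (hZ x))).
  - move=> x; exact: (sol_Q (proj1 (hZ x))).
  - move=> x y; exact: (proj1 (lips x y)).
  - move=> x y; exact: (proj2 (lips x y)).
Qed.

End LyapunovPerron.

(** * The reduced flow *)

Section Uniqueness.

(** Forward in time [exp (- 2 C s) |y - z|^2] is nonincreasing; the backward case follows by time
    reversal, which keeps the Lipschitz constant. *)
Lemma ode_unique {H : Hilbert} (B : H -> H) (C : R) (y z : R -> H) :
  (forall x x', norm (minus (B x) (B x')) <= C * norm (minus x x')) ->
  (forall t, is_derive y t (B (y t))) -> (forall t, is_derive z t (B (z t))) ->
  y 0 = z 0 -> forall t, y t = z t.
Proof.
  move=> hB hy hz h0.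
  have forward (B' : H -> H) (y' z' : R -> H) t :
    (forall x x', norm (minus (B' x) (B' x')) <= C * norm (minus x x')) ->
    (forall t, is_derive y' t (B' (y' t))) -> (forall t, is_derive z' t (B' (z' t))) ->
    y' 0 = z' 0 -> 0 <= t -> y' t = z' t.
  { move=> hB' hy' hz' h0' ht.
    pose w s := minus (y' s) (z' s).
    pose F s := exp (- (2 * C) * s) * inner (w s) (w s).
    pose dw s := minus (B' (y' s)) (B' (z' s)).
    have d s : is_derive w s (dw s) by apply: derive_minus.
    have dF s : is_derive F s (exp (- (2 * C) * s) * (2 * inner (dw s) (w s) - 2 * C * inner (w s) (w s))).
    { have -> : exp (- (2 * C) * s) * (2 * inner (dw s) (w s) - 2 * C * inner (w s) (w s))
        = plus (mult (- (2 * C) * exp (- (2 * C) * s)) (inner (w s) (w s)))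
               (mult (exp (- (2 * C) * s)) (inner (dw s) (w s) + inner (w s) (dw s))).
      { rewrite /plus /mult /= (inner_sym (w s) (dw s)); ring. }
      apply: (is_derive_mult (fun s => exp (- (2 * C) * s)) (fun s => inner (w s) (w s))).
      - auto_derive => //; ring.
      - exact: derive_inner.
      - exact: Rmult_comm. }
    have h : F t - F 0 <= 0 * (t - 0).
    { apply: (@mvt_le F (fun s => exp (- (2 * C) * s) * (2 * inner (dw s) (w s) - 2 * C * inner (w s) (w s)))) => //.
      - move=> s _; apply: ex_derive_continuous; eexists; exact: dF.
      - move=> s hs; have k1 := inner_le (dw s) (w s); have k2 := hB' (y' s) (z' s).
        have k3 := Rmult_le_compat_r _ _ _ (norm_nonneg (w s)) k2.
        have : 2 * inner (dw s) (w s) - 2 * C * inner (w s) (w s) <= 0.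
        { rewrite inner_norm /dw /w in k1 k3 *; lra. }
        have := exp_pos (- (2 * C) * s); nra. }
    have F0 : F 0 = 0 by rewrite /F /w h0' minus_eq_zero inner_zero Rmult_0_r.
    apply: minus_eq0; change (norm (w t) = 0).
    apply: (@scaled_square_zero (exp (- (2 * C) * t))); first exact: exp_pos.
    rewrite -inner_norm; change (F t <= 0); lra. }
  move=> t; case: (Rle_dec 0 t) => ht; first exact: (forward B).
  have rev (v : R -> H) : (forall t, is_derive v t (B (v t))) -> forall t, is_derive (fun s => v (- s)) t (opp (B (v (- t)))).
  { move=> hv s; have -> : opp (B (v (- s))) = scal (-1) (B (v (- s))) by vec.
    apply: (is_derive_comp v (fun s => - s)); first exact: hv.
    auto_derive => //. }
  have := forward (fun x => opp (B x)) (fun s => y (- s)) (fun s => z (- s)) (- t) _ (rev y hy) (rev z hz) _ _.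
  rewrite Ropp_involutive; apply.
  - move=> x x'; have -> : minus (opp (B x)) (opp (B x')) = opp (minus (B x) (B x')) by vec.
    rewrite norm_opp; exact: hB.
  - by rewrite Ropp_0.
  - lra.
Qed.

Lemma continuous_on_half_line {V : Hilbert} (x : R -> V) : continuous_on half_line x ->
  forall t, continuous (fun s => x (Rmax 0 s)) t.
Proof.
  move=> hx t; apply/continuous_normP => r hr.
  have [d hd] := proj1 (filterlim_normP _ _) (hx (Rmax 0 t) (Rmax_l 0 t)) r hr.
  exists d; split; first exact: cond_pos.
  move=> s hs; apply: hd; last exact: Rmax_l.
  exact: Rle_lt_trans (Rmax0_lipschitz s t) hs.
Qed.

Lemma continuous_continuous_on {V : Hilbert} (I : R -> Prop) (x : R -> V) :
  (forall t, continuous x t) -> continuous_on I x.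
Proof. move=> hx t _; exact: filterlim_filter_le_1 (filter_le_within _) (hx t). Qed.

(** Mild solutions offer no derivative; instead the sum of the two distances is bounded by [2 L]
    times its own integral, the semigroups being contractions, and Gronwall's lemma applies. *)
Lemma forward_unique {X H : Hilbert} (SX : R -> X -> X) (SH : R -> H -> H) aX aH
  (f : X * H -> X) (g : X * H -> H) L (u1 u2 : R -> X) (v1 v2 : R -> H) :
  decaying SX aX -> 0 <= aX -> decaying SH aH -> 0 <= aH -> 0 <= L ->
  (forall w z, dist (f w) (f z) <= L * dist_sum w z) -> (forall w z, dist (g w) (g z) <= L * dist_sum w z) ->
  continuous_on half_line u1 -> continuous_on half_line u2 ->
  continuous_on half_line v1 -> continuous_on half_line v2 ->
  (forall t, 0 <= t -> mild SX (fun s => f (u1 s, v1 s)) u1 0 t) ->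
  (forall t, 0 <= t -> mild SX (fun s => f (u2 s, v2 s)) u2 0 t) ->
  (forall t, 0 <= t -> mild SH (fun s => g (u1 s, v1 s)) v1 0 t) ->
  (forall t, 0 <= t -> mild SH (fun s => g (u2 s, v2 s)) v2 0 t) ->
  u1 0 = u2 0 -> v1 0 = v2 0 -> forall t, 0 <= t -> u1 t = u2 t /\ v1 t = v2 t.
Proof.
  move=> hX aX0 hH aH0 L0 lf lg cu1 cu2 cv1 cv2 mu1 mu2 mv1 mv2 e1 e2.
  pose D s := norm (minus (u1 s) (u2 s)) + norm (minus (v1 s) (v2 s)).
  pose phi s := D (Rmax 0 s).
  have cphi s : continuous phi s.
  { apply: (continuous_plus (V := R_NormedModule) (fun s => norm (minus (u1 (Rmax 0 s)) (u2 (Rmax 0 s))))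
      (fun s => norm (minus (v1 (Rmax 0 s)) (v2 (Rmax 0 s))))).
    - apply: continuous_norm_fun; apply: continuous_minus; exact: continuous_on_half_line.
    - apply: continuous_norm_fun; apply: continuous_minus; exact: continuous_on_half_line. }
  have Iphi t : is_RInt phi 0 t (RInt phi 0 t).
  { apply: (RInt_correct (V := R_CompleteNormedModule)).
    apply: (ex_RInt_continuous (V := R_CompleteNormedModule)) => r _; exact: cphi. }
  have part (V : Hilbert) (S : R -> V -> V) aV (h : X * H -> V) (x1 x2 : R -> V) t : decaying S aV -> 0 <= aV ->
    (forall w z, dist (h w) (h z) <= L * dist_sum w z) -> x1 0 = x2 0 -> 0 <= t ->
    mild S (fun s => h (u1 s, v1 s)) x1 0 t -> mild S (fun s => h (u2 s, v2 s)) x2 0 t ->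
    norm (minus (x1 t) (x2 t)) <= L * RInt phi 0 t.
  { move=> hS aV0 lh h0 ht m1 m2.
    have m := mild_minus hS ht m1 m2; rewrite /mild h0 in m.
    have lin := decay_linear hS (t := t - 0) ltac:(lra).
    have E0 : minus (minus (x1 t) (x2 t)) (S (t - 0) (minus (x2 0) (x2 0))) = minus (x1 t) (x2 t).
    { rewrite (lin_minus _ _ lin); vec. }
    rewrite E0 in m.
    have hI := is_RInt_scal _ _ _ L _ (Iphi t).
    apply: (RInt_norm_le ht _ m hI) => s hs.
    apply: Rle_trans (decay_contraction hS aV0 _ _) _; first lra.
    apply: Rle_trans (lh _ _) _; rewrite /phi Rmax_right; last lra.
    exact: Rle_refl. }
  move=> t ht.
  have hphi : phi t <= 0.
  { apply: (@gronwall phi (2 * L) t) => //; [lra | | lra].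
    move=> s hs; rewrite {1}/phi Rmax_right /D; last lra.
    have k1 := part X SX aX f u1 u2 s hX aX0 lf e1 (proj1 hs) (mu1 s (proj1 hs)) (mu2 s (proj1 hs)).
    have k2 := part H SH aH g v1 v2 s hH aH0 lg e2 (proj1 hs) (mv1 s (proj1 hs)) (mv2 s (proj1 hs)).
    lra. }
  rewrite /phi Rmax_right // /D in hphi.
  have n1 := norm_nonneg (minus (u1 t) (u2 t)); have n2 := norm_nonneg (minus (v1 t) (v2 t)).
  split; apply: minus_eq0; lra.
Qed.

End Uniqueness.

(** * Lifting reduced solutions to the full system *)

Section SlowFlow.
Context {X H : Hilbert} (SX : R -> X -> X) (aX aQ a b : R).
Context (A : operator H) (Lam : R) (P : H -> H) (e : nat -> H) (l : nat -> R) (N : nat) (c : R) (S : R -> H -> H).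
Hypothesis hX : decaying SX aX.
Hypothesis sp : splitting A Lam P e l N.
Hypothesis hc : 0 < c.
Hypothesis gen : generated_by_opp (lifted A P c) S.
Hypothesis hb : forall k, l k <= Lam -> l k <= b.
Hypothesis hq_rate : forall k, Lam < l k -> aQ <= l k + c.
Hypothesis b0 : 0 <= b.
Hypothesis hab : b < a.
Hypothesis haX : a <= aX.
Hypothesis haQ : a <= aQ.
Context (f : X * H -> X) (g : X * H -> H) (Mf Mg L : R).
Hypothesis bf : forall w, norm (f w) <= Mf.
Hypothesis bg : forall w, norm (g w) <= Mg.
Hypothesis L0 : 0 <= L.
Hypothesis lf : forall w z, dist (f w) (f z) <= L * dist_sum w z.
Hypothesis lg : forall w z, dist (g w) (g z) <= L * dist_sum w z.
Hypothesis hK : LPconst a b L < 1.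

Local Notation SH := (SQ P S).
Local Notation AP := (AP Lam e l N).
Local Notation E := (spectral_group Lam e l N).
Local Notation traj := (traj SX SH aX aQ Lam P e l N f g Mf Mg).

Let hQ : decaying SH aQ := SQ_decaying sp hc gen hq_rate.
Let QSH t x (ht : 0 <= t) : coproj P (SH t x) = SH t x := Q_SQ sp hc gen x ht.

Context (hu : H -> X) (hq : H -> H) (C : R).
Hypothesis C_nonneg : 0 <= C.
Hypothesis on_graph : forall u p q, traj u p q -> forall t, t <= 0 -> u t = hu (p t) /\ q t = hq (p t).
Hypothesis lip_u : forall x y, norm (minus (hu x) (hu y)) <= C * norm (minus (P x) (P y)).
Hypothesis lip_q : forall x y, norm (minus (hq x) (hq y)) <= C * norm (minus (P x) (P y)).
Hypothesis Q_hq : forall x, coproj P (hq x) = hq x.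

Local Notation J := (graph_map hu hq).
(** A Lipschitz constant of [g] along the graph: 1 for [p] itself and [C] for each of [hu] and
    [hq]. *)
Definition LJ := L * (1 + 2 * C).

Lemma LJ_nonneg : 0 <= LJ.
Proof. apply: Rmult_le_pos; lra. Qed.

Lemma g_graph_lipschitz x y : norm (minus (g (J (P x))) (g (J (P y)))) <= LJ * norm (minus (P x) (P y)).
Proof.
  apply: Rle_trans (lg _ _) _; rewrite /LJ Rmult_assoc; apply: Rmult_le_compat_l => //.
  change (norm (minus (hu (P x)) (hu (P y))) + norm (minus (plus (P x) (hq (P x))) (plus (P y) (hq (P y))))
    <= (1 + 2 * C) * norm (minus (P x) (P y))).
  have h1 := lip_u (P x) (P y); have h2 := lip_q (P x) (P y); rewrite !(P_idem sp) in h1 h2.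
  have E0 : minus (plus (P x) (hq (P x))) (plus (P y) (hq (P y)))
    = plus (minus (P x) (P y)) (minus (hq (P x)) (hq (P y))) by vec.
  have := norm_split E0; lra.
Qed.

(** The argument of [J] is projected first, so that the field is globally Lipschitz and the flow can
    be built in all of [H]; on the range of [P] it is the field of the reduced equation. *)
Definition reduced_field x := minus (P (g (J (P x)))) (AP x).

Lemma field_lipschitz : exists M, forall x y, norm (minus (reduced_field x) (reduced_field y)) <= M * norm (minus x y).
Proof.
  have linAP : is_linear AP := mult_op_linear sp l.
  have [M [hM hb']] := linear_norm _ linAP.
  exists (LJ + M) => x y.
  have E0 : minus (reduced_field x) (reduced_field y)
    = plus (P (minus (g (J (P x))) (g (J (P y))))) (opp (AP (minus x y))).
  { rewrite /reduced_field (lin_minus _ _ (P_linear sp)) (lin_minus _ _ linAP); vec. }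
  have h1 := norm_split E0; rewrite norm_opp in h1.
  have h2 := P_norm sp (minus (g (J (P x))) (g (J (P y)))).
  have h3 := g_graph_lipschitz x y.
  have h4 := hb' (minus x y).
  have h5 := P_norm sp (minus x y); rewrite (lin_minus _ _ (P_linear sp)) in h5.
  have h6 := Rmult_le_compat_l _ _ _ LJ_nonneg h5.
  rewrite Rmult_plus_distr_r; apply: Rle_trans h1 _; apply: Rplus_le_compat; last exact: h4.
  exact: Rle_trans h2 (Rle_trans _ _ _ h3 h6).
Qed.

Lemma field_range x : P (reduced_field x) = reduced_field x.
Proof. by rewrite /reduced_field (lin_minus _ _ (P_linear sp)) (P_idem sp) (AP_range sp). Qed.

Lemma slow_flow_exists : exists phi : R -> H -> H,
  forall x, phi 0 x = x /\ forall t, is_derive (fun t => phi t x) t (reduced_field (phi t x)).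
Proof.
  have [M hM] := field_lipschitz.
  have [Phi hPhi] : exists Phi : H -> R -> H, forall x, Phi x 0 = x /\ forall t, is_derive (Phi x) t (reduced_field (Phi x t)).
  { apply: (@choose _ _ (fun x (y : R -> H) => y 0 = x /\ forall t, is_derive y t (reduced_field (y t)))) => x.
    apply: (@picard _ (fun _ x => reduced_field x) x M (norm (reduced_field x))).
    - by move=> _; exact: hM.
    - move=> y s; exact: continuous_const.
    - move=> _; exact: Rle_refl. }
  by exists (fun t x => Phi x t).
Qed.

Context (r : R -> H).
Hypothesis r_derive : forall t, is_derive r t (reduced_field (r t)).
Hypothesis r_range : P (r 0) = r 0.

Lemma r_in_range t : P (r t) = r t.
Proof. apply: (range_invariant sp r_derive) => // s; exact: field_range. Qed.

Lemma r_continuous t : continuous r t.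
Proof. exact: derive_continuous (r_derive t). Qed.

Lemma lipschitz_r_continuous {V : Hilbert} (h : H -> V) t :
  (forall x y, norm (minus (h x) (h y)) <= C * norm (minus (P x) (P y))) -> continuous (fun s => h (r s)) t.
Proof.
  move=> lh; apply: (continuous_dominated (k := fun s => C * norm (minus (r s) (r t)))).
  - apply: (continuous_scal_r (V := R_NormedModule)); apply: continuous_dist; exact: r_continuous.
  - rewrite minus_eq_zero norm_zeroR; ring.
  - move=> s; have := lh (r s) (r t); by rewrite !r_in_range.
Qed.

Lemma r_pgroup t0 t : pgroup Lam e l N (fun s => g (J (r s))) r t0 t.
Proof.
  apply: (pgroup_derive sp) => s; [ | exact: r_in_range | ].
  - have [_ h] := wcurve_continuous_f L0 lf lg s
      (fun t => lipschitz_r_continuous lip_u) (@r_continuous) (fun t => lipschitz_r_continuous lip_q).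
    exact: h.
  - have := r_derive s; by rewrite /reduced_field r_in_range.
Qed.

(* Both curves solve the same integral equation; a weight [exp (- lam t)] with [lam] large turns the
   comparison of the two into a contraction. *)
Lemma r_trajectory t1 : exists u p q, traj u p q /\ forall t, t <= 0 -> p t = r (t + t1).
Proof.
  have [u [p [q [ht hp]]]] := traj_exists hX hQ QSH sp hb b0 hab haX haQ bf bg L0 lf lg hK (r_in_range t1).
  exists u, p, q; split=> // t ht0.
  have LJ0 := LJ_nonneg.
  (* [lam - b = 2 LJ + 1], so each pass multiplies the bound by [LJ / (lam - b) <= 1 / 2]. The rate
     [eta] would not do, because [LJ] need not be small against the gap. *)
  pose lam := b + 2 * LJ + 1.
  have hlam : b < lam by rewrite /lam; lra.
  have Mg0 : 0 <= Mg by apply: Rle_trans (bg (zero, zero)); exact: norm_nonneg.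
  have [_ _ _ _ _ solP _ _ _ solp] := ht.
  pose G1 s := g (wcurve u p q s). pose G2 s := g (J (r (s + t1))).
  have pg s : s <= 0 -> pgroup Lam e l N (fun s => minus (G1 s) (G2 s)) (fun s => minus (p s) (r (s + t1))) 0 s.
  { move=> hs; apply: (pgroup_minus sp); first by apply: solp => //; exact: Rle_refl.
    apply: (pgroup_shift (F := fun s => g (J (r s))) (p := r)); exact: r_pgroup. }
  have z0 : norm (minus (p 0) (r (0 + t1))) = 0 by rewrite Rplus_0_l hp minus_eq_zero norm_zeroR.
  have dG s : s <= 0 -> norm (minus (G1 s) (G2 s)) <= LJ * norm (minus (p s) (r (s + t1))).
  { move=> hs; have [E1 E2] := on_graph ht hs; rewrite /G1 /G2 /wcurve E1 E2.
    have := g_graph_lipschitz (p s) (r (s + t1)); by rewrite solP // r_in_range. }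
  have w1 s : s <= 0 -> 1 <= exp (- lam * s).
  { move=> hs; rewrite -exp_0; apply: exp_le; rewrite /lam; nra. }
  have key n : forall s, s <= 0 -> norm (minus (p s) (r (s + t1))) <= 2 * Mg / (lam - b) * (1 / 2) ^ n * exp (- lam * s).
  { elim: n => [|n IH] s hs.
    - have h2 : 0 <= 2 * Mg by lra.
      have := pgroup_decay sp hb hlam h2 hs (pg s hs); rewrite z0 Rplus_0_l /= Rmult_1_r; apply=> r' hr'.
      have := norm_triangle_minus (G1 r') (G2 r'); have := bg (wcurve u p q r'); have := bg (J (r (r' + t1))).
      have := w1 r' hr'; rewrite /G1 /G2; nra.
    - set cn := 2 * Mg / (lam - b) * (1 / 2) ^ n in IH.
      have cn0 : 0 <= cn.
      { apply: Rmult_le_pos; last by apply: pow_le; lra. apply: Rdiv_le_0_compat; lra. }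
      have h2 : 0 <= LJ * cn by apply: Rmult_le_pos.
      have h3 := pgroup_decay sp hb hlam h2 hs (pg s hs); rewrite z0 Rplus_0_l in h3.
      have h4 : norm (minus (p s) (r (s + t1))) <= LJ * cn / (lam - b) * exp (- lam * s).
      { apply: h3 => r' hr'; apply: Rle_trans (dG r' hr') _; rewrite Rmult_assoc.
        apply: Rmult_le_compat_l => //; exact: IH. }
      apply: Rle_trans h4 _; apply: Rmult_le_compat_r; first by left; apply: exp_pos.
      have -> : 2 * Mg / (lam - b) * (1 / 2) ^ Datatypes.S n = cn * (1 / 2) by rewrite /cn /=; field; lra.
      have -> : LJ * cn / (lam - b) = cn * (LJ / (lam - b)) by field; lra.
      apply: Rmult_le_compat_l => //.
      apply: (Rmult_le_reg_r (lam - b)); first lra.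
      have -> : LJ / (lam - b) * (lam - b) = LJ by field; lra.
      rewrite /lam; lra. }
  apply: minus_eq0; have n0 := norm_nonneg (minus (p t) (r (t + t1))).
  have : norm (minus (p t) (r (t + t1))) <= 0; last lra.
  apply: (@le_of_geometric _ _ (2 * Mg / (lam - b) * exp (- lam * t)) (1 / 2)); first lra.
  move=> n; apply: Rle_trans (key n t ht0) _; right; ring.
Qed.

(** Time [t] is moved to 0, where [r_trajectory] provides a trajectory with [p] component [r]; lying
    on the graph, its other components are functions of [r]. As [t] is arbitrary, the whole line is
    covered. *)
Lemma r_mild_component {V : Hilbert} (T : R -> V -> V) (h : X * H -> V) (k : H -> V) t0 t : t0 <= t ->
  (forall u p q, traj u p q -> exists v, (forall s, s <= 0 -> v s = k (p s)) /\
     mild T (fun s => h (wcurve u p q s)) v (t0 - t) 0) ->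
  mild T (fun s => h (J (r s))) (fun s => k (r s)) t0 t.
Proof.
  move=> h0 hT; have [u [p [q [ht hp]]]] := r_trajectory t; have [v [hv hm]] := hT u p q ht.
  have h1 : mild T (fun s => h (J (r (s + t)))) (fun s => k (r (s + t))) (t0 - t) 0.
  { apply: mild_ext hm => [|s hs]; first lra.
    have hs0 : s <= 0 by lra.
    have [E1 E2] := on_graph ht hs0; by rewrite hv // /wcurve E1 E2 hp. }
  have h2 : mild T (fun s => h (J (r (s + - t + t)))) (fun s => k (r (s + - t + t))) t0 t.
  { apply: (mild_shift (F := fun s => h (J (r (s + t)))) (u := fun s => k (r (s + t)))).
    by rewrite Rplus_opp_r. }
  apply: mild_ext h2 => // s _; by have -> : s + - t + t = s by ring.
Qed.

Lemma r_mild_u t0 t : t0 <= t -> mild SX (fun s => f (J (r s))) (fun s => hu (r s)) t0 t.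
Proof.
  move=> h0; apply: r_mild_component => // u p q ht; exists u; split.
  - move=> s hs; exact: (proj1 (on_graph ht hs)).
  - apply: (sol_u ht); lra.
Qed.

Lemma r_mild_q t0 t : t0 <= t -> mild SH (fun s => g (J (r s))) (fun s => hq (r s)) t0 t.
Proof.
  move=> h0; apply: r_mild_component => // u p q ht; exists q; split.
  - move=> s hs; exact: (proj2 (on_graph ht hs)).
  - apply: (sol_q ht); lra.
Qed.

(** [S] is the sum of the group on the range of [P] and of [SQ]; [r] feels only the first and [hq]
    only the second, so the two integral equations add up. *)
Lemma r_mild_v t0 t : t0 <= t -> mild S (fun s => g (J (r s))) (fun s => plus (r s) (hq (r s))) t0 t.
Proof.
  move=> h0; have hp := @r_pgroup t0 t; have hm := r_mild_q h0.
  have lin := gen_linear gen (t := t - t0) ltac:(lra).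
  have E1 : S (t - t0) (r t0) = E (t - t0) (r t0).
  { rewrite (S_split sp hc gen (r t0)); last lra.
    rewrite /SQ /coproj r_in_range minus_eq_zero (linear_zero _ lin); vec. }
  have E2 : S (t - t0) (hq (r t0)) = SH (t - t0) (hq (r t0)) by rewrite /SQ Q_hq.
  rewrite /mild (lin_plus _ _ lin) E1 E2.
  have -> : minus (plus (r t) (hq (r t))) (plus (E (t - t0) (r t0)) (SH (t - t0) (hq (r t0))))
    = plus (minus (r t) (E (t - t0) (r t0))) (minus (hq (r t)) (SH (t - t0) (hq (r t0)))) by vec.
  apply: (is_RInt_ext (fun s => plus (E (t - s) (g (J (r s)))) (SH (t - s) (g (J (r s)))))).
  - move=> s; rewrite (Rmin_left _ _ _) // (Rmax_right _ _ _) // => hs.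
    symmetry; apply: (S_split sp hc gen); lra.
  - exact: is_RInt_plus hp hm.
Qed.

End SlowFlow.

(** * The slow manifold *)

Lemma sup_norm_bound {T : Type} {V : Hilbert} (f : T -> V) : (exists C, forall w, norm (f w) <= C) ->
  forall w, norm (f w) <= real (sup_norm everywhere f).
Proof.
  move=> [C hC] w; rewrite /sup_norm; set E := fun r => _.
  have [h1 h2] := Lub_Rbar_correct E.
  have m : Rbar_le (norm (f w)) (Lub_Rbar E) by apply: h1; exists w.
  have u : Rbar_le (Lub_Rbar E) C by apply: h2 => r [x [_ ->]]; exact: hC.
  by case: (Lub_Rbar E) m u.
Qed.

Lemma sup_norm_le {T : Type} {V : Hilbert} (D : T -> Prop) (f : T -> V) C :
  (forall w, D w -> norm (f w) <= C) -> Rbar_le (sup_norm D f) C.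
Proof.
  move=> hC; apply: (proj2 (Lub_Rbar_correct _)) => r [x [hx ->]]; exact: hC.
Qed.

Lemma lip_bound {T : Type} {V : Hilbert} (d : T -> T -> R) (f : T -> V) :
  (forall w z, 0 <= d w z) -> (exists L, forall w z, dist (f w) (f z) <= L * d w z) ->
  0 <= real (lip d everywhere f) /\ forall w z, dist (f w) (f z) <= real (lip d everywhere f) * d w z.
Proof.
  move=> hd [L hL]; rewrite /lip; set E := fun L => _.
  have [h1 h2] := Glb_Rbar_correct E.
  have u : Rbar_le (Glb_Rbar E) (Rmax 0 L).
  { apply: h1; split; first exact: Rmax_l.
    move=> x y _ _; apply: Rle_trans (hL x y) _; apply: Rmult_le_compat_r => //; exact: Rmax_r. }
  have m : Rbar_le 0 (Glb_Rbar E) by apply: h2 => r [hr _].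
  case EG : (Glb_Rbar E) m u h2 => [G | | ] //= m u h2; split=> // w z.
  (* Every admissible constant dominates the difference quotients, hence so does the infimum. Where
     [d] vanishes there is no quotient, but the given [L] forces the two values to coincide. *)
  case: (Rle_lt_or_eq_dec _ _ (hd w z)) => hwz.
  - have h3 : Rbar_le (dist (f w) (f z) / d w z) G.
    { apply: h2 => r [_ hr]; apply: (Rmult_le_reg_r (d w z)) => //.
      rewrite /Rdiv Rmult_assoc Rinv_l ?Rmult_1_r; [exact: hr | lra]. }
    have := Rmult_le_compat_r _ _ _ (hd w z) h3.
    rewrite /Rdiv Rmult_assoc Rinv_l ?Rmult_1_r //; lra.
  - have := hL w z; rewrite -hwz; lra.
Qed.

Lemma lip_le {T : Type} {V : Hilbert} (d : T -> T -> R) (D : T -> Prop) (f : T -> V) C : 0 <= C ->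
  (forall x y, D x -> D y -> norm (minus (f x) (f y)) <= C * d x y) ->
  Rbar_le (lip d D f) C /\ Rbar_le 0 (lip d D f).
Proof.
  move=> hC h; have [h1 h2] := Glb_Rbar_correct (fun L => 0 <= L /\ forall x y, D x -> D y -> norm (minus (f x) (f y)) <= L * d x y).
  split; [exact: h1 | apply: h2 => r [hr _]; exact: hr].
Qed.

Lemma dist_sum_nonneg {X H : Hilbert} (w z : X * H) : 0 <= dist_sum w z.
Proof. apply: Rplus_le_le_0_compat; exact: norm_ge_0. Qed.

Theorem theorem8p3
  (X H : Hilbert) (Af : operator X) (As : operator H)
  (f : X * H -> X) (g : X * H -> H) (omegaf mu delta eps : R) :
  infinite_dimensional H ->
  self_adjoint Af -> 0 < omegaf -> bounded_below_by omegaf Af ->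
  self_adjoint As -> bounded_below_by 0 As -> compact_resolvent As ->
  (exists C : R, forall w, norm (f w) <= C) ->
  (exists C : R, forall w, norm (g w) <= C) ->
  (exists L : R, forall w z, dist (f w) (f z) <= L * dist_sum w z) ->
  (exists L : R, forall w z, dist (g w) (g z) <= L * dist_sum w z) ->
  0 < mu -> 0 < delta <= 1 -> 0 < eps <= 1 ->
  let Mf := real (sup_norm everywhere f) in
  let Mg := real (sup_norm everywhere g) in
  let Lstar := Rmax (real (lip (@dist_sum X H) everywhere f))
                    (real (lip (@dist_sum X H) everywhere g)) in
  let G := gap As omegaf mu delta eps in
  let K := 6 * Lstar / G in
  0 < G -> K < 1 ->
  let PH := range (Pproj As mu eps) in
  let QH := range (Qproj As mu eps) in
  let sol := system_solution Af As f g mu delta eps in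
  exists (hu : H -> X) (hq : H -> H),
    let J := graph_map hu hq in
    finite_dimensional PH /\
    (forall p, PH p -> QH (hq p)) /\
    invariant sol (slow_manifold As mu eps hu hq) /\
    Rbar_le (sup_norm PH hu) (Mf * delta / omegaf) /\
    Rbar_le (sup_norm PH hq) (Mg / alpha As mu eps) /\
    Mg / alpha As mu eps <= Mg * eps ^ 2 / (mu + eps) /\
    Rbar_le (Rbar_plus (lip dist PH hu) (lip dist PH hq))
            (4 * Lstar / ((1 - K) * G)) /\
    conjugate_through PH (reduced_solution As g mu eps J) sol J.
Proof.
  move=> inf saf hom bbf sas poss cr bdf bdg lipf lipg hmu hdelta heps Mf Mg Lstar G K hG hK PH QH sol.
  have [e [l [N sp]]] := Pproj_splitting mu eps inf sas poss cr.
  set Lam := Lambda mu eps in sp; set P := Pproj As mu eps in sp.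
  have hc : 0 < / eps by apply: Rinv_0_lt_compat; lra.
  have hd : 0 < / delta by apply: Rinv_0_lt_compat; lra.
  pose S := semigroup (As_eps As mu eps).
  (* [As_eps As mu eps] and [lifted As P (/ eps)] are convertible, [Qproj] being [coproj P]. *)
  have saS : self_adjoint (lifted As P (/ eps)) := lifted_sa sp sas (/ eps).
  have posS : bounded_below_by 0 (lifted As P (/ eps)) := lifted_pos sp poss hc.
  have gen : generated_by_opp (lifted As P (/ eps)) S := semigroup_generated saS posS.
  pose Bf := op_scal (/ delta) Af.
  pose SX := semigroup Bf.
  pose aX := omegaf * / delta.
  have saB : self_adjoint Bf.
  { apply: (@sa_perturb _ Af saf Bf (/ delta) (fun _ => zero)) => //; first lra.
    - exact: is_linear_zero.
    - move=> x y; by rewrite inner_zero inner_zero_r.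
    - move=> x; by rewrite /= plus_zero_r. }
  have bB : bounded_below_by aX Bf.
  { move=> x hx; rewrite /= inner_scal /aX.
    have := Rmult_le_compat_l _ _ _ (Rlt_le _ _ hd) (bbf x hx); lra. }
  have aX0 : 0 < aX by apply: Rmult_lt_0_compat.
  have posB : bounded_below_by 0 Bf.
  { move=> x hx; have := bB x hx; have := Rmult_le_pos _ _ (Rlt_le _ _ aX0) (pow2_ge_0 (norm x)); lra. }
  have hX : decaying SX aX := gen_decaying saB (semigroup_generated saB posB) bB.
  (* The rate 0 of the full slow semigroup suffices for forward uniqueness. *)
  have hS : decaying S 0 := gen_decaying saS gen posS.
  have [b0 hb] := spectrum_P_sup sp sas.
  have [hLam hlp] := spectrum_Q_inf sp sas.
  rewrite -/PH -/(beta As mu eps) in b0 hb; set b := beta As mu eps in b0 hb.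
  rewrite -/QH -/(lambda_plus As mu eps) in hLam hlp.
  set aQ := alpha As mu eps.
  have hq_rate k : Lam < l k -> aQ <= l k + / eps by move=> /hlp; rewrite /aQ /alpha; lra.
  pose a := Rmin aX aQ.
  have EG : G = a - b by [].
  have hab : b < a by lra.
  have haX : a <= aX := Rmin_l _ _.
  have haQ : a <= aQ := Rmin_r _ _.
  have bf : forall w, norm (f w) <= Mf := sup_norm_bound bdf.
  have bg : forall w, norm (g w) <= Mg := sup_norm_bound bdg.
  have [Lf0 lf'] := lip_bound (@dist_sum_nonneg X H) lipf.
  have [Lg0 lg'] := lip_bound (@dist_sum_nonneg X H) lipg.
  have L0 : 0 <= Lstar by apply: Rle_trans Lf0 _; exact: Rmax_l.
  have lf w z : dist (f w) (f z) <= Lstar * dist_sum w z.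
  { apply: Rle_trans (lf' w z) _; apply: Rmult_le_compat_r; [exact: dist_sum_nonneg | exact: Rmax_l]. }
  have lg w z : dist (g w) (g z) <= Lstar * dist_sum w z.
  { apply: Rle_trans (lg' w z) _; apply: Rmult_le_compat_r; [exact: dist_sum_nonneg | exact: Rmax_r]. }
  have hK' : LPconst a b Lstar < 1 := hK.
  have hQ : decaying (SQ P S) aQ := SQ_decaying sp hc gen hq_rate.
  have QSH t x (ht : 0 <= t) := Q_SQ sp hc gen x ht.
  have [hu [hq [on_graph [bu [bq [Q_hq [lip_u lip_q]]]]]]] :=
    graph_exists hX hQ QSH sp hb b0 hab haX haQ bf bg L0 lf lg hK'.
  have hgam : 0 < gam a b by rewrite /gam; lra.
  set C := Lstar / gam a b / (1 - LPconst a b Lstar) in lip_u lip_q.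
  have C0 : 0 <= C.
  { apply: Rdiv_le_0_compat; last lra. exact: Rdiv_le_0_compat. }
  pose J := graph_map hu hq.
  pose fld := reduced_field Lam P e l N g hu hq.
  have PHP p : PH p <-> P p = p := P_range sp p.
  (* On the range of [P] the unbounded [As] is replaced by the bounded [AP], which turns the reduced
     equation into an ordinary differential equation with Lipschitz field. *)
  have redP r : reduced_solution As g mu eps J r <->
      (forall t, P (r t) = r t) /\ forall t, is_derive r t (fld (r t)).
  { have E t : P (r t) = r t -> fld (r t) = minus (P (g (J (r t)))) (As (r t)).
    { move=> h; have [_ hA] := AP_P sp sas (r t); rewrite h in hA; by rewrite /fld /reduced_field h hA. }
    split=> [[h1 h2] | [h1 h2]].
    - have h3 t : P (r t) = r t by apply/PHP; exact: h1.
      split=> // t; rewrite E //; exact: h2.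
    - split=> t; first by apply/PHP.
      rewrite -/P -E //; exact: h2. }
  have solJ r I : reduced_solution As g mu eps J r -> sol I (fun t => J (r t)).
  { move=> /redP [h1 h2]; split; split.
    - apply: continuous_continuous_on => t; exact: (lipschitz_r_continuous sp h2 (h1 0) lip_u).
    - move=> t0 t _ _ ht.
      exact: (r_mild_u hX sp hc gen hb hq_rate b0 hab haX haQ bf bg L0 lf lg hK' C0 on_graph lip_u lip_q h2 (h1 0) ht).
    - apply: continuous_continuous_on => t; apply: continuous_plus.
      + exact: derive_continuous (h2 t).
      + exact: (lipschitz_r_continuous sp h2 (h1 0) lip_q).
    - move=> t0 t _ _ ht.
      exact: (r_mild_v hX sp hc gen hb hq_rate b0 hab haX haQ bf bg L0 lf lg hK' C0 on_graph lip_u lip_q Q_hq h2 (h1 0) ht). }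
  have uniq w1 w2 : sol half_line w1 -> sol half_line w2 -> w1 0 = w2 0 -> forall t, 0 <= t -> w1 t = w2 t.
  { move=> [[cu1 mu1] [cv1 mv1]] [[cu2 mu2] [cv2 mv2]] h0 t ht.
    have pair (V : Hilbert) (T : R -> V -> V) (h : X * H -> V) (x : R -> V) (w : R -> X * H) s : 0 <= s ->
      mild T (fun s => h (w s)) x 0 s -> mild T (fun s => h (fst (w s), snd (w s))) x 0 s.
    { move=> hs hm; apply: mild_ext hm => // r _; by rewrite -surjective_pairing. }
    have z0 : half_line 0 := Rle_refl 0.
    have [E1 E2] := forward_unique hX (Rlt_le _ _ aX0) hS (Rle_refl 0) L0 lf lg cu1 cu2 cv1 cv2
      (fun s hs => pair _ _ f _ w1 s hs (mu1 0 s z0 hs hs)) (fun s hs => pair _ _ f _ w2 s hs (mu2 0 s z0 hs hs))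
      (fun s hs => pair _ _ g _ w1 s hs (mv1 0 s z0 hs hs)) (fun s hs => pair _ _ g _ w2 s hs (mv2 0 s z0 hs hs))
      (f_equal fst h0) (f_equal snd h0) ht.
    by rewrite (surjective_pairing (w1 t)) (surjective_pairing (w2 t)) E1 E2. }
  have [phi hphi] := slow_flow_exists sp L0 lg C0 lip_u lip_q.
  have phiP p : P p = p -> forall t, P (phi t p) = phi t p.
  { move=> hp; apply: (range_invariant sp (proj2 (hphi p))); last by rewrite (proj1 (hphi p)).
    move=> s; exact: (field_range sp). }
  have phi_red p : PH p -> reduced_solution As g mu eps J (fun t => phi t p).
  { move=> /PHP hp; apply/redP; split; [exact: phiP | exact: (proj2 (hphi p))]. }
  have phi0 p : phi 0 p = p := proj1 (hphi p).
  have P_hq p : P (hq p) = zero by rewrite -Q_hq (PQ_zero sp).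
  (* [P] recovers [p] from the slow component, as [hq] takes values in the kernel of [P]. *)
  have J_inj p p' : P p = p -> P p' = p' -> J p = J p' -> p = p'.
  { move=> hp hp' [_ E]; have := f_equal P E.
    by rewrite !(lin_plus _ _ (P_linear sp)) !P_hq hp hp' !plus_zero_r. }
  exists hu, hq; split; [ | split; [ | split; [ | split; [ | split; [ | split; [ | split]]]]]].
  - exact: (range_P_finite sp).
  - move=> p _; exists (hq p); by rewrite -{1}Q_hq.
  - split.
    + move=> w hw [p [hp E0]] t ht.
      exists (phi t p); split; first by apply/PHP; apply: phiP; apply/PHP.
      apply: (uniq w (fun t => J (phi t p)) hw (solJ _ _ (phi_red p hp))) => //.
      by rewrite phi0.
    + move=> m [p [hp ->]]; exists (fun t => J (phi t p)); split; [ | split].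
      * exact: solJ (phi_red p hp).
      * by rewrite phi0.
      * move=> t; exists (phi t p); split=> //; apply/PHP; apply: phiP; exact/PHP.
  - have -> : Mf * delta / omegaf = Mf / aX by rewrite /aX; field; lra.
    apply: sup_norm_le => p _; exact: bu.
  - apply: sup_norm_le => p _; exact: bq.
  - have Mg0 : 0 <= Mg by apply: Rle_trans (bg (zero, zero)); exact: norm_nonneg.
    rewrite -/aQ.
    (* The infimum of the upper spectrum is at least [Lam], so [alpha] is at least
       [Lam + 1 / eps]. *)
    have h1 : (mu + eps) / eps ^ 2 <= aQ.
    { have -> : (mu + eps) / eps ^ 2 = Lam + / eps by rewrite /Lam /Lambda; field; lra.
      rewrite /aQ /alpha; lra. }
    have h2 : 0 < (mu + eps) / eps ^ 2 by apply: Rdiv_lt_0_compat; nra.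
    have -> : Mg * eps ^ 2 / (mu + eps) = Mg / ((mu + eps) / eps ^ 2) by field; lra.
    apply: Rmult_le_compat_l => //; exact: Rinv_le_contravar.
  - have lipP (V : Hilbert) (h : H -> V) : (forall x y, norm (minus (h x) (h y)) <= C * norm (minus (P x) (P y))) ->
      Rbar_le (lip dist PH h) C /\ Rbar_le 0 (lip dist PH h).
    { move=> hh; apply: lip_le => // x y /PHP hx /PHP hy; have := hh x y; by rewrite hx hy. }
    have [u1 u0] := lipP X hu lip_u; have [q1 q0] := lipP H hq lip_q.
    (* [gam] is [G / 2], so twice [C = L / (gam (1 - K))] is the stated constant. *)
    have -> : 4 * Lstar / ((1 - K) * G) = C + C.
    { change (4 * Lstar / ((1 - LPconst a b Lstar) * (a - b)) = C + C).
      rewrite /C /gam; field; split; lra. }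
    case: (lip dist PH hu) u1 u0 => [x | | ] //= u1 u0.
    case: (lip dist PH hq) q1 q0 => [y | | ] //= q1 q0; lra.
  - exists phi; split; [ | split].
    + move=> p hp; split; [exact: phi_red | split; first exact: phi0].
      move=> r /redP [h1 h2] h0 t.
      have [M hM] := field_lipschitz sp L0 lg C0 lip_u lip_q.
      apply: (ode_unique hM h2 (proj2 (hphi p))); by rewrite phi0.
    + move=> p hp; split; first exact: solJ (phi_red p hp).
      move=> w hw h0 t ht; apply: (uniq w (fun t => J (phi t p)) hw (solJ _ _ (phi_red p hp))) => //.
      by rewrite phi0.
    + move=> r hr; split; first by apply: solJ.
      move=> [[cu mu'] [cv mv']]; apply/redP.
      have rP t : P (r t) = r t by apply/PHP.
      (* Full solutions are unique forward only. Starting at [t - 1] puts [t] in the interior of the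
         interval where [r] coincides with the reduced flow through [r t0], which yields the
         two-sided derivative at [t]. *)
      split=> // t; set t0 := t - 1.
      have shift : sol half_line (fun s => J (r (s + t0))).
      { have cs (V : Hilbert) (v : R -> V) : continuous_on everywhere v -> continuous_on half_line (fun s => v (s + t0)).
        { move=> hv; apply: continuous_continuous_on => s; apply: (continuous_comp (fun s => s + t0) v).
          - apply: ex_derive_continuous; by auto_derive.
          - have le : filter_le (locally (s + t0)) (within everywhere (locally (s + t0))).
            { move=> Q' [d hd']; exists d => y hy; exact: hd'. }
            exact: filterlim_filter_le_1 le (hv (s + t0) I). }
        split; split.
        - exact: (cs X (fun s => hu (r s)) cu).
        - move=> s0 s _ _ hs; exact: (mild_shift (F := fun s => f (J (r s))) (u := fun s => hu (r s)) (mu' (s0 + t0) (s + t0) I I ltac:(lra))).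
        - exact: (cs H (fun s => plus (r s) (hq (r s))) cv).
        - move=> s0 s _ _ hs; exact: (mild_shift (F := fun s => g (J (r s))) (u := fun s => plus (r s) (hq (r s))) (mv' (s0 + t0) (s + t0) I I ltac:(lra))). }
      have eqr s : 0 <= s -> r (s + t0) = phi s (r t0).
      { move=> hs; apply: J_inj; [exact: rP | exact: phiP (rP t0) s | ].
        apply: (uniq _ (fun s => J (phi s (r t0))) shift (solJ _ _ (phi_red _ (hr t0)))) => //.
        by rewrite phi0 Rplus_0_l. }
      have sub_add (s : R) : s - t0 + t0 = s by ring.
      have Et : r t = phi (t - t0) (r t0).
      { rewrite -eqr; [congr r; symmetry; exact: sub_add | rewrite /t0; lra]. }
      rewrite Et; apply: (is_derive_ext_loc (fun s => phi (s - t0) (r t0))).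
      * exists (mkposreal 1 Rlt_0_1) => s hs; have [h1 h2] := Rabs_def2 _ _ (hs : Rabs (s - t) < 1).
        rewrite -eqr; [congr r; exact: sub_add | rewrite /t0; lra].
      * have -> : fld (phi (t - t0) (r t0)) = scal 1 (fld (phi (t - t0) (r t0))) by rewrite scal_one.
        apply: (is_derive_comp (fun s => phi s (r t0)) (fun s => s - t0)); first exact: (proj2 (hphi _)).
        auto_derive => //.
Qed.
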